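(* Let $n\ge2$ and let $\lambda=(\lambda_1,\dots,\lambda_n)$ be a $\mathfrak{gl}_n$-weight such that $\lambda_1-\lambda_n\notin\mathbb Z_{\ge 1-n}$, and $\lambda_r-\lambda_s\notin\mathbb Z$ for all $1\le s\le n$ and all $r\in\{1,\dots,n\}$ with $r\notin\{1,s,n\}$. Then the Verma module $M(\lambda)$ is a $\sigma$-relation module for all $\sigma\in S_n$.
   Context: A $\mathfrak{gl}_n$-weight is a tuple $\lambda=(\lambda_1,\dots,\lambda_n)\in\mathbb C^n$, $\lambda_i$ being the value on the matrix unit $E_{ii}\in\mathfrak{gl}_n(\mathbb C)$. $M(\lambda)$ is the Verma module of highest weight $\lambda$ for the standard (upper triangular) Borel subalgebra. **Relation graphs and relation modules.** Let $\mathfrak V=\{(i,j): 1\le j\le i\le n\}$; $(k,1),\dots,(k,k)$ form row $k$, row $n$ being the top row. A Gelfand-Tsetlin tableau $T(L)$ is a triangular array of complex numbers $l_{ij}$ indexed by $(i,j)\in\mathfrak V$. All graphs are directed graphs on $\mathfrak V$ whose arrows connect only vertices in consecutive rows or vertices of row $n$, without oriented cycles or multiple arrows. $G$ is non-critical if any two vertices in the same row $k<n$ lying in the same connected component of the underlying unoriented graph are joined by an oriented path from one to the other. $T(L)$ satisfies $G$ if for each arrow $(i,j)\to(r,s)$ one has $l_{ij}-l_{rs}\in\mathbb Z_{\ge0}$ when the arrow is horizontal or points down ($r=i-1$), and $l_{ij}-l_{rs}\in\mathbb Z_{>0}$ when it points up ($r=i+1$). $T(L)$ is a $G$-realization if it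 satisfies $G$ and, for all $1\le k\le n-1$, $l_{ki}-l_{kj}\in\mathbb Z$ only if $(k,i),(k,j)$ are in the same connected component. For a $G$-realization $T(L)$, $V_G(T(L))$ is the complex vector space with basis all $G$-realizations $T(L+z)$, $z$ an integer array with $z_{ni}=0$ for all $i$. A non-critical $G$ is a relation graph if for every $G$-realization $T(L)$ the Gelfand-Tsetlin formulas $$E_{k,k+1}T(L)=-\sum_{i=1}^k\frac{\prod_{j=1}^{k+1}(l_{ki}-l_{k+1,j})}{\prod_{j\ne i}(l_{ki}-l_{kj})}T(L+\delta^{ki}),\quad E_{k+1,k}T(L)=\sum_{i=1}^k\frac{\prod_{j=1}^{k-1}(l_{ki}-l_{k-1,j})}{\prod_{j\ne i}(l_{ki}-l_{kj})}T(L-\delta^{ki}),$$ $$E_{kk}T(L)=\Big(k-1+\sum_{i=1}^kl_{ki}-\sum_{i=1}^{k-1}l_{k-1,i}\Big)T(L)$$ define a $\mathfrak{gl}_n$-module structure on $V_G(T(L))$; here $T(L\pm\delta^{ki})$ is $T(L)$ with $\pm1$ added to entry $(k,i)$, and a summand is $0$ by definition if the new tableau is not a $G$-realization. Modules isomorphic to $V_G(T(L))$ for some relation graph $G$ and some $G$-realization $T(L)$ are called relation modules. **$\sigma$-relation modules.** For a $\mathfrak{gl}_n$-module $N$ and $\sigma\in S_n$, $N^\sigma$ is the same vector space with action $x\cdot_\sigma m=\varphi_\sigma(x)\cdot m$, where $\varphi_\sigma(E_{ij})=E_{\sigma(i)\sigma(j)}$. A $\mathfrak{gl}_n$-module is a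 $\sigma$-relation module if it is isomorphic to $N^\sigma$ for some relation module $N$. *)

(* Defs.v *)
From HB Require Import structures.
From mathcomp Require Import all_boot all_order all_fingroup all_algebra.
From mathcomp Require Import generic_quotient ring_quotient.
From mathcomp Require Import boolp reals.
From mathcomp Require Import complex.
From mathcomp Require Import finmap monalg.

Set Implicit Arguments.
Unset Strict Implicit.
Unset Printing Implicit Defensive.

Import Order.TTheory GRing.Theory Num.Theory.
Local Open Scope ring_scope.
Local Open Scope quotient_scope.

Definition is_int (K : numFieldType) (x : K) : Prop :=
  exists m : int, x = m%:~R.

Definition int_ge (K : numFieldType) (a : int) (x : K) : Prop :=
  exists2 m : int, a <= m & x = m%:~R.

Section GlModules.
Variables (K : numFieldType) (n : nat).

Record is_gl_action (V : lmodType K) (act : 'M[K]_n -> V -> V) : Prop :=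
  IsGlAction {
    gl_act_linear_l : forall (c : K) (x y : 'M[K]_n) (v : V),
      act (c *: x + y) v = c *: act x v + act y v;
    gl_act_linear_r : forall (c : K) (x : 'M[K]_n) (v w : V),
      act x (c *: v + w) = c *: act x v + act x w;
    gl_act_bracket : forall (x y : 'M[K]_n) (v : V),
      act (x *m y - y *m x) v = act x (act y v) - act y (act x v) }.

Record gl_module := GlModule {
  gl_space :> lmodType K;
  gl_act : 'M[K]_n -> gl_space -> gl_space;
  gl_actP : is_gl_action gl_act }.

Definition gl_iso (M N : gl_module) : Prop :=
  exists f : M -> N,
    [/\ bijective f,
        forall (c : K) (v w : M), f (c *: v + w) = c *: f v + f w &
        forall (x : 'M[K]_n) (v : M), f (gl_act x v) = gl_act x (f v)].

End GlModules.

Section Twist.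
Variables (K : numFieldType) (n : nat) (s : 'S_n).

Definition twist_mx (x : 'M[K]_n) : 'M[K]_n :=
  \sum_(i < n) \sum_(j < n) x i j *: delta_mx (s i) (s j).

Lemma twist_mxE (x : 'M[K]_n) i j : twist_mx x (s i) (s j) = x i j.
Proof.
rewrite summxE (bigD1 i) //= summxE (bigD1 j) //= !mxE !eqxx mulr1.
rewrite big1 => [|k kj]; last first.
  by rewrite !mxE eqxx (inj_eq perm_inj) eq_sym (negPf kj) mulr0.
rewrite big1 ?addr0 // => k ki; rewrite summxE big1 // => l _.
by rewrite !mxE (inj_eq perm_inj) eq_sym (negPf ki) mulr0.
Qed.

Lemma twist_mxP (x y : 'M[K]_n) :
  (forall i j, y (s i) (s j) = x i j) -> twist_mx x = y.
Proof.
move=> h; apply/matrixP=> i j.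
by rewrite -(permKV s i) -(permKV s j) twist_mxE h.
Qed.

Lemma twist_mx_linear c x y :
  twist_mx (c *: x + y) = c *: twist_mx x + twist_mx y.
Proof. by apply: twist_mxP => i j; rewrite !mxE !twist_mxE. Qed.

Lemma twist_mxB x y : twist_mx (x - y) = twist_mx x - twist_mx y.
Proof. by apply: twist_mxP => i j; rewrite !mxE !twist_mxE. Qed.

Lemma twist_mxM x y : twist_mx (x *m y) = twist_mx x *m twist_mx y.
Proof.
apply: twist_mxP => i j; rewrite !mxE (reindex_inj (@perm_inj _ s)) /=.
by apply: eq_bigr => k _; rewrite !twist_mxE.
Qed.

Lemma gl_twistP (N : gl_module K n) :
  is_gl_action (fun x (v : N) => gl_act (twist_mx x) v).
Proof.
have [hl hr hb] := gl_actP N; split=> *.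
- by rewrite twist_mx_linear hl.
- by rewrite hr.
- by rewrite twist_mxB !twist_mxM hb.
Qed.

Definition gl_twist (N : gl_module K n) : gl_module K n :=
  GlModule (gl_twistP N).

End Twist.

Definition subspace (K : numFieldType) (V : lmodType K) (I : V -> Prop) : Prop :=
  I 0 /\ forall (c : K) (u v : V), I u -> I v -> I (c *: u + v).

Section QuotientLmodule.
Variables (K : numFieldType) (V : lmodType K) (I : V -> Prop).
Variable subI : subspace I.

Definition subspace_pred of subspace I : V -> bool := fun v => `[< I v >].

Lemma subspace_pred_zmod : zmod_closed (subspace_pred subI).
Proof.
have [I0 IZ] := subI; split=> [|u v /asboolP Iu /asboolP Iv]; apply/asboolP => //.
by rewrite addrC -scaleN1r; apply: IZ.
Qed.

HB.instance Definition _ :=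
  GRing.isZmodClosed.Build V (subspace_pred subI) subspace_pred_zmod.

Definition lquot : Type :=
  Quotient.quot (GRing.ZmodClosed.clone V (subspace_pred subI) _).
HB.instance Definition _ := Choice.on lquot.
HB.instance Definition _ := GRing.Zmodule.on lquot.

Definition lquot_pi (v : V) : lquot :=
  \pi_(Quotient.quot (GRing.ZmodClosed.clone V (subspace_pred subI) _)) v.
Definition lquot_repr (q : lquot) : V :=
  repr (q : Quotient.quot (GRing.ZmodClosed.clone V (subspace_pred subI) _)).

Lemma lquot_reprK : cancel lquot_repr lquot_pi.
Proof. by move=> q; apply: reprK. Qed.

Lemma lquot_surj (q : lquot) : exists f, q = lquot_pi f.
Proof. by exists (lquot_repr q); rewrite lquot_reprK. Qed.

Lemma lquot_eqP (f g : V) : lquot_pi f = lquot_pi g <-> I (f - g).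
Proof.
split=> [/eqP h|h].
  by move: h; rewrite -[_ == _]Quotient.idealrBE => /asboolP.
by apply/eqP; rewrite -[_ == _]Quotient.idealrBE; apply/asboolP.
Qed.

Lemma lquot_piD f g : lquot_pi (f + g) = lquot_pi f + lquot_pi g.
Proof. exact: raddfD. Qed.

Lemma lquot_piB f g : lquot_pi (f - g) = lquot_pi f - lquot_pi g.
Proof. exact: raddfB. Qed.

Definition lquot_map (h : V -> V) (q : lquot) : lquot :=
  lquot_pi (h (lquot_repr q)).

Lemma lquot_map_pi (h : V -> V) (f : V) :
  (forall u v, h (u - v) = h u - h v) -> (forall u, I u -> I (h u)) ->
  lquot_map h (lquot_pi f) = lquot_pi (h f).
Proof.
move=> hB hI; apply/lquot_eqP; rewrite -hB; apply: hI.
by apply/lquot_eqP; rewrite lquot_reprK.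
Qed.

Definition lquot_scale (c : K) : lquot -> lquot := lquot_map (fun v => c *: v).

Lemma lquot_scale_pi c f : lquot_scale c (lquot_pi f) = lquot_pi (c *: f).
Proof.
apply: lquot_map_pi => [u v|u uI]; rewrite ?scalerBr //.
by have [I0 IZ] := subI; rewrite -[_ *: _]addr0; apply: IZ.
Qed.

Fact lquot_scaleA a b v :
  lquot_scale a (lquot_scale b v) = lquot_scale (a * b) v.
Proof. by have [f ->] := lquot_surj v; rewrite !lquot_scale_pi scalerA. Qed.

Fact lquot_scale1 : left_id 1 lquot_scale.
Proof.
by move=> v; have [f ->] := lquot_surj v; rewrite lquot_scale_pi scale1r.
Qed.

Fact lquot_scaleDr : right_distributive lquot_scale +%R.
Proof.
move=> c v w; have [[f ->] [g ->]] := (lquot_surj v, lquot_surj w).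
by rewrite -lquot_piD !lquot_scale_pi -lquot_piD scalerDr.
Qed.

Fact lquot_scaleDl v : {morph lquot_scale^~ v : a b / a + b}.
Proof.
move=> a b; have [f ->] := lquot_surj v.
by rewrite !lquot_scale_pi -lquot_piD scalerDl.
Qed.

HB.instance Definition _ := GRing.Zmodule_isLmodule.Build K lquot
  lquot_scaleA lquot_scale1 lquot_scaleDr lquot_scaleDl.

Lemma lquot_pi_linear c f g :
  lquot_pi (c *: f + g) = c *: lquot_pi f + lquot_pi g.
Proof. by rewrite lquot_piD -lquot_scale_pi. Qed.

End QuotientLmodule.

Lemma malg_scaleAr (K : comNzRingType) (W : monomType) (c : K)
  (f g : {malg K[W]}) : f * (c *: g) = c *: (f * g).
Proof.
apply/malgP => k.
rewrite mcoeffZ (mcoeffMlw _ (fsubset_refl _) (msuppZ_le c g)).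
rewrite mcoeffMl mulr_sumr; apply: eq_bigr => i _.
rewrite mulr_sumr; apply: eq_bigr => j _.
by rewrite mcoeffZ mulrnAr mulrCA.
Qed.

Lemma malgU_linear (K : nzRingType) (B : choiceType) (c x y : K) (b : B) :
  << c * x + y *g b >> = c *: << x *g b >> + << y *g b >>.
Proof.
by apply/malgP => k; rewrite mcoeffD mcoeffZ !mcoeffU mulrnAr -mulrnDl.
Qed.

Section LeftModule.
Variables (K : numFieldType) (n : nat) (W : monomType).
Variables (iota : 'M[K]_n -> {malg K[W]}) (I : {malg K[W]} -> Prop).
Variable subI : subspace I.
Hypothesis iota_linear :
  forall c x y, iota (c *: x + y) = c *: iota x + iota y.
Hypothesis I_left : forall f g, I g -> I (f * g).
Hypothesis I_lie : forall x y f,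
  I ((iota x * iota y - iota y * iota x - iota (x *m y - y *m x)) * f).

Definition left_act (x : 'M[K]_n) : lquot subI -> lquot subI :=
  lquot_map (fun f => iota x * f).

Lemma left_act_pi x f :
  left_act x (lquot_pi subI f) = lquot_pi subI (iota x * f).
Proof. by apply: lquot_map_pi => [u v|u uI]; [rewrite mulrBr|apply: I_left]. Qed.

Lemma left_actP : is_gl_action left_act.
Proof.
split=> [c x y v|c x v w|x y v].
- have [f ->] := lquot_surj v; rewrite !left_act_pi iota_linear mulrDl.
  by rewrite -scalerAl lquot_pi_linear.
- have [[f ->] [g ->]] := (lquot_surj v, lquot_surj w).
  rewrite -lquot_pi_linear !left_act_pi mulrDr malg_scaleAr.
  by rewrite lquot_pi_linear.
- have [f ->] := lquot_surj v; rewrite !left_act_pi -lquot_piB.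
  apply/esym/lquot_eqP; rewrite !mulrA -!mulrBl; exact: I_lie.
Qed.

End LeftModule.

(* M(lam) = U(gl_n) / U(gl_n) <E_ij (i < j), E_ii - lam_i>.  Since U(gl_n) is
   itself a quotient of the tensor algebra of gl_n, M(lam) is presented
   directly as the quotient of that tensor algebra (the free algebra on the
   n^2 matrix units) by the left ideal [verma_ideal]; in the constructor
   [verma_lie] the factor f on the right makes this left ideal contain the
   two-sided ideal that defines U(gl_n). *)

Section Verma.
Variables (K : numFieldType) (n : nat).

Definition gl_letter : choiceType := ('I_n * 'I_n)%type.
Definition gl_word : monomType := {fmonom gl_letter}.
Local Notation gl_tensor := {malg K[gl_word]}.

Definition gl_inj (x : 'M[K]_n) : gl_tensor :=
  \sum_(i < n) \sum_(j < n)
    << x i j *g (fmu ((i, j) : gl_letter) : gl_word) >>.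

Inductive verma_ideal (lam : 'I_n -> K) : gl_tensor -> Prop :=
| verma_zero : verma_ideal lam 0
| verma_add f g : verma_ideal lam f -> verma_ideal lam g ->
    verma_ideal lam (f + g)
| verma_mul f g : verma_ideal lam g -> verma_ideal lam (f * g)
| verma_lie (x y : 'M[K]_n) f :
    verma_ideal lam
      ((gl_inj x * gl_inj y - gl_inj y * gl_inj x
        - gl_inj (x *m y - y *m x)) * f)
| verma_nilp (i j : 'I_n) : (i < j)%N ->
    verma_ideal lam (gl_inj (delta_mx i j))
| verma_cartan (i : 'I_n) :
    verma_ideal lam (gl_inj (delta_mx i i) - lam i *: 1).

Lemma gl_inj_linear c x y : gl_inj (c *: x + y) = c *: gl_inj x + gl_inj y.
Proof.
rewrite /gl_inj scaler_sumr -big_split /=; apply: eq_bigr => i _.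
rewrite scaler_sumr -big_split /=; apply: eq_bigr => j _.
by rewrite !mxE malgU_linear.
Qed.

Variable lam : 'I_n -> K.

Lemma verma_ideal_subspace : subspace (verma_ideal lam).
Proof.
split=> [|c f g hf hg]; first exact: verma_zero.
by rewrite -mul_malgC; apply: verma_add => //; apply: verma_mul.
Qed.

Lemma verma_actP : is_gl_action (left_act gl_inj (subI := verma_ideal_subspace)).
Proof.
apply: left_actP => [c x y|f g hg|x y f].
- exact: gl_inj_linear.
- exact: verma_mul.
- exact: verma_lie.
Qed.

Definition verma : gl_module K n := GlModule verma_actP.

End Verma.

Section RelationModules.
Variables (K : numFieldType) (n : nat).

(* The pair (i, j) of ordinals encodes the vertex (i+1, j+1) of the usual
   1-based indexing; [vrow] is the 1-based row number. *)
Definition vertex : finType := {v : 'I_n * 'I_n | (v.2 <= v.1)%N}.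
Definition vrow (v : vertex) : nat := (val v).1.+1.

Definition tableau : choiceType := {ffun vertex -> K}.

Definition same_component (G : rel vertex) : rel vertex :=
  connect (fun v w => G v w || G w v).

(* Acyclicity rules out loops and pairs of opposite arrows; a boolean relation
   has no other multiple arrows. *)
Definition admissible_graph (G : rel vertex) : Prop :=
  (forall v w, G v w ->
     [\/ vrow v = (vrow w).+1, vrow w = (vrow v).+1 | vrow v = n /\ vrow w = n]) /\
  (forall v w, G v w -> ~~ connect G w v).

Definition non_critical (G : rel vertex) : Prop :=
  forall v w, vrow v = vrow w -> (vrow v < n)%N -> same_component G v w ->
    connect G v w \/ connect G w v.

Definition satisfies (G : rel vertex) (L : tableau) : Prop :=
  forall v w, G v w ->
    if vrow w == (vrow v).+1 then int_ge 1 (L v - L w) else int_ge 0 (L v - L w).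

Definition realization (G : rel vertex) (L : tableau) : Prop :=
  satisfies G L /\
  forall v w, vrow v = vrow w -> (vrow v < n)%N ->
    is_int (L v - L w) -> same_component G v w.

Definition int_shift (L M : tableau) : Prop :=
  exists z : vertex -> int,
    (forall v, vrow v = n -> z v = 0) /\ M = [ffun v => L v + (z v)%:~R].

Definition gt_basis_pred (G : rel vertex) (L : tableau) : pred tableau :=
  fun M => `[< realization G M /\ int_shift L M >].

Definition gt_basis (G : rel vertex) (L : tableau) : choiceType :=
  {M : tableau | gt_basis_pred G L M}.

Definition gt_space (G : rel vertex) (L : tableau) : lmodType K :=
  {malg K[gt_basis G L]}.

Definition gt_vec (G : rel vertex) (L M : tableau) : gt_space G L :=
  if insub M is Some b then << (b : gt_basis G L) >> else 0.

Definition gt_shift (v : vertex) (c : K) (M : tableau) : tableau :=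
  [ffun w => M w + (if w == v then c else 0)].

Definition gt_denom (M : tableau) (v : vertex) : K :=
  \prod_(w : vertex | (vrow w == vrow v) && (w != v)) (M v - M w).

(* The Gelfand-Tsetlin formulas; the matrix unit E_{k,l} is [delta_mx i j]
   with k = i+1, l = j+1. *)
Definition gt_action (G : rel vertex) (L : tableau)
    (act : 'M[K]_n -> gt_space G L -> gt_space G L) : Prop :=
  forall M : tableau, gt_basis_pred G L M ->
  [/\ forall i j : 'I_n, j = i.+1 :> nat ->
        act (delta_mx i j) (gt_vec G L M) =
        - \sum_(v : vertex | vrow v == i.+1)
            ((\prod_(w : vertex | vrow w == i.+2) (M v - M w)) / gt_denom M v)
              *: gt_vec G L (gt_shift v 1 M),
      forall i j : 'I_n, j = i.+1 :> nat ->
        act (delta_mx j i) (gt_vec G L M) =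
        \sum_(v : vertex | vrow v == i.+1)
            ((\prod_(w : vertex | vrow w == i) (M v - M w)) / gt_denom M v)
              *: gt_vec G L (gt_shift v (-1) M) &
      forall i : 'I_n,
        act (delta_mx i i) (gt_vec G L M) =
        (i%:R + \sum_(v : vertex | vrow v == i.+1) M v
              - \sum_(v : vertex | vrow v == i) M v) *: gt_vec G L M].

Definition relation_graph (G : rel vertex) : Prop :=
  [/\ admissible_graph G, non_critical G &
      forall L, realization G L ->
        exists act, @is_gl_action K n (gt_space G L) act /\ gt_action act].

Definition relation_module (N : gl_module K n) : Prop :=
  exists (G : rel vertex) (L : tableau)
         (act : 'M[K]_n -> gt_space G L -> gt_space G L)
         (actP : is_gl_action act),
    [/\ relation_graph G, realization G L, gt_action act &
        gl_iso N (GlModule actP)].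

Definition sigma_relation_module (s : 'S_n) (M : gl_module K n) : Prop :=
  exists N : gl_module K n, relation_module N /\ gl_iso M (gl_twist s N).

End RelationModules.

(* Main.v *)
Require Import Defs.
From HB Require Import structures.
From mathcomp Require Import all_boot all_order all_fingroup all_algebra.
From mathcomp Require Import boolp reals.
From mathcomp Require Import complex.
From mathcomp Require Import finmap monalg.
From mathcomp Require Import ring zify.

Set Implicit Arguments.
Unset Strict Implicit.
Unset Printing Implicit Defensive.

Import Order.TTheory GRing.Theory Num.Theory.
Local Open Scope ring_scope.

(** A module over [gl_n] is the same as operators satisfying the
    Chevalley-Serre relations.  Take for the graph one vertical chain per column
    of the triangle, the column [j] being labelled by [sigma^-1 j], whose arrows
    are oriented by comparing labels; when [lam_1 - lam_n] is an integer, one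
    arrow in the top row links the columns labelled [n] and [1].  This is a
    relation graph: a path of steps with nonzero Gelfand-Tsetlin coefficients that
    leaves the basis never returns to it, so truncation does not affect the
    relations; the Serre relations become rational identities in pairs of
    entries, and the commutators of the raising with the lowering operators are
    computed by Lagrange interpolation.

    The tableau all of whose vertical relations are tight gives a vector of
    weight [lam] killed by the twisted raising operators, hence a map from the
    Verma module.  It is onto because the quadratic Casimir operators of the
    subalgebras [gl_k] separate the neighbours of a basis tableau, so that this
    vector generates the module.  It is injective by counting: the ordered
    monomials in the lowering operators span the Verma module, they are in
    bijection with the basis tableaux, and the bijection preserves a grading
    with finite-dimensional pieces, on which a surjective square matrix is
    invertible. *)

(** * Matrix units from the Chevalley-Serre relations *)

(** The twist by $\sigma$ makes [E a c] a raising operator exactly when the label of $a$ is smaller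
    than that of $c$; this is why labels, and not column positions, orient the arrows, and why one
    construction serves all $\sigma$. The hypotheses enter through coincidences of entries. Distinct
    labels other than the pair $1,n$ give non-integral differences, so only these two columns can
    ever meet. The tight tableau has top entry $\lambda_r-(r-1)$ in the column labelled $r$, so the
    top gap between the columns labelled $n$ and $1$ is $\lambda_n-\lambda_1-(n-1)$; if integral, it
    is at least $1$ exactly when $\lambda_1-\lambda_n\notin\mathbb Z_{\ge 1-n}$. Going down, the
    column labelled $n$ strictly increases and the column labelled $1$ weakly decreases, so the gap
    never closes and no denominator vanishes. A relation graph must however serve every realization,
    also those with top gap $0$. There two entries of row $n-1$ may differ by exactly $1$, two
    interpolation nodes collide, and the commutator needs a separate identity. *)

Definition br (A : pzRingType) (x y : A) : A := x * y - y * x.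

Section Bracket.
Variable A : pzRingType.
Implicit Types x y z : A.

Lemma br_opp x y : br x y = - br y x.
Proof. by rewrite /br opprB. Qed.

Lemma brxx x : br x x = 0.
Proof. by rewrite /br subrr. Qed.

Lemma brr0 x : br x 0 = 0.
Proof. by rewrite /br mul0r mulr0 subrr. Qed.

Lemma br0r x : br 0 x = 0.
Proof. by rewrite /br mul0r mulr0 subrr. Qed.

Lemma brDr x y z : br x (y + z) = br x y + br x z.
Proof. by rewrite /br mulrDl mulrDr opprD addrACA. Qed.

Lemma brNr x y : br x (- y) = - br x y.
Proof. by rewrite /br mulNr mulrN opprD. Qed.

Lemma brDl x y z : br (x + y) z = br x z + br y z.
Proof. by rewrite /br mulrDl mulrDr opprD addrACA. Qed.

Lemma brNl x y : br (- x) y = - br x y.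
Proof. by rewrite /br mulNr mulrN opprD. Qed.

Lemma jacobi x y z : br x (br y z) = br (br x y) z + br y (br x z).
Proof.
rewrite /br !(mulrBr, mulrBl) !mulrA.
set a := x * y * z; set b := x * z * y; set c := y * z * x.
set d := z * y * x; set e := y * x * z; set g := z * x * y.
rewrite [RHS]addrACA (addrA (a - e)) subrK -opprD (addrC (g - d)) (addrA (b - g)) subrK.
by rewrite !opprB addrACA [RHS]addrACA (addrC (- b)).
Qed.

Lemma br_comm0 x y z : br x y = 0 -> br x z = 0 -> br x (br y z) = 0.
Proof. by move=> xy xz; rewrite jacobi xy xz br0r brr0 addr0. Qed.

Lemma br_sym0 x y : br x y = 0 -> br y x = 0.
Proof. by move=> xy; rewrite br_opp xy oppr0. Qed.

End Bracket.

(** * Brackets inside the upper triangular part *)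

Section SerreUp.
Variables (A : pzRingType) (n : nat) (e : nat -> A).
Hypothesis tf : forall x : A, x + x = 0 -> x = 0.
Hypothesis e_comm : forall i j, (i.+1 < j)%N -> (j.+1 < n)%N ->
  br (e i) (e j) = 0.
Hypothesis e_serre1 : forall i, (i.+2 < n)%N ->
  br (e i) (br (e i) (e i.+1)) = 0.
Hypothesis e_serre2 : forall i, (i.+2 < n)%N ->
  br (e i.+1) (br (e i.+1) (e i)) = 0.

(* [root_vec i m] is the matrix unit $E_{i,i+m+1}$. *)
Fixpoint root_vec (i m : nat) : A :=
  if m is m'.+1 then br (root_vec i m') (e (i + m')%N.+1) else e i.

Lemma br_root_vec_far k i m : (i + m.+1 < k)%N -> (k.+1 < n)%N ->
  br (e k) (root_vec i m) = 0.
Proof.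
elim: m => [|m IH] hk hn /=; first by apply/br_sym0/e_comm => //; lia.
apply: br_comm0; first by apply: IH => //; lia.
by apply/br_sym0/e_comm => //; lia.
Qed.

Lemma br_root_vec_low k i m : (k.+1 < i)%N -> (i + m.+1 < n)%N ->
  br (e k) (root_vec i m) = 0.
Proof.
elim: m => [|m IH] hk hn /=; first by apply/e_comm => //; lia.
by apply: br_comm0; [apply: IH | apply: e_comm]; lia.
Qed.

Lemma br_root_vec_pred k m : (k.+1 + m.+1 < n)%N ->
  br (e k) (root_vec k.+1 m) = root_vec k m.+1.
Proof.
elim: m => [|m IH] hn /=; first by rewrite addn0.
rewrite jacobi IH /=; last by lia.
by rewrite e_comm ?brr0 ?addr0 /= ?addnS //; lia.
Qed.

(** The Jacobi correction is a bracket of distant generators, hence zero. The last two simple steps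
    of a root vector can thus be grouped, which is the form to which [e_serre2] applies. *)
Lemma br_root_vecA i m : (i + m.+3 < n)%N ->
  br (br (root_vec i m) (e (i + m).+1)) (e (i + m).+2) =
  br (root_vec i m) (br (e (i + m).+1) (e (i + m).+2)).
Proof.
move=> hn; have h : br (e (i + m).+2) (root_vec i m) = 0.
  by apply: br_root_vec_far; lia.
by rewrite [RHS]jacobi (br_sym0 h) brr0 addr0.
Qed.

Lemma br_root_vec_last i m : (i + m.+1 < n)%N ->
  br (e (i + m)) (root_vec i m) = 0.
Proof.
case: m => [|[|m]] hn /=; first by rewrite addn0 brxx.
  rewrite addn0 addn1 [br (e i) _]br_opp brNr e_serre2 ?oppr0 //; lia.
rewrite addnS [(i + m.+1)%N]addnS br_root_vecA; last by lia.
apply: br_comm0; first by apply: br_root_vec_far; lia.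
rewrite [br (e (i + m).+1) _]br_opp brNr e_serre2 ?oppr0 //; lia.
Qed.

Lemma br_root_vec_first i m : (i + m.+1 < n)%N ->
  br (e i) (root_vec i m) = 0.
Proof.
elim: m => [|[|m] IH] hn /=; first by rewrite brxx.
  by rewrite addn0 e_serre1 //; lia.
by apply: br_comm0; [apply: IH | apply: e_comm]; lia.
Qed.

(* Twice the bracket vanishes, since Jacobi computes it with both signs. *)
Lemma br_root_vec_mid k i m : (i < k < i + m)%N -> (i + m.+1 < n)%N ->
  br (e k) (root_vec i m) = 0.
Proof.
elim: m => [|m IH] hk hn; first by lia.
have [hkm|hkm] := ltnP k (i + m)%N.
  by rewrite /=; apply: br_comm0; [apply: IH | apply: e_comm]; lia.
case: m {IH} hk hn hkm => [|m] hk hn hkm; first by lia.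
have -> : k = (i + m).+1 by lia.
apply: tf; rewrite /= addnS.
have lst := @br_root_vec_last i m.+1; rewrite /= !addnS in lst.
rewrite {1}jacobi lst ?br0r ?add0r; last by lia.
rewrite br_root_vecA ?[X in _ + X]jacobi ?e_serre1 ?brr0 ?addr0; try lia.
by rewrite [br (e _) (root_vec _ _)]br_opp brNl subrr.
Qed.

(** All positions of [k] are merged into the formula for $[E_{k,k+1},E_{i,i+m+1}]$: only an
    extension at one of the two ends survives. *)
Lemma br_root_vec k i m : (k.+1 < n)%N -> (i + m.+1 < n)%N ->
  br (e k) (root_vec i m) =
  root_vec k m.+1 *+ (k.+1 == i) - root_vec i m.+1 *+ (k == i + m.+1)%N.
Proof.
move=> hk hn.
have [hki|hki|hki] := ltngtP k.+1 i.
- by rewrite br_root_vec_low // (_ : k == _ = false) ?subrr //; lia.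
- have [->|/eqP ki] := eqVneq k (i + m.+1)%N.
    by rewrite mulr0n sub0r mulr1n [LHS]br_opp /= addnS.
  rewrite mulr0n subrr.
  have [h|h] := ltnP (i + m.+1) k; first by rewrite br_root_vec_far.
  have [->|/eqP h1] := eqVneq k i; first by rewrite br_root_vec_first.
  have [->|/eqP h2] := eqVneq k (i + m)%N; first by rewrite br_root_vec_last.
  by rewrite br_root_vec_mid //; lia.
- rewrite -{i}hki in hn *; rewrite br_root_vec_pred // (_ : k == _ = false) ?subr0 //.
  by lia.
Qed.

End SerreUp.

Lemma br_boolr (A : pzRingType) (x y : A) (b : bool) : br x (y *+ b) = br x y *+ b.
Proof. by case: b; rewrite ?mulr1n // !mulr0n brr0. Qed.

Lemma br_booll (A : pzRingType) (x y : A) (b : bool) : br (x *+ b) y = br x y *+ b.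
Proof. by case: b; rewrite ?mulr1n // !mulr0n br0r. Qed.

(** * Brackets of root vectors with Cartan elements and opposite generators *)

Section SerreMixed.
Variables (A : pzRingType) (n : nat) (e f h : nat -> A).
Hypothesis e_comm : forall i j, (i.+1 < j)%N -> (j.+1 < n)%N ->
  br (e i) (e j) = 0.
Hypothesis h_e : forall i k, (i < n)%N -> (k.+1 < n)%N ->
  br (h i) (e k) = e k *+ (i == k) - e k *+ (i == k.+1).
Hypothesis e_f : forall k l, (k.+1 < n)%N -> (l.+1 < n)%N ->
  br (e k) (f l) = (h k - h k.+1) *+ (k == l).

Lemma br_cartan_root_vec k i m : (k < n)%N -> (i + m.+1 < n)%N ->
  br (h k) (root_vec e i m) =
  root_vec e i m *+ (k == i) - root_vec e i m *+ (k == i + m.+1)%N.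
Proof.
move=> hk; elim: m => [|m IH] hm; first by rewrite /= h_e ?addn1 //; lia.
rewrite /= jacobi IH ?h_e //; try lia.
by rewrite !addnS brDl brNl !br_booll brDr brNr !br_boolr addrA subrK.
Qed.

(** An opposite simple vector shortens a root vector at one of its ends. The statement starts at
    length two because a simple root vector would be shortened to a Cartan element. *)
Lemma br_f_root_vec k i m : (k.+1 < n)%N -> (i + m.+2 < n)%N ->
  br (f k) (root_vec e i m.+1) =
  root_vec e i.+1 m *+ (k == i) - root_vec e i m *+ (k == i + m.+1)%N.
Proof.
move=> hk hm; have fe j : (j.+1 < n)%N ->
  br (f k) (e j) = - (h j - h j.+1) *+ (k == j).
  by move=> hj; rewrite br_opp e_f // eq_sym mulNrn.
have neqF (p q : nat) : p <> q -> (p == q) = false by move/eqP/negPf.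
have hR m' : (i + m'.+2 < n)%N -> br (root_vec e i m') (- (h (i + m').+1 - h (i + m').+2))
    = - root_vec e i m'.
  move=> hm'; rewrite brNr -br_opp brDl brNl !br_cartan_root_vec; try lia.
  rewrite addnS eqxx !neqF; try lia.
  by rewrite !mulr0n mulr1n sub0r !subr0.
elim: m hm => [|m IH] hm.
  have h0 := hR 0%N hm; rewrite /= addn0 in h0.
  rewrite /= jacobi !fe; try lia.
  rewrite br_booll br_boolr addn0 h0 addn1 mulNrn; congr (_ *+ _ - _).
  rewrite brNl brDl brNl !h_e; try lia.
  rewrite !eqxx !neqF; try lia.
  by rewrite !mulr0n mulr1n !subr0 sub0r opprK.
rewrite [root_vec e i m.+2]/= -/(root_vec e i m.+1) jacobi IH; last by lia.
rewrite fe; last by lia.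
rewrite br_boolr hR // brDl brNl !br_booll mulNrn !addnS; congr (_ - _).
have -> : br (root_vec e i m) (e (i + m).+2) = 0.
  by apply/br_sym0/(br_root_vec_far e_comm); lia.
by rewrite mul0rn subr0 /= addSn.
Qed.

End SerreMixed.

(** * All brackets of matrix units *)

Section Serre.
Variables (A : pzRingType) (n : nat) (e f h : nat -> A).
Hypothesis tf : forall x : A, x + x = 0 -> x = 0.
Hypothesis e_comm : forall i j, (i.+1 < j)%N -> (j.+1 < n)%N ->
  br (e i) (e j) = 0.
Hypothesis e_serre1 : forall i, (i.+2 < n)%N ->
  br (e i) (br (e i) (e i.+1)) = 0.
Hypothesis e_serre2 : forall i, (i.+2 < n)%N ->
  br (e i.+1) (br (e i.+1) (e i)) = 0.
Hypothesis f_comm : forall i j, (i.+1 < j)%N -> (j.+1 < n)%N ->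
  br (f i) (f j) = 0.
Hypothesis f_serre1 : forall i, (i.+2 < n)%N ->
  br (f i) (br (f i) (f i.+1)) = 0.
Hypothesis f_serre2 : forall i, (i.+2 < n)%N ->
  br (f i.+1) (br (f i.+1) (f i)) = 0.
Hypothesis h_h : forall i j, (i < n)%N -> (j < n)%N -> br (h i) (h j) = 0.
Hypothesis h_e : forall i k, (i < n)%N -> (k.+1 < n)%N ->
  br (h i) (e k) = e k *+ (i == k) - e k *+ (i == k.+1).
Hypothesis h_f : forall i k, (i < n)%N -> (k.+1 < n)%N ->
  br (h i) (f k) = f k *+ (i == k.+1) - f k *+ (i == k).
Hypothesis e_f : forall k l, (k.+1 < n)%N -> (l.+1 < n)%N ->
  br (e k) (f l) = (h k - h k.+1) *+ (k == l).

(* Passing to the converse ring exchanges the roles of [e] and [f]. *)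
Local Notation low_vec := (@root_vec A^c f).

Lemma br_conv (x y : A) : @br A^c x y = br y x.
Proof. by []. Qed.

Definition unit_vec (i j : nat) : A :=
  if (i < j)%N then root_vec e i (j - i).-1
  else if (j < i)%N then low_vec j (i - j).-1 else h i.

Lemma unit_vec_up i m : unit_vec i (i + m.+1) = root_vec e i m.
Proof. by rewrite /unit_vec addKn addnS ltnS leq_addr. Qed.

Lemma unit_vec_low i m : unit_vec (i + m.+1) i = low_vec i m.
Proof.
by rewrite /unit_vec addKn ltnNge leq_addr /= addnS ltnS leq_addr.
Qed.

Lemma unit_vec_diag i : unit_vec i i = h i.
Proof. by rewrite /unit_vec ltnn. Qed.

(** Fixing the first unit and quantifying over the second gives a property that passes from two
    units to their bracket, as the induction in [br_rule_all] requires. *)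
Definition br_rule (i j : nat) := forall k l, (k < n)%N -> (l < n)%N ->
  br (unit_vec i j) (unit_vec k l) =
  unit_vec i l *+ (j == k) - unit_vec k j *+ (l == i).

Lemma ltn_cases (i j : nat) :
  [\/ exists m, j = (i + m.+1)%N, exists m, i = (j + m.+1)%N | i = j].
Proof.
have [h'|h'|h'] := ltngtP i j.
- by apply: Or31; exists (j - i).-1; lia.
- by apply: Or32; exists (i - j).-1; lia.
- by apply: Or33.
Qed.

Lemma neqF (p q : nat) : p <> q -> (p == q) = false.
Proof. by move/eqP/negPf. Qed.

Lemma br_rule_e k : (k.+1 < n)%N -> br_rule k k.+1.
Proof.
move=> hk i j hi hj; have -> : unit_vec k k.+1 = e k.
  by have := unit_vec_up k 0; rewrite addn1.
case: (ltn_cases i j) => [[m E]|[m E]|<-].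
- subst j; rewrite unit_vec_up (br_root_vec tf e_comm) //.
  congr (_ - _).
    case: eqP => // <-; congr (_ *+ _).
    by rewrite addSn -addnS unit_vec_up.
  rewrite eq_sym; case: eqP => // <-; congr (_ *+ _).
  by rewrite -addnS unit_vec_up.
- subst i; rewrite unit_vec_low; case: m hi => [|m] hi.
    rewrite addn1 in hi *; rewrite /= e_f //.
    rewrite eqSS (eq_sym j); case: eqP => [->|kj]; last by rewrite !mulr0n subr0.
    by rewrite !mulr1n !unit_vec_diag.
  rewrite br_opp -br_conv (@br_f_root_vec A^c n f e h) //; try lia.
  + rewrite opprB; congr (_ - _).
      rewrite !addnS eqSS; case: eqP => // ->; congr (_ *+ _).
      by rewrite -addnS unit_vec_low.
    rewrite eq_sym; case: eqP => // ->; congr (_ *+ _).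
    by rewrite addnS -addSn unit_vec_low.
  + by move=> a b ab hb; rewrite br_conv; apply/br_sym0/f_comm.
  + by move=> a b ha hb; rewrite br_conv br_opp h_f // opprB.
  + by move=> a b ha hb; rewrite br_conv e_f // eq_sym; case: eqP => // ->.
- rewrite unit_vec_diag br_opp h_e // opprB (eq_sym k.+1); congr (_ - _).
    by case: eqP => // ->; rewrite -addn1 unit_vec_up.
  by case: eqP => // ->; rewrite -addn1 unit_vec_up.
Qed.

Lemma br_rule_h k : (k < n)%N -> br_rule k k.
Proof.
move=> hk i j hi hj; rewrite unit_vec_diag.
case: (ltn_cases i j) => [[m E]|[m E]|<-].
- subst j; rewrite unit_vec_up (br_cartan_root_vec h_e) //.
  congr (_ - _); first by case: eqP => // ->; rewrite unit_vec_up.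
  by rewrite eq_sym; case: eqP => // <-; rewrite unit_vec_up.
- subst i; rewrite unit_vec_low br_opp -br_conv.
  rewrite (@br_cartan_root_vec A^c n f h) //; last first.
    by move=> a b ha hb; rewrite br_conv br_opp h_f // opprB.
  rewrite opprB; congr (_ - _); first by case: eqP => // ->; rewrite unit_vec_low.
  by rewrite eq_sym; case: eqP => // <-; rewrite unit_vec_low.
- rewrite unit_vec_diag h_h // eq_sym; case: eqP => [->|_]; last by rewrite !mulr0n subr0.
  by rewrite subrr.
Qed.

Lemma br_rule_f k : (k.+1 < n)%N -> br_rule k.+1 k.
Proof.
move=> hk i j hi hj; have -> : unit_vec k.+1 k = f k.
  by have := unit_vec_low k 0; rewrite addn1.
case: (ltn_cases i j) => [[m E]|[m E]|<-].
- subst j; rewrite unit_vec_up; case: m hj => [|m] hj.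
    rewrite addn1 in hj *; rewrite /= br_opp e_f // eqSS eq_sym.
    case: eqP => [->|ki]; last by rewrite !mulr0n !subr0 oppr0.
    by rewrite !mulr1n opprB !unit_vec_diag.
  rewrite (br_f_root_vec e_comm h_e e_f) //; congr (_ - _).
    case: eqP => // ->; congr (_ *+ _).
    by rewrite addnS -addSn unit_vec_up.
  rewrite !addnS eqSS eq_sym; case: eqP => // <-; congr (_ *+ _).
  by rewrite -addnS unit_vec_up.
- subst i; rewrite unit_vec_low br_opp -br_conv.
  rewrite (@br_root_vec A^c n f) //; last first.
  + move=> a ha; rewrite !br_conv br_opp [br (f a) _]br_opp brNr opprK; exact: f_serre2.
  + move=> a ha; rewrite !br_conv br_opp [br (f a.+1) _]br_opp brNr opprK; exact: f_serre1.
  + by move=> a b ab hb; rewrite br_conv; apply/br_sym0/f_comm.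
  rewrite opprB; congr (_ - _).
    case: eqP => // ->; congr (_ *+ _).
    by rewrite -addnS unit_vec_low.
  rewrite (eq_sym j); case: eqP => // <-; congr (_ *+ _).
  by rewrite addSn -addnS unit_vec_low.
- rewrite unit_vec_diag br_opp h_f // opprB (eq_sym k); congr (_ - _).
    by case: eqP => // ->; rewrite -addn1 unit_vec_low.
  by case: eqP => // ->; rewrite -addn1 unit_vec_low.
Qed.

(** By Jacobi, bracketing with $[x,y]$ is the commutator of bracketing with $x$ and with $y$. The
    condition [i <> j] makes the bracket of the two units a single unit instead of a difference of
    Cartan elements. *)
Lemma br_rule_br i m j : (i < n)%N -> (m < n)%N -> (j < n)%N -> i <> j ->
  br_rule i m -> br_rule m j -> br_rule i j.
Proof.
move=> hi hm hj ij gim gmj k l hk hl.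
have -> : unit_vec i j = br (unit_vec i m) (unit_vec m j).
  by rewrite gim // eqxx (@neqF j i) ?mulr0n ?mulr1n ?subr0 //; apply/nesym.
have jac (x y z : A) : br (br x y) z = br x (br y z) - br y (br x z).
  by rewrite jacobi addrK.
rewrite jac gmj // gim // !brDr !brNr !br_boolr !gim // !gmj // eqxx.
rewrite (@neqF j i) ?(@neqF i j) //; last exact/nesym.
rewrite (eq_sym m k).
case: (j == k); case: (l == i); case: (k == m); case: (l == m);
  rewrite !(mulr0n, mulr1n, oppr0, subr0, sub0r, subrr, addr0, add0r, opprB, opprK,
            addrA, subrK, addNr) //.
- by rewrite -[X in X + _ - _ + _]addrA [- _ + _]addrC addrA subrK addrAC subrK.
- by rewrite addrAC addNr add0r.
Qed.

Lemma br_rule_all i j : (i < n)%N -> (j < n)%N -> br_rule i j.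
Proof.
move=> hi hj; case: (ltn_cases i j) => [[m E]|[m E]|<-]; last exact: br_rule_h.
- subst j; elim: m hj => [|m IH] hj; first by rewrite addn1 in hj *; apply: br_rule_e.
  apply: (@br_rule_br i (i + m.+1)); try lia; first by apply: IH; lia.
  by rewrite [(i + m.+2)%N]addnS; apply: br_rule_e; lia.
- subst i; elim: m hi => [|m IH] hi; first by rewrite addn1 in hi *; apply: br_rule_f.
  apply: (@br_rule_br _ (j + m.+1)); try lia; last by apply: IH; lia.
  by rewrite [(j + m.+2)%N]addnS; apply: br_rule_f; lia.
Qed.

End Serre.

(** * The ring of endomorphisms and the action defined by matrix units *)

Section Endomorphisms.
Variables (K : numFieldType) (V : lmodType K).

(** The space may be infinite-dimensional, so operators are bundled functions; pointwise equal ones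
    are equal by [endoP]. The ring structure allows $1=0$, since [V] may be zero. *)
Record endo := Endo {
  endo_fun :> V -> V;
  endo_lin : forall c u v, endo_fun (c *: u + v) = c *: endo_fun u + endo_fun v }.

HB.instance Definition _ := gen_eqMixin endo.
HB.instance Definition _ := gen_choiceMixin endo.

Lemma endoP (f g : endo) : f =1 g -> f = g.
Proof.
case: f g => f hf [g hg] /= /funext E.
by case: _ / E hg => hg; congr Endo; apply: Prop_irrelevance.
Qed.

Fact endo0_lin (c : K) (u v : V) : 0 = c *: 0 + 0 :> V.
Proof. by rewrite scaler0 addr0. Qed.

Fact endo_opp_lin (f : endo) c u v : - f (c *: u + v) = c *: - f u + - f v.
Proof. by rewrite endo_lin opprD scalerN. Qed.

Fact endo_add_lin (f g : endo) c u v :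
  f (c *: u + v) + g (c *: u + v) = c *: (f u + g u) + (f v + g v).
Proof. by rewrite !endo_lin scalerDr addrACA. Qed.

Fact endo_mul_lin (f g : endo) c u v :
  f (g (c *: u + v)) = c *: f (g u) + f (g v).
Proof. by rewrite !endo_lin. Qed.

Definition endo0 := Endo (fun c u v => endo0_lin c u v).
Definition endo1 := @Endo id (fun c u v => erefl).
Definition endo_opp f := Endo (endo_opp_lin f).
Definition endo_add f g := Endo (endo_add_lin f g).
Definition endo_mul f g := Endo (endo_mul_lin f g).

Lemma endo_D (f : endo) u v : f (u + v) = f u + f v.
Proof. by have := endo_lin f 1 u v; rewrite !scale1r. Qed.

Lemma endo_0 (f : endo) : f 0 = 0.
Proof. by apply: (addrI (f 0)); rewrite -endo_D !addr0. Qed.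

Fact endo_addA : associative endo_add.
Proof. by move=> f g k; apply: endoP => v /=; rewrite addrA. Qed.
Fact endo_addC : commutative endo_add.
Proof. by move=> f g; apply: endoP => v /=; rewrite addrC. Qed.
Fact endo_add0 : left_id endo0 endo_add.
Proof. by move=> f; apply: endoP => v /=; rewrite add0r. Qed.
Fact endo_addN : left_inverse endo0 endo_opp endo_add.
Proof. by move=> f; apply: endoP => v /=; rewrite addNr. Qed.

HB.instance Definition _ :=
  GRing.isZmodule.Build endo endo_addA endo_addC endo_add0 endo_addN.

Fact endo_mulA : associative endo_mul.
Proof. by move=> f g k; apply: endoP. Qed.
Fact endo_mul1 : left_id endo1 endo_mul.
Proof. by move=> f; apply: endoP. Qed.
Fact endo_mulr1 : right_id endo1 endo_mul.
Proof. by move=> f; apply: endoP. Qed.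
Fact endo_mulDl : left_distributive endo_mul +%R.
Proof. by move=> f g k; apply: endoP. Qed.
Fact endo_mulDr : right_distributive endo_mul +%R.
Proof. by move=> f g k; apply: endoP => v; apply: endo_D. Qed.

HB.instance Definition _ := GRing.Zmodule_isPzRing.Build endo
  endo_mulA endo_mul1 endo_mulr1 endo_mulDl endo_mulDr.

Lemma endo_brE (f g : endo) v : br f g v = f (g v) - g (f v).
Proof. by []. Qed.

Lemma endo_tf (f : endo) : f + f = 0 -> f = 0.
Proof.
move=> ff; apply: endoP => v; have : f v + f v = 0.
  by have := congr1 (fun g : endo => g v) ff.
rewrite -mulr2n -scaler_nat => /eqP.
by rewrite scaler_eq0 pnatr_eq0 => /eqP.
Qed.

Lemma endo_lin_sum (f : endo) (I : Type) (r : seq I) (P : pred I) (c : I -> K)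
    (u : I -> V) :
  f (\sum_(i <- r | P i) c i *: u i) = \sum_(i <- r | P i) c i *: f (u i).
Proof.
elim/big_rec2: _ => [|i x y _ IH]; first exact: endo_0.
by rewrite endo_lin IH.
Qed.

End Endomorphisms.

Lemma mx_lin_ind (K : numFieldType) (n : nat) (P : 'M[K]_n -> Prop) :
  P 0 -> (forall c x y, P x -> P y -> P (c *: x + y)) ->
  (forall i j, P (delta_mx i j)) -> forall x, P x.
Proof.
move=> P0 PZ Pd x; rewrite (matrix_sum_delta x).
have PD y z : P y -> P z -> P (y + z) by rewrite -{2}[y]scale1r; apply: PZ.
by elim/big_ind: _ => // i _; elim/big_ind: _ => // j _; rewrite -[_ *: _]addr0; apply: PZ.
Qed.

Section GlActionOfUnits.
Variables (K : numFieldType) (V : lmodType K) (n : nat).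
Variable E : 'I_n -> 'I_n -> endo V.
Hypothesis E_br : forall i j k l, br (E i j) (E k l) =
  E i l *+ (j == k) - E k j *+ (l == i).

Definition unit_act (x : 'M[K]_n) (v : V) : V :=
  \sum_(p : 'I_n * 'I_n) x p.1 p.2 *: E p.1 p.2 v.

Lemma unit_act_delta i j v : unit_act (delta_mx i j) v = E i j v.
Proof.
rewrite /unit_act (bigD1 (i, j)) //= mxE !eqxx scale1r big1 ?addr0 // => -[a b] /=.
by rewrite xpair_eqE mxE => /negPf ->; rewrite scale0r.
Qed.

Lemma unit_actP : is_gl_action unit_act.
Proof.
have lin_r c x v w : unit_act x (c *: v + w) = c *: unit_act x v + unit_act x w.
  rewrite scaler_sumr -big_split /=; apply: eq_bigr => p _.
  by rewrite endo_lin scalerDr !scalerA mulrC.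
have lin_l c x y v : unit_act (c *: x + y) v = c *: unit_act x v + unit_act y v.
  rewrite scaler_sumr -big_split /=; apply: eq_bigr => p _.
  by rewrite !mxE scalerDl scalerA.
have act0l w : unit_act 0 w = 0.
  by rewrite /unit_act big1 // => p _; rewrite mxE scale0r.
have act0r x : unit_act x 0 = 0.
  by rewrite /unit_act big1 // => p _; rewrite endo_0 scaler0.
split=> // x y; elim/mx_lin_ind: x => [|c x1 x2 IH1 IH2|i j] v.
- by rewrite mul0mx mulmx0 subr0 !act0l act0r subr0.
- rewrite mulmxDl mulmxDr -scalemxAl -scalemxAr opprD addrACA -scalerBr.
  by rewrite !lin_l IH1 IH2 lin_r scalerBr opprD addrACA.
elim/mx_lin_ind: y v => [|c y1 y2 IH1 IH2|k l] v.
- by rewrite mul0mx mulmx0 subr0 !act0l act0r subr0.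
- rewrite mulmxDl mulmxDr -scalemxAl -scalemxAr opprD addrACA -scalerBr.
  by rewrite !lin_l IH1 IH2 lin_r scalerBr opprD addrACA.
rewrite !mul_delta_mx_cond !unit_act_delta -endo_brE E_br.
have -> : delta_mx i l *+ (j == k) - delta_mx k j *+ (l == i) =
  (-1) *: (delta_mx k j *+ (l == i)) + delta_mx i l *+ (j == k) :> 'M[K]_n.
  by rewrite scaleN1r addrC.
rewrite lin_l scaleN1r addrC; congr (_ - _).
  by case: (j == k); rewrite ?mulr1n ?mulr0n ?unit_act_delta ?act0l.
by case: (l == i); rewrite ?mulr1n ?mulr0n ?unit_act_delta ?act0l.
Qed.

End GlActionOfUnits.

Section GlActionOfSerre.
Variables (K : numFieldType) (V : lmodType K) (n : nat) (e f h : nat -> endo V).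
Hypothesis e_comm : forall i j, (i.+1 < j)%N -> (j.+1 < n)%N ->
  br (e i) (e j) = 0.
Hypothesis e_serre1 : forall i, (i.+2 < n)%N ->
  br (e i) (br (e i) (e i.+1)) = 0.
Hypothesis e_serre2 : forall i, (i.+2 < n)%N ->
  br (e i.+1) (br (e i.+1) (e i)) = 0.
Hypothesis f_comm : forall i j, (i.+1 < j)%N -> (j.+1 < n)%N ->
  br (f i) (f j) = 0.
Hypothesis f_serre1 : forall i, (i.+2 < n)%N ->
  br (f i) (br (f i) (f i.+1)) = 0.
Hypothesis f_serre2 : forall i, (i.+2 < n)%N ->
  br (f i.+1) (br (f i.+1) (f i)) = 0.
Hypothesis h_h : forall i j, (i < n)%N -> (j < n)%N -> br (h i) (h j) = 0.
Hypothesis h_e : forall i k, (i < n)%N -> (k.+1 < n)%N ->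
  br (h i) (e k) = e k *+ (i == k) - e k *+ (i == k.+1).
Hypothesis h_f : forall i k, (i < n)%N -> (k.+1 < n)%N ->
  br (h i) (f k) = f k *+ (i == k.+1) - f k *+ (i == k).
Hypothesis e_f : forall k l, (k.+1 < n)%N -> (l.+1 < n)%N ->
  br (e k) (f l) = (h k - h k.+1) *+ (k == l).

Lemma gl_action_of_serre : exists act : 'M[K]_n -> V -> V,
  [/\ is_gl_action act,
      forall i j : 'I_n, j = i.+1 :> nat -> act (delta_mx i j) =1 e i,
      forall i j : 'I_n, j = i.+1 :> nat -> act (delta_mx j i) =1 f i &
      forall i : 'I_n, act (delta_mx i i) =1 h i].
Proof.
pose E (i j : 'I_n) := unit_vec e f h i j.
have EP i j k l : br (E i j) (E k l) = E i l *+ (j == k) - E k j *+ (l == i).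
  exact: (br_rule_all (@endo_tf K V) e_comm e_serre1 e_serre2 f_comm f_serre1 f_serre2 h_h h_e h_f e_f).
exists (unit_act E); split=> [|i j ij v|i j ij v|i v]; first exact: unit_actP.
- by rewrite unit_act_delta /E ij -addn1 unit_vec_up.
- by rewrite unit_act_delta /E ij -addn1 unit_vec_low.
- by rewrite unit_act_delta /E unit_vec_diag.
Qed.

End GlActionOfSerre.

(** * Identities between the Gelfand-Tsetlin coefficients *)

Section Coefficients.
Variables (K : numFieldType) (n : nat).
Implicit Types (M : tableau K n) (u v w : vertex n) (s : bool).

Definition sg s : K := if s then 1 else -1.

(* [s = true] stands for the raising operators $E_{k,k+1}$ and [s = false] for
   the lowering operators $E_{k+1,k}$. *)
Definition step s v M : tableau K n := gt_shift v (sg s) M.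

Definition adj s v : nat := if s then (vrow v).+1 else (vrow v).-1.

Definition numer s M v : K := \prod_(w | vrow w == adj s v) (M v - M w).

(** The factor [- sg s] merges the two Gelfand-Tsetlin formulas, which carry opposite signs. *)
Definition coef s M v : K := - sg s * numer s M v / gt_denom M v.

Lemma stepE s v M w : step s v M w = M w + (if w == v then sg s else 0).
Proof. by rewrite ffunE. Qed.

Lemma step_id s v M : step s v M v = M v + sg s.
Proof. by rewrite stepE eqxx. Qed.

Lemma step_neq s v M w : w != v -> step s v M w = M w.
Proof. by rewrite stepE => /negPf ->; rewrite addr0. Qed.

Lemma stepC s s' v w M : step s v (step s' w M) = step s' w (step s v M).
Proof. by apply/ffunP => u; rewrite !stepE addrAC. Qed.

Lemma step_opp s v M : step (~~ s) v (step s v M) = M.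
Proof.
apply/ffunP => u; rewrite !stepE; case: eqP => _; rewrite ?addr0 //.
by case: s; rewrite /sg /= ?addrK ?subrK.
Qed.

Lemma row_neq v w : vrow v != vrow w -> v != w.
Proof. by apply: contraNneq => ->. Qed.

Lemma adj_neq s v : adj s v != vrow v.
Proof. by case: s => /=; rewrite /vrow /=; lia. Qed.

Lemma denom_step s u M v : vrow u != vrow v ->
  gt_denom (step s u M) v = gt_denom M v.
Proof.
move=> uv; apply: eq_bigr => w /andP[/eqP wv _].
by rewrite !step_neq //; apply: row_neq; rewrite ?wv eq_sym.
Qed.

Definition denom2 M v w : K :=
  \prod_(u | [&& vrow u == vrow v, u != v & u != w]) (M v - M u).

Lemma denomE M v w : vrow w == vrow v -> w != v ->
  gt_denom M v = (M v - M w) * denom2 M v w.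
Proof.
move=> wr wv; rewrite /gt_denom (bigD1 w) /=; last by rewrite wr wv.
by congr (_ * _); apply: eq_bigl => u; rewrite andbA.
Qed.

Lemma denom2_step s u M v w : u != v -> (vrow u != vrow v) || (u == w) ->
  denom2 (step s u M) v w = denom2 M v w.
Proof.
move=> uv uw; apply: eq_bigr => x /and3P[/eqP xr xv xw].
rewrite !step_neq //; last by rewrite eq_sym.
by case/orP: uw => [ur|/eqP -> //]; apply: row_neq; rewrite xr eq_sym.
Qed.

Lemma numer_step s s' u M v : u != v -> vrow u != adj s v ->
  numer s (step s' u M) v = numer s M v.
Proof.
move=> uv ur; apply: eq_bigr => w /eqP wr.
rewrite !step_neq //; first by apply: row_neq; rewrite wr eq_sym.
by rewrite eq_sym.
Qed.

Definition numer2 s M v u : K :=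
  \prod_(w | (vrow w == adj s v) && (w != u)) (M v - M w).

Lemma numerE s M v u : vrow u == adj s v ->
  numer s M v = (M v - M u) * numer2 s M v u.
Proof. by move=> ur; rewrite /numer (bigD1 u). Qed.

Lemma numer2_step s s' x M v u : x != v -> (vrow x != adj s v) || (x == u) ->
  numer2 s (step s' x M) v u = numer2 s M v u.
Proof.
move=> xv xu; apply: eq_bigr => w /andP[/eqP wr wu].
rewrite !step_neq //; last by rewrite eq_sym.
by case/orP: xu => [xr|/eqP -> //]; apply: row_neq; rewrite wr eq_sym.
Qed.

Lemma coef_step s s' u M v : vrow u != vrow v -> vrow u != adj s v ->
  coef s (step s' u M) v = coef s M v.
Proof.
by move=> uv ua; rewrite /coef numer_step ?denom_step //; apply: row_neq.
Qed.

Lemma coefC_far s s' M v w : vrow v != vrow w ->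
  vrow w != adj s v -> vrow v != adj s' w ->
  coef s M v * coef s' (step s v M) w = coef s' M w * coef s (step s' w M) v.
Proof. by move=> vw wa va; rewrite !coef_step // 1?mulrC // eq_sym. Qed.

(** The two moves interact only if [w] lies one row above [v]. Each coefficient then has one factor
    in $d$ = [M v - M w], and both products contain $-d(d+1)$. *)
Lemma coefC_raise_lower M v w : vrow v != vrow w ->
  coef true M v * coef false (step true v M) w =
  coef false M w * coef true (step false w M) v.
Proof.
move=> vw; have vw' := row_neq vw.
have [wv|wv] := eqVneq (vrow w) (adj true v); last first.
  by apply: coefC_far => //; move: wv; rewrite /adj /vrow /=; lia.
have va : vrow v == adj false w by rewrite /adj wv.
have wa : vrow w == adj true v by rewrite wv.
rewrite /coef !(numerE _ wa) !(numerE _ va).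
rewrite !denom_step 1?(eq_sym (vrow w)) //.
rewrite !numer2_step ?eqxx ?orbT // 1?eq_sym //.
rewrite !step_id !(step_neq _ _ vw') !(@step_neq _ v _ w) 1?eq_sym //.
by rewrite /sg /=; ring.
Qed.

(** Only the denominators couple the two vertices; with $d$ = [M v - M w] both sides contain
    $-1/(d(d+1))$. *)
Lemma coefC_row M v w : vrow v == vrow w -> v != w ->
  coef true M v * coef false (step true v M) w =
  coef false M w * coef true (step false w M) v.
Proof.
move=> vwr vw; have wv : w != v by rewrite eq_sym.
have wvr : vrow w == vrow v by rewrite eq_sym.
rewrite /coef !(denomE _ vwr vw) !(denomE _ wvr wv).
rewrite !denom2_step ?eqxx ?orbT //.
have va s : vrow v != adj s w by rewrite (eqP vwr) eq_sym adj_neq.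
have wa s : vrow w != adj s v by rewrite (eqP wvr) eq_sym adj_neq.
rewrite !numer_step //.
rewrite !step_id !(step_neq _ _ vw) !(step_neq _ _ wv) !invfM.
have -> : (M w - (M v + sg true))^-1 = - (M v - (M w + sg false))^-1.
  by rewrite -invrN /sg; congr (_^-1); ring.
by rewrite -(opprB (M v) (M w)) invrN; ring.
Qed.

(** * The cubic identities behind the Serre relations *)

Section SerreCoefficients.
Variables (s : bool) (M : tableau K n) (u v w : vertex n).
Local Notation st := (step s).
Local Notation c := (coef s).

(** The contribution of one choice of vertices to $xxy-2xyx+yxx=[x,[x,y]]$, where $y$ moves [u] and
    the two factors $x$ move first [v], then [w]. The Serre relation only asks that the sum over
    both orders of [v] and [w] vanish. *)
Definition serre_coef v w : K :=
  c M u * c (st u M) v * c (st v (st u M)) w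
  - 2 * (c M v * c (st v M) u * c (st u (st v M)) w)
  + c M v * c (st v M) w * c (st w (st v M)) u.

(** The vertex [u] enters the coefficient at [v] through one linear factor, which a move of [u]
    translates by [sg s]. After extracting [rho], an identity in the single difference [M v - M u]
    remains. *)
Lemma serre_coef_vv1 : vrow u == adj s v -> serre_coef v v = 0.
Proof.
move=> ua; have va : vrow v != adj s u.
  by move: ua; rewrite /adj /vrow; case: (s) => /=; lia.
have uv : vrow u != vrow v by rewrite (eqP ua) adj_neq.
have vu : vrow v != vrow u by rewrite eq_sym.
pose rho N := - sg s * (numer2 s N v u / gt_denom N v).
have E0 N : c N v = rho N * (N v - N u).
  by rewrite /coef (numerE _ ua) /rho; ring.
have E1 N : c (st u N) v = rho N * (N v - N u - sg s).
  rewrite E0 /rho denom_step // numer2_step ?eqxx ?orbT ?row_neq //.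
  by rewrite step_id step_neq ?row_neq //; ring.
have E2 N : c (st v N) u = c N u by rewrite coef_step.
rewrite /serre_coef !(stepC s s v u) !E1 !E0 !E2 step_id step_neq ?row_neq //.
by ring.
Qed.

(** Here the coefficient at [u] is linear in the entry at [v], and the alternating sum is its second
    difference along the moves of [v]. *)
Lemma serre_coef_vv2 : vrow v == adj s u -> serre_coef v v = 0.
Proof.
move=> va; have ua : vrow u != adj s v.
  by move: va; rewrite /adj /vrow; case: (s) => /=; lia.
have vu : vrow v != vrow u by rewrite (eqP va) adj_neq.
have uv : vrow u != vrow v by rewrite eq_sym.
pose rho N := - sg s * (numer2 s N u v / gt_denom N u).
have rhoE N : rho (st v N) = rho N.
  by rewrite /rho denom_step // numer2_step ?eqxx ?orbT ?row_neq.
have E0 N : c N u = rho N * (N u - N v).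
  by rewrite /coef (numerE _ va) /rho; ring.
have E2 N : c (st u N) v = c N v by rewrite coef_step.
rewrite /serre_coef !(stepC s s v u) !E2 !E0 !rhoE !step_id.
rewrite !(@step_neq _ v _ u) ?row_neq //.
by ring.
Qed.

Hypothesis vw : v != w.
Hypothesis vwr : vrow v == vrow w.
Hypothesis vw0 : M v - M w != 0.
Hypothesis vw1 : M v - M w != 1.
Hypothesis vwN1 : M v - M w != -1.

Let nz1 : M v - M w - sg s != 0.
Proof. by rewrite subr_eq0 /sg; case: (s). Qed.

Let nz2 : M w - M v - sg s != 0.
Proof.
by rewrite subr_eq0 -opprB eqr_oppLR /sg; case: (s); rewrite ?opprK.
Qed.

Let nz3 : M w - M v != 0.
Proof. by rewrite -opprB oppr_eq0. Qed.

(** The coefficients at [v] and [w] have poles where the two entries coincide and, once one of them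
    has moved, where they differ by a unit. The hypotheses on [M v - M w] exclude exactly these
    values, and a rational identity in three entries is left. *)
Lemma serre_coef_vw1 : vrow u == adj s v -> serre_coef v w + serre_coef w v = 0.
Proof.
move=> ua; have ua' : vrow u == adj s w by rewrite /adj -(eqP vwr).
have wv : w != v by rewrite eq_sym.
have wvr : vrow w == vrow v by rewrite eq_sym.
have va : vrow v != adj s u.
  by move: ua; rewrite /adj /vrow; case: (s) => /=; lia.
have uv : vrow u != vrow v by rewrite (eqP ua) adj_neq.
have vu : vrow v != vrow u by rewrite eq_sym.
have wa : vrow w != adj s u by rewrite -(eqP vwr).
have uw : vrow u != vrow w by rewrite -(eqP vwr).
have wu : vrow w != vrow u by rewrite -(eqP vwr).
have va' s' : vrow v != adj s' w by rewrite (eqP vwr) eq_sym adj_neq.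
have wa' s' : vrow w != adj s' v by rewrite (eqP wvr) eq_sym adj_neq.
pose rv := - sg s * (numer2 s M v u / denom2 M v w).
pose rw := - sg s * (numer2 s M w u / denom2 M w v).
have E0 N : c N v = - sg s * (numer2 s N v u / denom2 N v w) * (N v - N u) / (N v - N w).
  by rewrite /coef (numerE _ ua) (denomE _ wvr wv) invfM; ring.
have E0' N : c N w = - sg s * (numer2 s N w u / denom2 N w v) * (N w - N u) / (N w - N v).
  by rewrite /coef (numerE _ ua') (denomE _ vwr vw) invfM; ring.
have E2 N : c (st v N) u = c N u by rewrite coef_step.
have E2' N : c (st w N) u = c N u by rewrite coef_step.
rewrite /serre_coef !(E2, E2') !E0 !E0'.
rewrite !numer2_step ?eqxx ?orbT ?va' ?wa' // ?row_neq //.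
rewrite !denom2_step ?eqxx ?orbT ?uv ?uw // ?row_neq // -/rv -/rw.
rewrite !(step_id, @step_neq s u _ v, @step_neq s u _ w, @step_neq s v _ u,
  @step_neq s w _ u, @step_neq s v _ w, @step_neq s w _ v) // ?row_neq //.
move: (M v) (M w) (M u) nz1 nz2 nz3 vw0 => a b z.
rewrite /sg; case: (s) => h1 h2 h3 h4; field; by rewrite !opprD !addrA h1 h2 h3 h4.
Qed.

Lemma serre_coef_vw2 : vrow v == adj s u -> serre_coef v w + serre_coef w v = 0.
Proof.
move=> va; have wa : vrow w == adj s u by rewrite -(eqP vwr).
have wv : w != v by rewrite eq_sym.
have wvr : vrow w == vrow v by rewrite eq_sym.
have ua : vrow u != adj s v.
  by move: va; rewrite /adj /vrow; case: (s) => /=; lia.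
have vu : vrow v != vrow u by rewrite (eqP va) adj_neq.
have uv : vrow u != vrow v by rewrite eq_sym.
have ua' : vrow u != adj s w by rewrite /adj -(eqP vwr).
have uw : vrow u != vrow w by rewrite -(eqP vwr).
have wu : vrow w != vrow u by rewrite -(eqP vwr).
have va' s' : vrow v != adj s' w by rewrite (eqP vwr) eq_sym adj_neq.
have wa' s' : vrow w != adj s' v by rewrite (eqP wvr) eq_sym adj_neq.
pose rv := - sg s * (numer s M v / denom2 M v w).
pose rw := - sg s * (numer s M w / denom2 M w v).
pose nu (N : tableau K n) : K := \prod_(x | [&& vrow x == adj s u, x != v & x != w]) (N u - N x).
have nuE x N : (x == v) || (x == w) -> nu (st x N) = nu N.
  move=> xvw; apply: eq_bigr => y /and3P[/eqP yr yv yw].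
  by case/orP: xvw => /eqP ->; rewrite !step_neq // row_neq.
pose ru := - sg s * (nu M / gt_denom M u).
have E0 N : c N v = - sg s * (numer s N v / denom2 N v w) / (N v - N w).
  by rewrite /coef (denomE _ wvr wv) invfM; ring.
have E0' N : c N w = - sg s * (numer s N w / denom2 N w v) / (N w - N v).
  by rewrite /coef (denomE _ vwr vw) invfM; ring.
have E1 N : c N u = - sg s * (nu N / gt_denom N u) * ((N u - N v) * (N u - N w)).
  rewrite /coef (numerE _ va) /numer2 (bigD1 w) /=; last by rewrite wa.
  rewrite (eq_bigl (fun x => [&& vrow x == adj s u, x != v & x != w])) -/(nu N).
    by ring.
  by move=> x; rewrite andbA.
rewrite /serre_coef !E0 !E0' !E1.
rewrite !numer_step ?va' ?wa' // ?row_neq //.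
rewrite !denom2_step ?eqxx ?orbT ?uv ?uw // ?row_neq // -/rv -/rw.
rewrite !nuE ?eqxx ?orbT // !denom_step // -/ru.
rewrite !(step_id, @step_neq s u _ v, @step_neq s u _ w, @step_neq s v _ u,
  @step_neq s w _ u, @step_neq s v _ w, @step_neq s w _ v) // ?row_neq //.
move: (M v) (M w) (M u) nz1 nz2 nz3 vw0 => a b z.
rewrite /sg; case: (s) => h1 h2 h3 h4; field; by rewrite !opprD !addrA h1 h2 h3 h4.
Qed.

End SerreCoefficients.

End Coefficients.

(** * Lagrange interpolation *)

Section Lagrange.
Variable K : fieldType.

(** A polynomial of degree below the number of nodes equals its interpolant; comparing top
    coefficients gives the formula, because every [B z] is monic. *)
Lemma lagrange_coef (zs : seq K) (F : {poly K}) : uniq zs -> (size F <= size zs)%N ->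
  \sum_(z <- zs) F.[z] / \prod_(y <- zs | y != z) (z - y) = F`_(size zs).-1.
Proof.
move=> uz sF; have [zs0|zs0] := posnP (size zs).
  by move: sF; rewrite zs0 leqn0 size_poly_eq0 (size0nil zs0) big_nil => /eqP ->; rewrite coef0.
pose B z : {poly K} := \prod_(y <- zs | y != z) ('X - y%:P).
pose b z := \prod_(y <- zs | y != z) (z - y).
pose G := \sum_(z <- zs) (F.[z] / b z) *: B z.
have sB z : z \in zs -> size (B z) = size zs.
  move=> zz; rewrite /B -big_filter size_prod_XsubC -rem_filter // size_rem //.
  by rewrite prednK.
have Bz z y : y \in zs -> y != z -> (B z).[y] = 0.
  move=> yz yz'; apply/rootP; rewrite /B -big_filter root_prod_XsubC.
  by rewrite mem_filter yz' yz.
have Bzz z : (B z).[z] = b z.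
  by rewrite /B horner_prod; apply: eq_bigr => y _; rewrite !hornerE.
have b0 z : b z != 0.
  by rewrite /b prodf_seq_neq0; apply/allP => y _; apply/implyP; rewrite subr_eq0 eq_sym.
have FG : F = G.
  apply/eqP; rewrite -subr_eq0; apply: contraT => FG0.
  have := max_poly_roots FG0 _ uz; rewrite ltnNge => /(_ _)/negP; case.
    apply/allP => z zz; rewrite /root hornerD hornerN subr_eq0 horner_sum.
    rewrite (bigD1_seq z) //= hornerZ Bzz divfK // big_seq_cond big1 ?addr0 //.
    by move=> y /andP[yz zy]; rewrite hornerZ Bz ?mulr0 // eq_sym.
  rewrite (leq_trans (size_polyD _ _)) // geq_max sF size_polyN.
  rewrite (leq_trans (size_sum _ _ _)) //; apply/bigmax_leqP_seq => z zz _.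
  by rewrite (leq_trans (size_scale_leq _ _)) ?sB.
rewrite {2}FG coef_sum big_seq [RHS]big_seq; apply: eq_bigr => z zz.
rewrite coefZ -(sB z zz) -/(lead_coef (B z)) /B -big_filter.
by rewrite (monicP (monic_prod_XsubC _ _ _)) mulr1 big_filter.
Qed.

(** Interpolate the difference of the monic polynomials with roots [rs] and [zs]. The second
    vanishes at every node, and the leading terms cancel, so the relevant coefficient is a
    difference of sums of roots. *)
Lemma lagrange_prod (zs rs : seq K) : uniq zs -> size rs = size zs ->
  \sum_(z <- zs) (\prod_(r <- rs) (z - r)) / \prod_(y <- zs | y != z) (z - y) =
  \sum_(z <- zs) z - \sum_(r <- rs) r.
Proof.
move=> uz sz; have [zs0|zs0] := posnP (size zs).
  rewrite zs0 in sz.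
  by rewrite (size0nil zs0) (size0nil sz) !big_nil subr0.
pose F : {poly K} := \prod_(r <- rs) ('X - r%:P) - \prod_(z <- zs) ('X - z%:P).
have sF : (size F <= size zs)%N.
  rewrite /F; apply/leq_sizeP => j; rewrite leq_eqVlt => /orP[/eqP <-|zj].
    rewrite coefB -{1}sz.
    have lc (s : seq K) : (\prod_(r <- s) ('X - r%:P))`_(size s) = 1.
      have /monicP := monic_prod_XsubC s predT id.
      by rewrite /lead_coef size_prod_XsubC.
    by rewrite !lc subrr.
  by rewrite coefB !nth_default ?subrr // size_prod_XsubC ?sz.
have := lagrange_coef uz sF; rewrite coefB [X in _ = _ - X]coefPn_prod_XsubC -?lt0n //.
rewrite -[X in _`_X.-1]sz coefPn_prod_XsubC -?lt0n ?sz //.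
rewrite opprK addrC => <-; rewrite big_seq [RHS]big_seq; apply: eq_bigr => z zz.
congr (_ / _); rewrite hornerD hornerN !horner_prod.
under eq_bigr do rewrite -[_ - _](hornerXsubC).
rewrite [X in _ - X](big_rem z) //= !hornerE subrr mul0r subr0.
by apply: eq_bigr => r _; rewrite hornerXsubC.
Qed.

Lemma lagrange_index (I J : finType) (A : pred I) (R : pred J) (z : I -> K) (r : J -> K) :
  {in A &, injective z} -> #|A| = #|R| ->
  \sum_(i | A i) (\prod_(j | R j) (z i - r j)) / \prod_(i' | A i' && (i' != i)) (z i - z i') =
  \sum_(i | A i) z i - \sum_(j | R j) r j.
Proof.
move=> zinj cAR; pose zs := [seq z i | i <- enum A]; pose rs := [seq r j | j <- enum R].
have uz : uniq zs.
  by rewrite map_inj_in_uniq ?enum_uniq // => i j; rewrite !mem_enum; apply: zinj.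
have sz : size rs = size zs by rewrite !size_map -!cardE.
have := lagrange_prod uz sz; rewrite /zs /rs !big_map !big_enum /= => <-.
apply: eq_bigr => i Ai; rewrite !big_map big_enum /=; congr (_ / _).
rewrite big_enum_cond /=; apply: eq_bigl => i'; rewrite unfold_in.
case Ai': (A i') => //=; congr (~~ _); apply/eqP/eqP => [->//|]; exact: zinj.
Qed.

End Lagrange.

(* Two of the nodes coincide, but so do two roots of the numerator: both are
   dropped. *)
Section LagrangeDegenerate.
Variables (K : fieldType) (I J : finType) (A : pred I) (R : pred J) (z : I -> K) (r : J -> K).
Variables (p0 p1 : I) (u0 u1 : J).
Hypotheses (Ap0 : A p0) (Ap1 : A p1) (p01 : p0 != p1).
Hypotheses (Ru0 : R u0) (Ru1 : R u1) (u01 : u0 != u1).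
Hypotheses (zp : z p1 = z p0) (ru0 : r u0 = z p0) (ru1 : r u1 = z p0).
Hypothesis zinj : {in [pred i | [&& A i, i != p0 & i != p1]] &, injective z}.
Hypothesis zneq : forall i, [&& A i, i != p0 & i != p1] -> z i != z p0.
Hypothesis cAR : #|A| = #|R|.

Lemma lagrange_degenerate :
  \sum_(i | A i) (\prod_(j | R j) (z i - r j)) / \prod_(i' | A i' && (i' != i)) (z i - z i') =
  \sum_(i | A i) z i - \sum_(j | R j) r j.
Proof.
pose A' := [pred i | [&& A i, i != p0 & i != p1]].
pose R' := [pred j | [&& R j, j != u0 & j != u1]].
have A1 : A p1 && (p1 != p0) by rewrite Ap1 eq_sym.
have R1 : R u1 && (u1 != u0) by rewrite Ru1 eq_sym.
have A'E : (fun i => (A i && (i != p0)) && (i != p1)) =1 A'.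
  by move=> i; rewrite /= andbA.
have R'E : (fun i => (R i && (i != u0)) && (i != u1)) =1 R'.
  by move=> i; rewrite /= andbA.
have cAR' : #|A'| = #|R'|.
  move: cAR; rewrite (cardD1 p0) (cardD1 p1) (cardD1 u0 R) (cardD1 u1) !inE.
  rewrite !unfold_in Ap0 Ru0 (andP A1).1 (andP R1).1 eq_sym p01 eq_sym u01 /= => /eqP.
  rewrite !add1n !eqSS => /eqP E.
  transitivity #|[predD1 [predD1 A & p0] & p1]|.
    by apply: eq_card => i; rewrite !inE unfold_in /=; case: (A i); case: (i == p0); case: (i == p1).
  rewrite E; apply: eq_card => i.
  by rewrite !inE unfold_in /=; case: (R i); case: (i == u0); case: (i == u1).
have prodR x : \prod_(j | R j) (x - r j) = (x - z p0) ^+ 2 * \prod_(j | R' j) (x - r j).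
  rewrite (bigD1 u0) //= (bigD1 u1) //= ru0 ru1 mulrA expr2; congr (_ * _).
  exact: eq_bigl.
have dead i : z i = z p0 ->
    (\prod_(j | R j) (z i - r j)) / \prod_(i' | A i' && (i' != i)) (z i - z i') = 0.
  by move=> ->; rewrite prodR subrr expr0n !mul0r.
rewrite (bigD1 p0) //= dead // add0r (bigD1 p1) //= dead // add0r.
rewrite [X in _ = X - _](bigD1 p0) //= [X in _ = (_ + X) - _](bigD1 p1) //=.
rewrite [X in _ = _ - X](bigD1 u0) //= [X in _ = _ - (_ + X)](bigD1 u1) //=.
rewrite zp ru0 ru1 opprD addrACA subrr add0r opprD addrACA subrr add0r.
rewrite !(eq_bigl _ _ A'E) !(eq_bigl _ _ R'E).
rewrite -(@lagrange_index K I J A' R' z r zinj cAR'); apply: eq_bigr => i A'i.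
have nz : z i - z p0 != 0 by rewrite subr_eq0 zneq.
have [Ai ip0 ip1] : [/\ A i, i != p0 & i != p1] by apply/and3P.
rewrite prodR (bigD1 p0) /=; last by rewrite Ap0 eq_sym.
rewrite (bigD1 p1) /=; last by rewrite Ap1 eq_sym ip1 eq_sym.
rewrite zp mulrA -expr2 invfM mulrACA divff ?expf_neq0 // mul1r.
congr (_ / _); apply: eq_bigl => i'; rewrite /= -!andbA.
by case: (A i'); case: (i' != i); case: (i' != p0); case: (i' != p1).
Qed.

End LagrangeDegenerate.

Lemma prod_nodes (K : fieldType) (T : finType) (P : pred T) (G : T * bool -> K) v s :
  P v -> \prod_(p | P p.1 && (p != (v, s))) G p =
  G (v, ~~ s) * \prod_(w | P w && (w != v)) (G (w, true) * G (w, false)).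
Proof.
move=> Pv; rewrite (bigD1 (v, ~~ s)) /=; last first.
  by rewrite Pv xpair_eqE eqxx; case: (s).
congr (_ * _).
under [RHS]eq_bigr => w _ do rewrite -[_ * _](big_bool _ (fun b => G (w, b))).
rewrite pair_big_dep /=; apply: eq_big => [[w b]|[w b] _ //] /=.
by rewrite !xpair_eqE andbT; case: (P w) => //=; case: eqP => //= _; case: (s); case: b.
Qed.

Lemma sum_nodes (K : fieldType) (T : finType) (P : pred T) (G : T * bool -> K) :
  \sum_(p | P p.1) G p = \sum_(w | P w) (G (w, true) + G (w, false)).
Proof.
under [RHS]eq_bigr => w _ do rewrite -[_ + _](big_bool _ (fun b => G (w, b))).
by rewrite pair_big_dep /=; apply: eq_big => [[w b]|[w b] _ //] /=; rewrite andbT.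
Qed.

Lemma card_row (n r : nat) : (r <= n)%N -> #|[pred v : vertex n | vrow v == r]| = r.
Proof.
case: r => [_|r rn].
  by apply: eq_card0 => v; rewrite !inE.
have jP (j : 'I_r.+1) : ((widen_ord rn j, Ordinal rn).1 <= (widen_ord rn j, Ordinal rn).2)%N.
  by rewrite -ltnS /=.
pose f (j : 'I_r.+1) : vertex n := exist _ (Ordinal rn, widen_ord rn j) (jP j).
have finj : injective f.
  by move=> i j /(congr1 val) /= [] /= E; apply: val_inj.
rewrite -[RHS]card_ord -(card_codom finj); apply: eq_card => v; rewrite !inE.
apply/eqP/codomP => [|[j ->] //].
case: v => -[i j] /= ij; rewrite /vrow /= => -[] E.
have jr : (j < r.+1)%N by rewrite -E ltnS.
exists (Ordinal jr); apply: val_inj => /=; congr pair; exact: val_inj.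
Qed.

(** * The commutator of a raising operator with its opposite *)

Section Diagonal.
Variables (K : numFieldType) (n r : nat) (M : tableau K n).
Hypotheses (r0 : (0 < r)%N) (rn : (r < n)%N).

(** Each vertex of row [r] carries two nodes: its entry, for the path that raises and then lowers
    it, and the entry minus one, for the opposite order. The roots are the entries of row [r.+1] and
    those of row [r.-1] minus one, so that there are $2r$ of each. *)
Let A (p : vertex n * bool) := vrow p.1 == r.
Let R (u : vertex n) := (vrow u == r.+1) || (vrow u == r.-1).
Let z (p : vertex n * bool) : K := if p.2 then M p.1 else M p.1 - 1.
Let rt (u : vertex n) : K := if vrow u == r.+1 then M u else M u - 1.

Let cardAR : #|A| = #|R|.
Proof.
have -> : #|A| = (#|[pred v : vertex n | vrow v == r]| * 2)%N.
  rewrite -card_bool -cardX; apply: eq_card => -[v b].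
  by rewrite !inE unfold_in andbT.
have -> : #|R| = (#|[predU [pred v : vertex n | vrow v == r.+1] & [pred v : vertex n | vrow v == r.-1]]|)%N.
  by apply: eq_card => v; rewrite !inE.
have := cardUI [pred v : vertex n | vrow v == r.+1] [pred v : vertex n | vrow v == r.-1].
rewrite (@eq_card0 _ (predI _ _)) ?addn0 => [->|v]; last by rewrite !inE; lia.
by rewrite !card_row; lia.
Qed.

Let prodR (x : K) : \prod_(u | R u) (x - rt u) =
  \prod_(u : vertex n | vrow u == r.+1) (x - M u) *
  \prod_(u : vertex n | vrow u == r.-1) (x + 1 - M u).
Proof.
rewrite (bigID (fun u => vrow u == r.+1)) /=; congr (_ * _).
  apply: eq_big => [u|u /andP[_ ur]]; last by rewrite /rt ur.
  by rewrite /R; lia.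
apply: eq_big => [u|u /andP[_ /negPf ur]]; last by rewrite /rt ur; ring.
by rewrite /R; lia.
Qed.

Let term p := (\prod_(u | R u) (z p - rt u)) / \prod_(p' | A p' && (p' != p)) (z p - z p').

Let term_true v : vrow v == r ->
  term (v, true) = - (coef true M v * coef false (step true v M) v).
Proof.
move=> vr; rewrite /term prodR /A
  (@prod_nodes _ _ (fun v => vrow v == r) (fun p => z (v, true) - z p) v true vr) big_split /=.
rewrite /z /= /coef /sg.
have -> : \prod_(u : vertex n | vrow u == r.+1) (M v - M u) = numer true M v.
  by apply: eq_bigl => u; rewrite /adj (eqP vr).
have -> : \prod_(u : vertex n | vrow u == r.-1) (M v + 1 - M u) = numer false (step true v M) v.
  rewrite /numer /adj (eqP vr); apply: eq_bigr => u /eqP ur.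
  rewrite step_id step_neq //; apply: row_neq; rewrite ur (eqP vr); lia.
have -> : \prod_(w : vertex n | (vrow w == r) && (w != v)) (M v - M w) = gt_denom M v.
  by rewrite /gt_denom (eqP vr).
have -> : \prod_(w : vertex n | (vrow w == r) && (w != v)) (M v - (M w - 1)) =
    gt_denom (step true v M) v.
  rewrite /gt_denom (eqP vr); apply: eq_bigr => w /andP[_ wv].
  by rewrite step_id step_neq // /sg; ring.
have -> : M v - (M v - 1) = 1 by ring.
by rewrite mul1r invfM; ring.
Qed.

Let term_false v : vrow v == r ->
  term (v, false) = coef false M v * coef true (step false v M) v.
Proof.
move=> vr; rewrite /term prodR /A
  (@prod_nodes _ _ (fun v => vrow v == r) (fun p => z (v, false) - z p) v false vr) big_split /=.
rewrite /z /= /coef /sg.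
have -> : \prod_(u : vertex n | vrow u == r.+1) (M v - 1 - M u) = numer true (step false v M) v.
  rewrite /numer /adj (eqP vr); apply: eq_bigr => u /eqP ur.
  rewrite step_id step_neq //; apply: row_neq; rewrite ur (eqP vr); lia.
have -> : \prod_(u : vertex n | vrow u == r.-1) (M v - 1 + 1 - M u) = numer false M v.
  by rewrite /numer /adj (eqP vr) subrK.
have -> : \prod_(w : vertex n | (vrow w == r) && (w != v)) (M v - 1 - (M w - 1)) = gt_denom M v.
  by rewrite /gt_denom (eqP vr); apply: eq_bigr => w _; ring.
have -> : \prod_(w : vertex n | (vrow w == r) && (w != v)) (M v - 1 - M w) =
    gt_denom (step false v M) v.
  rewrite /gt_denom (eqP vr); apply: eq_bigr => w /andP[_ wv].
  by rewrite step_id step_neq.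
have -> : M v - 1 - M v = -1 by ring.
by rewrite !invfM invrN1; ring.
Qed.

Let sum_terms : \sum_(p | A p) term p = \sum_(p | A p) z p - \sum_(u | R u) rt u ->
  \sum_(v : vertex n | vrow v == r) (coef false M v * coef true (step false v M) v
     - coef true M v * coef false (step true v M) v) =
  (\sum_(v : vertex n | vrow v == r) M v) *+ 2 - \sum_(v : vertex n | vrow v == r.+1) M v
   - \sum_(v : vertex n | vrow v == r.-1) M v - 1.
Proof.
rewrite /A (sum_nodes (fun v => vrow v == r) term) => E.
transitivity (\sum_(v : vertex n | vrow v == r) (term (v, true) + term (v, false))).
  by apply: eq_bigr => v vr; rewrite term_true // term_false // addrC.
rewrite E (sum_nodes (fun v => vrow v == r) z) /z /= big_split /= sumrB.
rewrite [X in _ - X](bigID (fun u => vrow u == r.+1)) /=.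
have -> : \sum_(u | R u && (vrow u == r.+1)) rt u = \sum_(v : vertex n | vrow v == r.+1) M v.
  apply: eq_big => [u|u /andP[_ ur]]; last by rewrite /rt ur.
  by rewrite /R; lia.
have -> : \sum_(u | R u && (vrow u != r.+1)) rt u =
    \sum_(v : vertex n | vrow v == r.-1) (M v - 1).
  apply: eq_big => [u|u /andP[_ /negPf ur]]; last by rewrite /rt ur.
  by rewrite /R; lia.
rewrite sumrB !sumr_const !card_row; try lia.
case: (r) r0 => // r' _ /=; rewrite -natr1; ring.
Qed.

Lemma diagonal_generic :
  (forall v w, vrow v = r -> vrow w = r -> v != w -> M v != M w /\ M v + 1 != M w) ->
  \sum_(v : vertex n | vrow v == r) (coef false M v * coef true (step false v M) v
     - coef true M v * coef false (step true v M) v) =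
  (\sum_(v : vertex n | vrow v == r) M v) *+ 2 - \sum_(v : vertex n | vrow v == r.+1) M v
   - \sum_(v : vertex n | vrow v == r.-1) M v - 1.
Proof.
move=> sep; apply: sum_terms; apply: lagrange_index => // -[v b] [w b'].
rewrite !unfold_in /z /= => /eqP vr /eqP wr E.
have [vw|vw] := eqVneq v w.
  rewrite vw in E *; congr pair; case: b b' E => [] [] //.
    by rewrite -{1}[M w]subr0 => /addrI/oppr_inj/eqP; rewrite eq_sym oner_eq0.
  by rewrite -{2}[M w]subr0 => /addrI/oppr_inj/eqP; rewrite oner_eq0.
have [/eqP n1 /eqP n2] := sep _ _ vr wr vw.
have [|/eqP n3 /eqP n4] := sep _ _ wr vr _; first by rewrite eq_sym.
case: b b' E => [] [] // E.
- by case: n2; rewrite E subrK.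
- by case: n4; rewrite -E subrK.
- by case: n1; move: E => /addIr.
Qed.

(** The nodes [(v0, true)] and [(w0, false)] coincide, and the entries [u0], [u1] above them are a
    double root of the numerator at that same point, which is the situation of
    [lagrange_degenerate]. *)
Lemma diagonal_degenerate (v0 w0 u0 u1 : vertex n) :
  vrow v0 = r -> vrow w0 = r -> vrow u0 = r.+1 -> vrow u1 = r.+1 -> u0 != u1 -> v0 != w0 ->
  M w0 = M v0 + 1 -> M u0 = M v0 -> M u1 = M v0 ->
  (forall v w, vrow v = r -> vrow w = r -> v != w -> ~~ [&& v == v0 & w == w0] ->
     ~~ [&& v == w0 & w == v0] -> M v != M w /\ M v + 1 != M w) ->
  \sum_(v : vertex n | vrow v == r) (coef false M v * coef true (step false v M) v
     - coef true M v * coef false (step true v M) v) =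
  (\sum_(v : vertex n | vrow v == r) M v) *+ 2 - \sum_(v : vertex n | vrow v == r.+1) M v
   - \sum_(v : vertex n | vrow v == r.-1) M v - 1.
Proof.
move=> v0r w0r u0r u1r u01 v0w0 w0E u0E u1E sep; apply: sum_terms.
have nz1 (a : K) : a <> a + 1 /\ a <> a - 1.
  split=> /eqP; rewrite -subr_eq0; [rewrite opprD addrA subrr sub0r oppr_eq0 oner_eq0 //|].
  by rewrite opprB addrC subrK oner_eq0.
apply: (@lagrange_degenerate K _ _ A R z rt (v0, true) (w0, false) u0 u1) => //.
- by rewrite /A /= v0r.
- by rewrite /A /= w0r.
- by rewrite xpair_eqE andbF.
- by rewrite /R u0r eqxx.
- by rewrite /R u1r eqxx.
- by rewrite /z /= w0E addrK.
- by rewrite /rt u0r eqxx u0E.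
- by rewrite /rt u1r eqxx u1E.
- move=> -[v b] [w b']; rewrite !inE /A /= !xpair_eqE /z /=.
  move=> /and3P[/eqP vr v1 v2] /and3P[/eqP wr w1 w2] E.
  have [vw|vw] := eqVneq v w.
    rewrite vw in E *; congr pair; case: b b' E {v1 v2 w1 w2} => [] [] // E.
      by have [_] := nz1 (M w).
    by have [_] := nz1 (M w); rewrite E.
  (* The nodes kept for the exceptional pair are [M v0 - 1] and [M v0 + 1]; they are distinct
     because $2\ne0$. *)
  have [/andP[/eqP Ev /eqP Ew]|nvw] := boolP [&& v == v0 & w == w0].
    rewrite Ev Ew !eqxx /= in v1 v2 w1 w2 E *.
    case: b v1 {v2} E => //; case: b' w2 {w1} => // _ _; rewrite w0E => /addrI /eqP.
    by rewrite eq_sym -addr_eq0 (_ : 1 + 1 = 2%:R) // pnatr_eq0.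
  have [/andP[/eqP Ev /eqP Ew]|nwv] := boolP [&& v == w0 & w == v0].
    rewrite Ev Ew !eqxx /= in v1 v2 w1 w2 E *.
    case: b' w1 {w2} E => //; case: b v2 {v1} => // _ _; rewrite w0E => /addrI /eqP.
    by rewrite -addr_eq0 (_ : 1 + 1 = 2%:R) // pnatr_eq0.
  have [/eqP n1 /eqP n2] := sep _ _ vr wr vw nvw nwv.
  have wv : w != v by rewrite eq_sym.
  have := sep _ _ wr vr wv; rewrite ![(w == _) && _]andbC => /(_ nwv nvw)[/eqP n3 /eqP n4].
  case: b b' E {v1 v2 w1 w2} => [] [] // E.
  + by case: n2; rewrite E subrK.
  + by case: n4; rewrite -E subrK.
  + by case: n1; move: E => /addIr.
- move=> [v b]; rewrite /A /= !xpair_eqE /z /= => /and3P[/eqP vr v1 v2].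
  case: b v1 v2 => /=; rewrite ?andbT ?andbF => v1 v2.
    have [->|vw0] := eqVneq v w0; first by rewrite w0E; apply/eqP => E; case: (nz1 (M v0)).1; rewrite E.
    by have [] := sep _ _ vr v0r v1; rewrite ?(negPf v1) ?(negPf vw0) ?andbF.
  have [->|vv0] := eqVneq v v0; first by apply/eqP => E; case: (nz1 (M v0)).2; rewrite E.
  have v0v : v0 != v by rewrite eq_sym.
  have [] := sep _ _ v0r vr v0v; rewrite ?(negPf v2) ?(negPf vv0) ?andbF // => _.
  by apply: contraNneq => <-; rewrite subrK.
Qed.
End Diagonal.

(** * The chain graph *)

Section IntGe.
Variable K : numFieldType.
Implicit Types (x y : K) (a c : int).

Lemma int_geD a c x y : int_ge a x -> int_ge c y -> int_ge (a + c) (x + y).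
Proof. by move=> [m am ->] [p cp ->]; exists (m + p); rewrite ?lerD ?rmorphD. Qed.

Lemma int_geW a c x : c <= a -> int_ge a x -> int_ge c x.
Proof. by move=> ca [m am ->]; exists m => //; apply: le_trans am. Qed.

Lemma int_ge_int a x : int_ge a x -> is_int x.
Proof. by case=> m _ ->; exists m. Qed.

Lemma int_ge0 a x : x = 0 -> a <= 0 -> int_ge a x.
Proof. by move=> -> a0; exists 0. Qed.

Lemma int_geP a c : int_ge a (c%:~R : K) <-> a <= c.
Proof. by split=> [[m am /intr_inj ->]|ac] //; exists c. Qed.

Lemma is_intD x y : is_int x -> is_int y -> is_int (x + y).
Proof. by move=> [m ->] [p ->]; exists (m + p); rewrite rmorphD. Qed.

Lemma is_intN x : is_int x -> is_int (- x).
Proof. by move=> [m ->]; exists (- m); rewrite rmorphN. Qed.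

Lemma is_intB x y : is_int x -> is_int y -> is_int (x - y).
Proof. by move=> hx /is_intN; apply: is_intD. Qed.

Lemma is_int_sg s : is_int (sg K s).
Proof. by case: s; [exists 1 | exists (-1)]. Qed.

Lemma is_int0 : is_int (0 : K).
Proof. by exists 0. Qed.

End IntGe.

Section Vertices.
Variable n : nat.
Implicit Types v w : vertex n.

Definition vr v : 'I_n := (val v).1.
Definition vc v : 'I_n := (val v).2.
Definition mkv (i j : 'I_n) (ji : (j <= i)%N) : vertex n := exist _ (i, j) ji.

Lemma vc_le v : (vc v <= vr v)%N.
Proof. exact: (valP v). Qed.

Lemma vrowE v : vrow v = (vr v).+1.
Proof. by []. Qed.

Lemma vrow_inj v w : vrow v = vrow w -> vr v = vr w.
Proof. by case=> E; apply: val_inj. Qed.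

Lemma vertex_eq v w : vr v = vr w -> vc v = vc w -> v = w.
Proof.
case: v w => [[i j] hv] [[i' j'] hw]; rewrite /vr /vc /= => ii jj.
by apply: val_inj; rewrite /= ii jj.
Qed.

Lemma above_ex v : (vrow v < n)%N -> exists2 x, vr x = (vr v).+1 :> nat & vc x = vc v.
Proof.
move=> vn; have h : (vc v <= Ordinal vn)%N by rewrite /= vrowE ltnW // ltnS vc_le.
by exists (mkv h).
Qed.

Lemma below_ex v : (vc v < vr v)%N -> exists2 x, vr v = (vr x).+1 :> nat & vc x = vc v.
Proof.
move=> vn; have h0 : ((vr v).-1 < n)%N by rewrite (leq_ltn_trans (leq_pred _)).
have h : (vc v <= Ordinal h0)%N by rewrite /=; lia.
exists (mkv h) => //; have -> : vr (mkv h) = Ordinal h0 by [].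
by rewrite /=; lia.
Qed.

End Vertices.

Section Chain.
Variables (n : nat) (t : 'S_n) (b : bool).
Implicit Types v w x y : vertex n.

Definition down_arrow x y :=
  [&& vc x == vc y, vr x == (vr y).+1 :> nat & (t (vc y) < t (vr x))%N].
Definition up_arrow y x :=
  [&& vc x == vc y, vr x == (vr y).+1 :> nat & (t (vr x) < t (vc y))%N].
Definition top_arrow v w :=
  [&& b, vrow v == n, vrow w == n, t (vc v) == n.-1 :> nat & t (vc w) == 0%N :> nat].

(* The label of the column [j] is [t j].  The vertical arrows between two rows
   record whether the label that enters the upper row is larger or smaller. *)
Definition chain_graph : rel (vertex n) :=
  fun v w => [|| down_arrow v w, up_arrow v w | top_arrow v w].

Local Notation G := chain_graph.

Definition ups v : nat := #|[pred a : 'I_n | (vr v < a)%N && (t a < t (vc v))%N]|.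
(** The weights are chosen so that every arrow lowers the value by one: a down arrow loses a row; an
    up arrow gains a row but loses one unit of [ups], counted twice; the last term pays for the top
    arrow. This rules out cycles and later serves to order the vertices in [extremal_vertex]. *)
Definition potential v : nat := (vr v + 2 * ups v + (t (vc v) == n.-1 :> nat))%N.

Lemma ups_above x y : vc x = vc y -> vr x = (vr y).+1 :> nat ->
  ups y = ((t (vr x) < t (vc y)) + ups x)%N.
Proof.
move=> c r; rewrite /ups (cardD1 (vr x)) !inE r ltnSn /=; congr (_ + _)%N.
apply: eq_card => a; rewrite !inE c -(inj_eq val_inj) /=; lia.
Qed.

Lemma potential_arrow v w : (2 <= n)%N -> G v w -> potential v = (potential w).+1.
Proof.
move=> n2; rewrite /potential => /or3P[/and3P[/eqP c /eqP r l]|/and3P[/eqP c /eqP r l]|].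
- by rewrite (ups_above c r) c r; lia.
- by rewrite (ups_above c r) c r l; lia.
- move=> /and5P[_ /eqP vn /eqP wn /eqP tv /eqP tw].
  have ups0 z : vrow z = n -> ups z = 0%N.
    move=> zn; apply: eq_card0 => a; rewrite !inE.
    by have := ltn_ord a; move: zn; rewrite vrowE; lia.
  rewrite !ups0 // tv tw eqxx; move: vn wn; rewrite !vrowE; lia.
Qed.

Lemma vertical_arrow x y : vc x = vc y -> vr x = (vr y).+1 :> nat ->
  down_arrow x y \/ up_arrow y x.
Proof.
move=> c r; rewrite /down_arrow /up_arrow c r !eqxx /=.
case: (ltngtP (t (vc y)) (t (vr x))); [by left | by right|].
move=> /val_inj /perm_inj E; have := vc_le y; rewrite E r; lia.
Qed.

Lemma chain_admissible : (2 <= n)%N -> admissible_graph G.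
Proof.
move=> n2; split=> v w.
  case/or3P => [/and3P[_ /eqP r _]|/and3P[_ /eqP r _]|/and5P[_ /eqP vn /eqP wn _ _]].
  - by apply: Or31; rewrite vrowE r.
  - by apply: Or32; rewrite vrowE r.
  - exact: Or33.
move/(potential_arrow n2) => E; apply/negP => /connectP[p pp vE].
have : (potential (last w p) <= potential w)%N.
  elim: p w pp {E vE} => //= z p IH w /andP[wz pp].
  by rewrite (potential_arrow n2 wz) (leq_trans (IH _ pp)).
by rewrite -vE E ltnn.
Qed.

Definition comp_key v : nat := if b && (t (vc v) == n.-1 :> nat) then 0%N else t (vc v).

Lemma comp_key_same v w : same_component G v w -> comp_key v = comp_key w.
Proof.
have key x y : G x y -> comp_key x = comp_key y.
  rewrite /comp_key => /or3P[/and3P[/eqP -> //]|/and3P[/eqP -> //]|].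
  by move=> /and5P[-> _ _ -> /eqP -> /=]; case: ifP.
case/connectP => p pp -> {w}; elim: p v pp => //= z p IH v /andP[vz pp].
by rewrite -(IH _ pp); case/orP: vz => /key.
Qed.

(** By [same_component_row], the only pairs of distinct vertices of one row that can share a
    component, hence the only ones below the top row whose entries can differ by an integer in a
    realization. *)
Definition crit v w := [/\ b, t (vc v) = 0%N :> nat & t (vc w) = n.-1 :> nat].

Lemma same_component_row v w : vrow v = vrow w -> same_component G v w ->
  [\/ v = w, crit v w | crit w v].
Proof.
move=> r /comp_key_same; rewrite /comp_key.
have rr : vr v = vr w by apply: vrow_inj.
have cE : t (vc v) = t (vc w) :> nat -> v = w.
  by move=> /val_inj/perm_inj; apply: vertex_eq.
case hb: b => /=; last by move=> E; apply: Or31; apply: cE.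
case: (eqVneq (t (vc v) : nat) n.-1) => [Ev|nv];
  case: (eqVneq (t (vc w) : nat) n.-1) => [Ew|nw] E.
- by apply: Or31; apply: cE; rewrite Ev Ew.
- by apply: Or33; split; rewrite ?hb.
- by apply: Or32; split; rewrite ?hb.
- by apply: Or31; apply: cE.
Qed.

Lemma top_ex v : exists2 x, vrow x = n & vc x = vc v.
Proof.
have h0 : (n.-1 < n)%N by have := ltn_ord (vr v); lia.
have h : (vc v <= Ordinal h0)%N by rewrite /=; have := ltn_ord (vc v); lia.
by exists (mkv h) => //; rewrite /vrow /=; lia.
Qed.

Lemma last_col_up x y : vc x = vc y -> vr x = (vr y).+1 :> nat ->
  t (vc y) = n.-1 :> nat -> up_arrow y x.
Proof.
move=> c r l; case: (vertical_arrow c r) => // /and3P[_ _].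
by rewrite l; have := ltn_ord (t (vr x)); lia.
Qed.

Lemma first_col_down x y : vc x = vc y -> vr x = (vr y).+1 :> nat ->
  t (vc y) = 0%N :> nat -> down_arrow x y.
Proof. by move=> c r l; case: (vertical_arrow c r) => // /and3P[_ _]; rewrite l. Qed.

Lemma column_ind (P : vertex n -> Prop) :
  (forall x, vrow x = n -> P x) ->
  (forall x y, vc x = vc y -> vr x = (vr y).+1 :> nat -> P x -> P y) ->
  forall x, P x.
Proof.
move=> Ptop Pstep x; move: {2}(n - vrow x)%N (erefl (n - vrow x)%N) => m.
elim: m x => [|m IH] x E.
  by apply: Ptop; have := ltn_ord (vr x); move: E; rewrite vrowE; lia.
have [|y r c] := @above_ex n x; first by lia.
by apply: (Pstep y) => //; apply: IH; move: E; rewrite !vrowE r; lia.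
Qed.

Lemma connect_top v w : crit v w -> vrow v = n -> vrow w = n -> G w v.
Proof.
move=> [hb tv tw] vn wn; rewrite /chain_graph /top_arrow hb vn wn tv tw !eqxx.
by rewrite !orbT.
Qed.

Lemma connect_last_col v w : vc v = vc w -> t (vc v) = n.-1 :> nat -> vrow w = n ->
  connect G v w.
Proof.
move=> c l wn; elim/column_ind: v c l => [x xn c l|x y cxy rxy IH c l].
  suff -> : x = w by [].
  by apply: vertex_eq => //; apply: vrow_inj; rewrite xn wn.
apply: (connect_trans (y := x)); last by apply: IH; rewrite cxy.
by apply: connect1; rewrite /chain_graph last_col_up ?orbT // cxy.
Qed.

Lemma connect_first_col v w : vc v = vc w -> t (vc v) = 0%N :> nat -> vrow w = n ->
  connect G w v.
Proof.
move=> c l wn; elim/column_ind: v c l => [x xn c l|x y cxy rxy IH c l].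
  suff -> : x = w by [].
  by apply: vertex_eq => //; apply: vrow_inj; rewrite xn wn.
apply: (connect_trans (y := x)); first by apply: IH; rewrite cxy.
by apply: connect1; rewrite /chain_graph first_col_down // cxy.
Qed.

(** The column of the largest label has only up arrows and that of the smallest only down arrows.
    The path climbs the former, crosses the top arrow and descends the latter. *)
Lemma connect_crit v w : crit v w -> connect G w v.
Proof.
move=> [hb tv tw]; have [x xn xc] := top_ex v; have [y yn yc] := top_ex w.
apply: (connect_trans (y := y)); first exact: connect_last_col.
apply: (connect_trans (y := x)); last exact: connect_first_col.
by apply: connect1; apply: connect_top => //; split; rewrite ?xc ?yc.
Qed.

Lemma chain_non_critical : non_critical G.
Proof.
move=> v w r _ /(same_component_row r)[-> | c | c]; first by left.
- by right; apply: connect_crit.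
- by left; apply: connect_crit.
Qed.

Section Realizations.
Variables (K : numFieldType).
Implicit Types M : tableau K n.

Lemma satisfies_down M x y : satisfies G M -> down_arrow x y -> int_ge 0 (M x - M y).
Proof.
move=> sM xy; have := sM x y; rewrite /chain_graph xy => /(_ isT).
by case/and3P: xy => _ /eqP r _; rewrite !vrowE r; case: eqP => //; lia.
Qed.

Lemma satisfies_up M x y : satisfies G M -> up_arrow y x -> int_ge 1 (M y - M x).
Proof.
move=> sM xy; have := sM y x; rewrite /chain_graph xy orbT => /(_ isT).
by case/and3P: xy => _ /eqP r _; rewrite !vrowE r eqxx.
Qed.

Lemma last_col_ge M v w : satisfies G M -> vc v = vc w -> t (vc v) = n.-1 :> nat ->
  vrow w = n -> int_ge (n - vrow v)%N (M v - M w).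
Proof.
move=> sM c l wn; elim/column_ind: v c l => [x xn c l|x y cxy rxy IH c l].
  have -> : x = w.
    by apply: vertex_eq => //; apply: vrow_inj; rewrite xn wn.
  by apply: int_ge0; rewrite ?subrr // wn subnn.
have u : up_arrow y x by apply: last_col_up.
have := int_geD (satisfies_up sM u) (IH _ _); rewrite cxy => /(_ c l).
rewrite addrA subrK; apply: int_geW.
by rewrite !vrowE rxy; have := ltn_ord (vr x); rewrite rxy; lia.
Qed.

Lemma first_col_ge M v w : satisfies G M -> vc v = vc w -> t (vc v) = 0%N :> nat ->
  vrow w = n -> int_ge 0 (M w - M v).
Proof.
move=> sM c l wn; elim/column_ind: v c l => [x xn c l|x y cxy rxy IH c l].
  have -> : x = w.
    by apply: vertex_eq => //; apply: vrow_inj; rewrite xn wn.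
  by apply: int_ge0; rewrite ?subrr.
have u : down_arrow x y by apply: first_col_down.
have := int_geD (IH _ _) (satisfies_down sM u); rewrite cxy => /(_ c l).
by rewrite addrA subrK.
Qed.

(** Each up arrow above [w] contributes one unit. Both column bounds end in the top row, which [M]
    and [M'] share, so entries of two different tableaux can be compared; [serre_gap] does this for
    a tableau and its translate. *)
Lemma crit_gap M M' v w : satisfies G M -> satisfies G M' ->
  (forall x, vrow x = n -> M x = M' x) -> crit v w ->
  int_ge (n - vrow w)%N (M' w - M v).
Proof.
move=> sM sM' top cvw; have [hb tv tw] := cvw.
have [x xn xc] := top_ex v; have [y yn yc] := top_ex w.
have h1 := first_col_ge sM (esym xc) tv xn.
have h2 := last_col_ge sM' (esym yc) tw yn.
have : G y x by apply: connect_top => //; split; rewrite ?xc ?yc.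
move/(sM y x); rewrite xn yn (_ : n == n.+1 = false); last by lia.
rewrite (top y) // => h3.
have := int_geD h2 (int_geD h3 h1); rewrite !addr0 !addrA subrK.
by rewrite subrK.
Qed.

End Realizations.

End Chain.

(** * The chain graph is a relation graph *)

Section LinearExtension.
Variables (K : numFieldType) (B : choiceType) (V : lmodType K) (F : B -> V).
Implicit Types x y : {malg K[B]}.

Definition lext x : V := \sum_(i <- msupp x) x@_i *: F i.

Lemma lextEw (d : {fset B}) x : (msupp x `<=` d)%fset ->
  lext x = \sum_(i <- d) x@_i *: F i.
Proof.
move=> sd; rewrite /lext (big_fset_incl _ sd) // => i _ /mcoeff_outdom ->.
by rewrite scale0r.
Qed.

Lemma lext_linear c x y : lext (c *: x + y) = c *: lext x + lext y.
Proof.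
pose d := (msupp x `|` msupp y)%fset.
have sx : (msupp x `<=` d)%fset by apply: fsubsetUl.
have sy : (msupp y `<=` d)%fset by apply: fsubsetUr.
have sxy : (msupp (c *: x + y) `<=` d)%fset.
  apply: (fsubset_trans (msuppD_le _ _)); apply: fsetUSS => //.
  exact: msuppZ_le.
rewrite !(lextEw sx, lextEw sy, lextEw sxy) scaler_sumr -big_split /=.
by apply: eq_bigr => i _; rewrite mcoeffD mcoeffZ scalerDl scalerA.
Qed.

Lemma lextU i : lext << i >> = F i.
Proof.
rewrite (lextEw (msuppU_le (k := i))) big_seq_fset1 mcoeffUU scale1r //.
Qed.

End LinearExtension.

Lemma malgU_scale (K : numFieldType) (B : choiceType) (c : K) (i : B) :
  << c *g i >> = c *: << i >> :> {malg K[B]}.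
Proof. by apply/malgP => k; rewrite mcoeffZ !mcoeffU mulrnAr mulr1. Qed.

Lemma malg_sumU (K : numFieldType) (B : choiceType) (x : {malg K[B]}) :
  x = \sum_(i <- msupp x) x@_i *: << i >>.
Proof. by rewrite {1}[x]monalgE; apply: eq_bigr => i _; rewrite malgU_scale. Qed.

Definition lext_endo (K : numFieldType) (B : choiceType) (F : B -> {malg K[B]}) :
  endo {malg K[B]} := Endo (lext_linear F).

Definition hval (K : numFieldType) (n : nat) k (M : tableau K n) : K :=
  k%:R + \sum_(v : vertex n | vrow v == k.+1) M v - \sum_(v : vertex n | vrow v == k) M v.

(** * The defining relations for the truncated operators *)

Section GTRelations.
Variables (K : numFieldType) (n : nat) (t : 'S_n) (b : bool).
Hypothesis n2 : (2 <= n)%N.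
Local Notation G := (chain_graph t b).
Variable L : tableau K n.
Local Notation inB := (gt_basis_pred G L).
Variables (V : lmodType K) (gv : tableau K n -> V).
Variables (gt_op : bool -> nat -> endo V) (gt_cartan : nat -> endo V).
Implicit Types (M : tableau K n) (u v w x y : vertex n) (s : bool).

Hypothesis gt_vec_out : forall M, ~~ inB M -> gv M = 0.
Hypothesis gt_endoP : forall f g : endo V,
  (forall M, inB M -> f (gv M) = g (gv M)) -> f = g.
Hypothesis gt_opE : forall s k M, inB M ->
  gt_op s k (gv M) = \sum_(v | vrow v == k.+1) coef s M v *: gv (step s v M).
Hypothesis gt_cartanE : forall k M, inB M -> gt_cartan k (gv M) = hval k M *: gv M.

(** The untruncated sum over paths, the head of the list being applied first: intermediate tableaux
    may leave the basis and only the endpoint is truncated, whereas [ops] truncates at every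
    step. *)
Fixpoint walk (xs : seq (bool * nat)) M : V :=
  if xs is x :: xs' then
    \sum_(v | vrow v == x.2.+1) coef x.1 M v *: walk xs' (step x.1 v M)
  else gv M.

Fixpoint ops (xs : seq (bool * nat)) (z : V) : V :=
  if xs is x :: xs' then ops xs' (gt_op x.1 x.2 z) else z.

Lemma sg_int s : sg K s = (if s then 1 else -1 : int)%:~R.
Proof. by case: s. Qed.

(* Hence compositions of the truncated operators agree with the untruncated
   sums: a path that leaves the basis never comes back to it. *)
Lemma region_step s v M x y : vr x = (vr y).+1 :> nat ->
  int_ge 0 (M x - M y) -> coef s M v != 0 ->
  int_ge 0 (step s v M x - step s v M y).
Proof.
move=> r [m m0 E] c0.
have xy : x != y by apply: row_neq; rewrite !vrowE r; lia.
have [vx|vx] := eqVneq v x.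
  subst v; rewrite step_id (step_neq _ _ (w := y)) 1?eq_sym // addrAC E.
  rewrite sg_int -rmorphD /=.
  case: s c0 => c0; first by apply/int_geP; lia.
  have [m1|m1] := eqVneq m 0; last by apply/int_geP; lia.
  case/negP: c0; rewrite /coef (@numerE _ _ _ _ _ y) ?E ?m1 ?mul0r ?mulr0 ?mul0r //.
  by rewrite /adj !vrowE r.
have [vy|vy] := eqVneq v y.
  subst v; rewrite step_id step_neq // opprD addrA E.
  rewrite sg_int -rmorphB /=.
  case: s c0 => c0; last by apply/int_geP; lia.
  have [m1|m1] := eqVneq m 0; last by apply/int_geP; lia.
  case/negP: c0; rewrite /coef (@numerE _ _ _ _ _ x) ?mulr0 ?mul0r //; last first.
    by rewrite /adj !vrowE r.
  by rewrite -opprB E m1 oppr0 mul0r mulr0 mul0r.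
by rewrite !step_neq 1?eq_sym // E; exists m.
Qed.

(** The region where the strict relation of an up arrow fails by an integer absorbs all steps of
    nonzero coefficient, by [region_step], and every vector in it is zero. *)
Lemma walk_region xs M x y : up_arrow t y x -> int_ge 0 (M x - M y) -> walk xs M = 0.
Proof.
move=> uyx; have r : vr x = (vr y).+1 :> nat by case/and3P: uyx => _ /eqP.
elim: xs M => [|[s k] xs IH] M D /=.
  apply: gt_vec_out; apply/asboolP => -[[sM _] _].
  have := int_geD D (satisfies_up sM uyx).
  by rewrite add0r addrA subrK subrr => /(int_geP K 1 0).
apply: big1 => v _; have [->|c0] := eqVneq (coef s M v) 0; first by rewrite scale0r.
by rewrite IH ?scaler0 //; apply: region_step.
Qed.

(** By [region_step], a step of nonzero coefficient preserves the relations of down arrows, and the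
    top row does not move. Only the strict relation of an up arrow can break, which leads into the
    absorbing region. *)
Lemma step_out s v M : inB M -> (vrow v < n)%N -> coef s M v != 0 ->
  ~~ inB (step s v M) ->
  exists x y, up_arrow t y x /\ int_ge 0 (step s v M x - step s v M y).
Proof.
move=> /asboolP[[sM rM] [z [z0 ME]]] vn c0 /asboolP nB.
apply: contrapT => nex; apply: nB.
have dint x : is_int (step s v M x - M x).
  rewrite stepE addrC addKr; case: eqP => _; [exact: is_int_sg | exact: is_int0].
split; first split.
- move=> x y; rewrite /chain_graph => /or3P[xy|xy|xy].
  + have r : vr x = (vr y).+1 :> nat by case/and3P: xy => _ /eqP.
    rewrite !vrowE r (_ : _ == _ = false); last by lia.
    by apply: region_step => //; apply: (satisfies_down sM xy).
  + have r : vr y = (vr x).+1 :> nat by case/and3P: xy => _ /eqP.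
    rewrite !vrowE r eqxx.
    have [m _ E] := satisfies_up sM xy.
    have [p Ex] := dint x; have [q Ey] := dint y.
    have E' : step s v M x - step s v M y = (p - q + m)%:~R.
      rewrite -[step s v M x](subrK (M x)) -[step s v M y](subrK (M y)) Ex Ey.
      by rewrite rmorphD rmorphB /= -E; ring.
    rewrite E'; apply/int_geP; rewrite leNgt; apply/negP => lt1; apply: nex.
    exists y, x; split=> //; rewrite -opprB E' -rmorphN; apply/int_geP; lia.
  + move: xy (sM x y); rewrite {1}/top_arrow => /and5P[hb xn yn tx ty].
    have xv : x != v by apply: row_neq; rewrite (eqP xn); lia.
    have yv : y != v by apply: row_neq; rewrite (eqP yn); lia.
    rewrite !step_neq //; apply.
    by rewrite /chain_graph /top_arrow hb xn yn tx ty !orbT.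
- move=> x y r rn iM; apply: rM => //.
  have -> : M x - M y = step s v M x - step s v M y - (step s v M x - M x) + (step s v M y - M y).
    by ring.
  by apply: is_intD => //; apply: is_intB.
- case: (is_int_sg K s) => e Ee.
  exists (fun x => z x + (if x == v then e else 0)); split.
    move=> x xn; rewrite z0 // add0r; case: eqP => // xv.
    by move: vn; rewrite -xv xn ltnn.
  apply/ffunP => x; rewrite stepE ME !ffunE rmorphD /= addrA; congr (_ + _).
  by case: eqP => _; rewrite ?Ee.
Qed.

Lemma ops_walk xs M : all (fun i : bool * nat => i.2.+1 < n)%N xs -> inB M -> ops xs (gv M) = walk xs M.
Proof.
have ops_sum ys (I : finType) (P : pred I) (c : I -> K) (F : I -> V) :
    ops ys (\sum_(i | P i) c i *: F i) = \sum_(i | P i) c i *: ops ys (F i).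
  elim: ys F => [|[s k] ys IH] F //=.
  by rewrite endo_lin_sum IH.
have ops0 ys : ops ys 0 = 0 by elim: ys => [|[s k] ys IH] //=; rewrite endo_0.
elim: xs M => [|[s k] xs IH] M //= /andP[kn xn] BM.
rewrite gt_opE // ops_sum; apply: eq_bigr => v /eqP vr.
have [->|c0] := eqVneq (coef s M v) 0; first by rewrite !scale0r.
have [B'|nB'] := boolP (inB (step s v M)); first by rewrite IH.
rewrite gt_vec_out // ops0; congr (_ *: _).
have [|x [y [u D]]] := step_out BM _ c0 nB'; first by rewrite vr.
by rewrite (walk_region _ u D).
Qed.

Lemma inB_real M : inB M -> realization G M.
Proof. by case/asboolP. Qed.

Lemma inB_top M x : inB M -> vrow x = n -> M x = L x.
Proof. by case/asboolP => _ [z [z0 ->]] xn; rewrite ffunE z0 // addr0. Qed.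

Lemma walk_comm (g g' : bool * nat) M :
  (forall v w, vrow v == g.2.+1 -> vrow w == g'.2.+1 ->
    coef g.1 M v * coef g'.1 (step g.1 v M) w = coef g'.1 M w * coef g.1 (step g'.1 w M) v) ->
  walk [:: g; g'] M = walk [:: g'; g] M.
Proof.
move=> h /=; under eq_bigr do rewrite scaler_sumr.
under [RHS]eq_bigr do rewrite scaler_sumr.
rewrite [RHS]exchange_big /=; apply: eq_bigr => v vr; apply: eq_bigr => w wr.
by rewrite !scalerA stepC h.
Qed.

Lemma gt_op_comm s s' k k' : (k.+1 < n)%N -> (k'.+1 < n)%N ->
  (forall M v w, vrow v == k.+1 -> vrow w == k'.+1 ->
    coef s M v * coef s' (step s v M) w = coef s' M w * coef s (step s' w M) v) ->
  br (gt_op s k) (gt_op s' k') = 0.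
Proof.
move=> hk hk' h; apply: gt_endoP => M BM; rewrite endo_brE.
have E1 := @ops_walk [:: (s', k'); (s, k)] M; have E2 := @ops_walk [:: (s, k); (s', k')] M.
rewrite /= ?hk ?hk' /= in E1 E2; rewrite E1 // E2 //.
by rewrite [X in _ - X](@walk_comm (s, k) (s', k')) ?subrr //; apply: h.
Qed.

Lemma real_crit M v w : realization G M -> vrow v = vrow w -> (vrow v < n)%N -> v != w ->
  is_int (M v - M w) -> crit t b v w \/ crit t b w v.
Proof.
move=> [_ rM] vw vn nvw /(rM _ _ vw vn) /(same_component_row vw)[E|c|c].
- by rewrite E eqxx in nvw.
- by left.
- by right.
Qed.

(** Both [v] and [w] move by [sg s]. Comparing one of them before the move with the other after it
    gains a unit over [crit_gap], and the bound $2$ keeps the difference away from $0$ and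
    $\pm1$. *)
Lemma serre_gap s M u v w : inB M -> inB (step s w (step s v (step s u M))) ->
  vrow v = vrow w -> vrow u != vrow v -> (vrow v < n)%N -> v != w -> crit t b v w ->
  int_ge 2 (M w - M v).
Proof.
move=> BM BM' vw uv vn nvw c; set M' := step s w _ in BM'.
have top x : vrow x = n -> M x = M' x by move=> xn; rewrite !inB_top.
have wv : w != v by rewrite eq_sym.
have vu : v != u by apply: row_neq; rewrite eq_sym.
have wu : w != u by apply: row_neq; rewrite -vw eq_sym.
have sM := (inB_real BM).1; have sM' := (inB_real BM').1.
have n1 : 1 <= (n - vrow w)%N :> int by lia.
have Mw : M' w = M w + sg K s by rewrite step_id !step_neq.
have Mv : M' v = M v + sg K s by rewrite step_neq // step_id step_neq.
case: (s) Mw Mv => Mw Mv.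
  have := int_geW n1 (crit_gap sM' sM (fun x h => esym (top x h)) c).
  rewrite Mv /sg => /(int_geD (x := 1) (a := 1)).
  rewrite (_ : 1 + (M w - (M v + 1)) = M w - M v); last by ring.
  by apply; exists 1.
have := int_geW n1 (crit_gap sM sM' top c).
rewrite Mw /sg => /(int_geD (x := 1) (a := 1)).
rewrite (_ : 1 + (M w + -1 - M v) = M w - M v); last by ring.
by apply; exists 1.
Qed.

Lemma serre_sep s M u v w : inB M -> inB (step s w (step s v (step s u M))) ->
  vrow v = vrow w -> vrow u != vrow v -> (vrow v < n)%N -> v != w ->
  [/\ M v - M w != 0, M v - M w != 1 & M v - M w != -1].
Proof.
move=> BM BM' vw uv vn nvw.
have gap (m : int) : -1 <= m <= 1 -> M v - M w <> m%:~R.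
  move=> hm E; have [c|c] : crit t b v w \/ crit t b w v.
  - by apply: (real_crit (inB_real BM)) => //; exists m.
  - have := serre_gap BM BM' vw uv vn nvw c.
    by rewrite -opprB E -rmorphN => /int_geP; lia.
  - rewrite stepC in BM'; rewrite vw in uv vn; rewrite eq_sym in nvw.
    have := serre_gap BM BM' (esym vw) uv vn nvw c.
    by rewrite E => /int_geP; lia.
split; apply/eqP.
- exact: (gap 0).
- exact: (gap 1).
- exact: (gap (-1)).
Qed.

Lemma gt_op_serre_brE s k k' M : inB M -> (k.+1 < n)%N -> (k'.+1 < n)%N ->
  br (gt_op s k) (br (gt_op s k) (gt_op s k')) (gv M) =
  walk [:: (s, k'); (s, k); (s, k)] M - 2 *: walk [:: (s, k); (s, k'); (s, k)] M
  + walk [:: (s, k); (s, k); (s, k')] M.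
Proof.
move=> BM hk hk'; rewrite !endo_brE.
have xB z z' : gt_op s k (z - z') = gt_op s k z - gt_op s k z'.
  by rewrite -[- z']scaleN1r addrC endo_lin scaleN1r addrC.
have e1 := @ops_walk [:: (s, k'); (s, k); (s, k)] M.
have e2 := @ops_walk [:: (s, k); (s, k'); (s, k)] M.
have e3 := @ops_walk [:: (s, k); (s, k); (s, k')] M.
rewrite /= ?hk ?hk' /= in e1 e2 e3; rewrite xB e1 // e2 // e3 //.
by rewrite scaler_nat mulr2n opprB opprD !addrA [LHS]addrAC.
Qed.

(** The three walks end at the same tableaux once the sums are reordered. Adding the total to itself
    with [v] and [w] exchanged produces the vanishing symmetric combinations, so twice the total is
    zero. *)
Lemma walk_serre s k k' M : inB M -> (k.+1 < n)%N -> (k'.+1 < n)%N ->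
  (if s then k' = k.+1 \/ k = k'.+1 else k = k'.+1 \/ k' = k.+1) ->
  walk [:: (s, k'); (s, k); (s, k)] M - 2 *: walk [:: (s, k); (s, k'); (s, k)] M
  + walk [:: (s, k); (s, k); (s, k')] M = 0.
Proof.
move=> BM hk hk' kk'.
pose T v w u := serre_coef s M u v w *: gv (step s w (step s v (step s u M))).
pose X := \sum_(v | vrow v == k.+1) \sum_(w | vrow w == k.+1) \sum_(u | vrow u == k'.+1) T v w u.
have T0 v w u : vrow v == k.+1 -> vrow w == k.+1 -> vrow u == k'.+1 -> T v w u + T w v u = 0.
  move=> vr wr ur; rewrite /T (stepC s s v w) -scalerDl.
  (* Outside the basis the vector is zero and the coefficients may be anything; inside it,
     [serre_sep] excludes the vanishing denominators. *)
  have [B'|/gt_vec_out ->] := boolP (inB (step s w (step s v (step s u M)))); last exact: scaler0.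
  have adj12 : (vrow u == adj s v) || (vrow v == adj s u).
    rewrite /adj (eqP ur) (eqP vr).
    by case: (s) kk' => -[] ->; rewrite /= ?eqxx ?orbT.
  have [vw|vw] := eqVneq v w.
    rewrite -vw; suff -> : serre_coef s M u v v = 0 by rewrite addr0 scale0r.
    by case/orP: adj12; [apply: serre_coef_vv1 | apply: serre_coef_vv2].
  have [|||n0 n1 n3] := serre_sep BM B' _ _ _ vw; rewrite ?(eqP vr) ?(eqP wr) ?(eqP ur) //.
    by apply/eqP; case: (s) kk' => -[]; lia.
  suff -> : serre_coef s M u v w + serre_coef s M u w v = 0 by rewrite scale0r.
  have vwr : vrow v == vrow w by rewrite (eqP vr) eq_sym.
  by case/orP: adj12; [apply: serre_coef_vw1 | apply: serre_coef_vw2].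
have XE : walk [:: (s, k'); (s, k); (s, k)] M - 2 *: walk [:: (s, k); (s, k'); (s, k)] M
  + walk [:: (s, k); (s, k); (s, k')] M = X.
  rewrite /=.
  under eq_bigr => u _ do (rewrite scaler_sumr; under eq_bigr => v _ do rewrite !scaler_sumr).
  under [X in _ - _ *: X]eq_bigr => v _ do
    (rewrite scaler_sumr; under eq_bigr => u _ do rewrite !scaler_sumr; rewrite exchange_big /=).
  under [X in _ + X]eq_bigr => v _ do (rewrite scaler_sumr; under eq_bigr => w _ do rewrite !scaler_sumr).
  rewrite exchange_big /=.
  under [X in X - _ + _]eq_bigr => v _ do rewrite exchange_big /=.
  rewrite scaler_sumr -sumrB -big_split /=; apply: eq_bigr => v vr.
  rewrite scaler_sumr -sumrB -big_split /=; apply: eq_bigr => w wr.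
  rewrite scaler_sumr -sumrB -big_split /=; apply: eq_bigr => u ur.
  have E1 : step s w (step s u (step s v M)) = step s w (step s v (step s u M)).
    by rewrite (stepC s s u v).
  have E2 : step s u (step s w (step s v M)) = step s w (step s v (step s u M)).
    by rewrite (stepC s s u w) E1.
  rewrite /T !scalerA E1 E2.
  by rewrite -scalerBl -scalerDl.
rewrite XE; have XX : X + X = 0.
  rewrite {2}/X exchange_big -big_split /=; apply: big1 => v vr.
  rewrite -big_split /=; apply: big1 => w wr; rewrite -big_split /=; apply: big1 => u ur.
  exact: T0.
by move/eqP: XX; rewrite -mulr2n -scaler_nat scaler_eq0 pnatr_eq0 /= => /eqP.
Qed.

Lemma gt_op_serre s k k' : (k.+1 < n)%N -> (k'.+1 < n)%N ->
  k' = k.+1 \/ k = k'.+1 -> br (gt_op s k) (br (gt_op s k) (gt_op s k')) = 0.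
Proof.
move=> hk hk' kk'; apply: gt_endoP => M BM; rewrite gt_op_serre_brE // walk_serre //.
by case: (s) kk' => //; tauto.
Qed.

Lemma hval_step k s v M : hval k (step s v M) =
  hval k M + sg K s * ((vrow v == k.+1)%:R - (vrow v == k)%:R).
Proof.
have row r : \sum_(w : vertex n | vrow w == r) step s v M w =
    \sum_(w : vertex n | vrow w == r) M w + sg K s * (vrow v == r)%:R.
  under eq_bigr do rewrite stepE; rewrite big_split /=; congr (_ + _).
  have [vr|vr] := eqVneq (vrow v) r.
    rewrite (bigD1 v) /= ?vr // eqxx big1 ?addr0 ?mulr1 // => w /andP[_ /negPf ->//].
  by rewrite big1 ?mulr0 // => w /eqP wr; case: eqP => // wv; rewrite -wr wv eqxx in vr.
rewrite /hval !row; ring.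
Qed.

Lemma gt_cartanC k k' : br (gt_cartan k) (gt_cartan k') = 0.
Proof.
apply: gt_endoP => M BM; rewrite endo_brE !gt_cartanE //.
have lin f c z : (f : endo V) (c *: z) = c *: f z.
  by have := endo_lin f c z 0; rewrite endo_0 !addr0.
by rewrite !lin !gt_cartanE // !scalerA mulrC subrr.
Qed.

Lemma endo_boolB (f : endo V) (a c : bool) z :
  (f *+ a - f *+ c : endo V) z = (a%:R - c%:R) *: f z.
Proof.
have mulb (d : bool) : (f *+ d : endo V) z = d%:R *: f z.
  by case: d; rewrite ?mulr1n ?mulr0n ?scale1r ?scale0r.
by rewrite scalerBl -!mulb.
Qed.

Lemma gt_cartan_op i s k : (k.+1 < n)%N ->
  br (gt_cartan i) (gt_op s k) =
  if s then gt_op s k *+ (i == k) - gt_op s k *+ (i == k.+1)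
  else gt_op s k *+ (i == k.+1) - gt_op s k *+ (i == k).
Proof.
move=> hk; apply: gt_endoP => M BM; rewrite endo_brE gt_cartanE //.
have lin f c z : (f : endo V) (c *: z) = c *: f z.
  by have := endo_lin f c z 0; rewrite endo_0 !addr0.
have E : gt_cartan i (gt_op s k (gv M)) - gt_op s k (hval i M *: gv M) =
   (sg K s * ((i == k)%:R - (i == k.+1)%:R)) *: gt_op s k (gv M).
  rewrite lin gt_opE // endo_lin_sum !scaler_sumr -sumrB; apply: eq_bigr => v /eqP vr.
  have [B'|nB'] := boolP (inB (step s v M)); last first.
    by rewrite gt_vec_out // endo_0 !scaler0 subrr.
  rewrite gt_cartanE // !scalerA -scalerBl hval_step vr eqSS !(eq_sym k) !(eq_sym k.+1).
  by congr (_ *: _); ring.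
rewrite E; case: (s); rewrite endo_boolB /sg ?mul1r // mulN1r opprB //.
Qed.

Lemma gt_op_brE s s' k k' M : inB M -> (k.+1 < n)%N -> (k'.+1 < n)%N ->
  br (gt_op s k) (gt_op s' k') (gv M) =
  walk [:: (s', k'); (s, k)] M - walk [:: (s, k); (s', k')] M.
Proof.
move=> BM hk hk'; rewrite endo_brE.
have E1 := @ops_walk [:: (s', k'); (s, k)] M; have E2 := @ops_walk [:: (s, k); (s', k')] M.
by rewrite /= ?hk ?hk' /= in E1 E2; rewrite E1 // E2.
Qed.

(** Paths that move two different vertices of the row cancel by [coefC_row]; what remains is going
    to a neighbour and back. *)
Lemma gt_op_diag k M : inB M -> (k.+1 < n)%N ->
  br (gt_op true k) (gt_op false k) (gv M) =
  (\sum_(v : vertex n | vrow v == k.+1) (coef false M v * coef true (step false v M) v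
     - coef true M v * coef false (step true v M) v)) *: gv M.
Proof.
move=> BM hk; rewrite gt_op_brE //=.
under eq_bigr do rewrite scaler_sumr.
under [X in _ - X]eq_bigr do rewrite scaler_sumr.
rewrite [X in _ - X]exchange_big /= -sumrB scaler_suml; apply: eq_bigr => v vr.
rewrite -sumrB (bigD1 v) //= big1 ?addr0 => [|w /andP[wr wv]].
  by rewrite !scalerA (step_opp false) (step_opp true) -scalerBl.
rewrite !scalerA stepC -coefC_row ?subrr //.
by rewrite (eqP wr) eq_sym.
Qed.

Lemma real_neq M v w : realization G M -> vrow v = vrow w -> (vrow v < n)%N -> v != w ->
  M v != M w.
Proof.
move=> rM vw vn nvw; apply/eqP => E; have sM := rM.1.
have : crit t b v w \/ crit t b w v.
  by apply: (real_crit rM) => //; rewrite E subrr; apply: is_int0.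
case=> c; have := crit_gap sM sM (fun _ _ => erefl) c; rewrite E subrr.
  by move=> /(int_geP K _ 0); rewrite vw in vn; lia.
by move=> /(int_geP K _ 0); lia.
Qed.

Lemma real_succ M v w : realization G M -> vrow v = vrow w -> (vrow v < n)%N ->
  M v + 1 = M w -> crit t b v w.
Proof.
move=> rM vw vn E; have sM := rM.1.
have nvw : v != w.
  apply: contra_eq_neq E => ->; rewrite -subr_eq0 addrC addKr; exact: oner_neq0.
have : crit t b v w \/ crit t b w v.
  apply: (real_crit rM) => //; rewrite -E opprD addrA subrr sub0r.
  by exists (-1).
case=> // c; have := crit_gap sM sM (fun _ _ => erefl) c.
rewrite -E opprD addrA subrr sub0r => /(int_geP K _ (-1)); lia.
Qed.

Lemma crit_eq v w v' w' : vrow v = vrow v' -> vrow w = vrow w' ->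
  crit t b v w -> crit t b v' w' -> v = v' /\ w = w'.
Proof.
move=> rv rw [_ tv tw] [_ tv' tw'].
split; apply: vertex_eq; try exact: vrow_inj; apply: (@perm_inj _ t); apply: val_inj.
  by rewrite /= tv tv'.
by rewrite /= tw tw'.
Qed.

Lemma diagonal_value k M : inB M -> (k.+1 < n)%N ->
  \sum_(v : vertex n | vrow v == k.+1) (coef false M v * coef true (step false v M) v
     - coef true M v * coef false (step true v M) v) = hval k M - hval k.+1 M.
Proof.
move=> BM hk; have rM := inB_real BM; have sM := rM.1.
have -> : hval k M - hval k.+1 M =
  (\sum_(v : vertex n | vrow v == k.+1) M v) *+ 2 - \sum_(v : vertex n | vrow v == k.+2) M v
   - \sum_(v : vertex n | vrow v == k) M v - 1.
  by rewrite /hval -[k.+1%:R]natr1; ring.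
have neq v w : vrow v = k.+1 -> vrow w = k.+1 -> v != w -> M v != M w.
  by move=> vr wr; apply: real_neq; rewrite ?vr ?wr.
have [[v [w [vr wr E]]]|nex] :=
  pselect (exists v w, [/\ vrow v = k.+1, vrow w = k.+1 & M v + 1 = M w]); last first.
  apply: diagonal_generic => // v w vr wr vw; split; first exact: neq.
  by apply/eqP => E; apply: nex; exists v, w.
have c : crit t b v w by apply: (real_succ rM) => //; rewrite ?vr ?wr.
have [hb tv tw] := c.
have [|u0 r0 c0] := @above_ex n v; first by rewrite vr.
have [|u1 r1 c1] := @above_ex n w; first by rewrite wr.
have vw : v != w.
  apply: contra_eq_neq E => ->; rewrite -subr_eq0 addrC addKr; exact: oner_neq0.
have d0 : down_arrow t u0 v by apply: first_col_down => //; rewrite c0.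
have d1 : up_arrow t w u1 by apply: last_col_up.
have cu : crit t b u0 u1 by split; rewrite ?c0 ?c1.
have [p p0 pE] := satisfies_down sM d0.
have [q q1 qE] := satisfies_up sM d1.
have [g g0 gE] := crit_gap sM sM (fun _ _ => erefl) cu.
have : M v + 1 = M w by [].
(* The unit difference between [w] and [v] is the sum of three gaps along $v,u_0,u_1,w$: [p], [g]
   nonnegative and [q] at least one. Hence [p] and [g] vanish and both upper entries equal [M v]. *)
have /(intr_inj (R := K)) sum1 : (p + q + g)%:~R = 1%:~R :> K.
  rewrite !rmorphD /= -pE -qE -gE.
  have -> : M w = M v + 1 by [].
  by ring.
have gE0 : g = 0 by lia.
have pE0 : p = 0 by lia.
move=> _.
have Mu0 : M u0 = M v by apply/eqP; rewrite -subr_eq0 pE pE0.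
have Mu1 : M u1 = M v by rewrite -Mu0; apply/eqP; rewrite -subr_eq0 gE gE0.
apply: (@diagonal_degenerate _ _ _ _ _ _ v w u0 u1) => //.
- by rewrite vrowE r0 -vr.
- by rewrite vrowE r1 -wr.
- apply/eqP => u01; have : vc v = vc w by rewrite -c0 -c1 u01.
  by move=> vcE; move: tv; rewrite vcE tw; lia.
move=> v' w' vr' wr' vw' n1 n1'; split; first exact: neq.
apply/eqP => E'; have c' : crit t b v' w' by apply: (real_succ rM) => //; rewrite ?vr' ?wr'.
have [||Ev Ew] := crit_eq _ _ c' c; rewrite ?vr ?wr //.
by rewrite Ev Ew !eqxx in n1.
Qed.

Lemma gt_op_ef k l : (k.+1 < n)%N -> (l.+1 < n)%N ->
  br (gt_op true k) (gt_op false l) = (gt_cartan k - gt_cartan k.+1) *+ (k == l).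
Proof.
move=> hk hl; have [<-|kl] := eqVneq k l; last first.
  rewrite mulr0n; apply: gt_op_comm => // M v w vr wr; apply: coefC_raise_lower.
  by rewrite (eqP vr) (eqP wr) eqSS.
rewrite mulr1n; apply: gt_endoP => M BM; rewrite gt_op_diag // diagonal_value //.
rewrite -[RHS]/(gt_cartan k (gv M) - gt_cartan k.+1 (gv M)).
by rewrite !gt_cartanE // scalerBl.
Qed.

Lemma gt_op_far s k l : (k.+1 < l)%N -> (l.+1 < n)%N -> br (gt_op s k) (gt_op s l) = 0.
Proof.
move=> kl hl; apply: gt_op_comm => //; first by lia.
move=> M v w /eqP vr /eqP wr; apply: coefC_far; rewrite ?/adj ?vr ?wr; try lia.
  by case: s => /=; lia.
by case: s => /=; lia.
Qed.

Lemma gt_relations_action : exists act : 'M[K]_n -> V -> V,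
  [/\ is_gl_action act,
      forall i j : 'I_n, j = i.+1 :> nat -> act (delta_mx i j) =1 gt_op true i,
      forall i j : 'I_n, j = i.+1 :> nat -> act (delta_mx j i) =1 gt_op false i &
      forall i : 'I_n, act (delta_mx i i) =1 gt_cartan i].
Proof.
apply: gl_action_of_serre.
- exact: gt_op_far.
- by move=> i hi; apply: gt_op_serre; [lia | lia | left].
- by move=> i hi; apply: gt_op_serre; [lia | lia | right].
- exact: gt_op_far.
- by move=> i hi; apply: gt_op_serre; [lia | lia | left].
- by move=> i hi; apply: gt_op_serre; [lia | lia | right].
- by move=> i j _ _; apply: gt_cartanC.
- by move=> i k _ hk; rewrite (gt_cartan_op i true).
- by move=> i k _ hk; rewrite (gt_cartan_op i false).
- exact: gt_op_ef.
Qed.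

End GTRelations.

Section GTSpace.
Variables (K : numFieldType) (n : nat) (G : rel (vertex n)) (L : tableau K n).
Local Notation inB := (gt_basis_pred G L).
Local Notation gv := (gt_vec G L).
Implicit Types M : tableau K n.

Lemma gt_vecE M (BM : inB M) : gv M = << (Sub M BM : gt_basis G L) >>.
Proof. by rewrite /gt_vec insubT. Qed.

Lemma gt_vec_out M : ~~ inB M -> gv M = 0.
Proof. by move=> BM; rewrite /gt_vec insubN. Qed.

Lemma gt_endoP (f g : endo (gt_space G L)) :
  (forall M, inB M -> f (gv M) = g (gv M)) -> f = g.
Proof.
move=> fg; apply: endoP => z; rewrite [z]malg_sumU !endo_lin_sum.
apply: eq_bigr => i _; congr (_ *: _).
by have := fg _ (valP i); rewrite /gt_vec valK.
Qed.

Lemma lext_endo_ex (F : tableau K n -> gt_space G L) :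
  exists f : endo (gt_space G L), forall M, inB M -> f (gv M) = F M.
Proof.
exists (@lext_endo K (gt_basis G L) (fun i => F (val i))) => M BM.
by rewrite gt_vecE; apply: lextU.
Qed.

End GTSpace.

(* [gt_action] with the space left abstract, which keeps the monoid algebra
   folded in the computations below. *)
Definition gt_formulas (K : numFieldType) (n : nat) (V : lmodType K) (inB : pred (tableau K n))
    (gv : tableau K n -> V) (act : 'M[K]_n -> V -> V) : Prop :=
  forall M : tableau K n, inB M ->
  [/\ forall i j : 'I_n, j = i.+1 :> nat ->
        act (delta_mx i j) (gv M) =
        - \sum_(v : vertex n | vrow v == i.+1)
            ((\prod_(w : vertex n | vrow w == i.+2) (M v - M w)) / gt_denom M v)
              *: gv (gt_shift v 1 M),
      forall i j : 'I_n, j = i.+1 :> nat ->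
        act (delta_mx j i) (gv M) =
        \sum_(v : vertex n | vrow v == i.+1)
            ((\prod_(w : vertex n | vrow w == i) (M v - M w)) / gt_denom M v)
              *: gv (gt_shift v (-1) M) &
      forall i : 'I_n,
        act (delta_mx i i) (gv M) =
        (i%:R + \sum_(v : vertex n | vrow v == i.+1) M v
              - \sum_(v : vertex n | vrow v == i) M v) *: gv M].

Lemma gt_formulas_action (K : numFieldType) (n : nat) (t : 'S_n) (b : bool)
    (L : tableau K n) (V : lmodType K) (gv : tableau K n -> V) :
  (2 <= n)%N ->
  (forall M, ~~ gt_basis_pred (chain_graph t b) L M -> gv M = 0) ->
  (forall f g : endo V,
    (forall M, gt_basis_pred (chain_graph t b) L M -> f (gv M) = g (gv M)) -> f = g) ->
  (forall F : tableau K n -> V, exists f : endo V,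
    forall M, gt_basis_pred (chain_graph t b) L M -> f (gv M) = F M) ->
  exists act : 'M[K]_n -> V -> V, is_gl_action act /\
    gt_formulas (gt_basis_pred (chain_graph t b) L) gv act.
Proof.
move=> n2 out ext ex.
have [op opE] := choice (fun p : bool * nat => ex
  (fun M => \sum_(v | vrow v == p.2.+1) coef p.1 M v *: gv (step p.1 v M))).
have [ca caE] := choice (fun k : nat => ex (fun M => hval k M *: gv M)).
have opE' s k M : gt_basis_pred (chain_graph t b) L M -> op (s, k) (gv M) =
    \sum_(v | vrow v == k.+1) coef s M v *: gv (step s v M) by apply: (opE (s, k)).
have [act [actP eE fE hE]] := @gt_relations_action K n t b n2 L V gv
  (fun s k => op (s, k)) ca out ext opE' caE.
exists act; split=> // M BM; split=> [i j ij|i j ij|i].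
- rewrite eE // opE' // -sumrN; apply: eq_bigr => v /eqP vr.
  rewrite -scaleNr /coef /sg mulN1r mulNr; congr (- (_ / _) *: _).
  by apply: eq_bigl => w; rewrite /adj vr.
- rewrite fE // opE' //; apply: eq_bigr => v /eqP vr.
  rewrite /coef /sg opprK mul1r; congr (_ / _ *: _).
  by apply: eq_bigl => w; rewrite /adj vr.
- by rewrite hE caE.
Qed.

Lemma chain_relation_graph (K : numFieldType) (n : nat) (t : 'S_n) (b : bool) :
  (2 <= n)%N -> relation_graph K (chain_graph t b).
Proof.
move=> n2; split; [exact: chain_admissible | exact: chain_non_critical |].
move=> L _; exact: (gt_formulas_action n2 (@gt_vec_out _ _ _ L) (@gt_endoP _ _ _ L)
  (@lext_endo_ex _ _ _ L)).
Qed.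

(** * Generation by the extremal vector *)

Section GlUnits.
Variables (K : numFieldType) (V : lmodType K) (n : nat) (act : 'M[K]_n -> V -> V).
Hypothesis actP : is_gl_action act.

Definition act_endo x : endo V := Endo (fun c u v => gl_act_linear_r actP c x u v).
Definition glE (i j : 'I_n) : endo V := act_endo (delta_mx i j).

Lemma act_0l v : act 0 v = 0.
Proof.
have := gl_act_linear_l actP 1 0 0 v; rewrite scaler0 addr0 scale1r => /eqP.
by rewrite -subr_eq0 opprD addrA subrr add0r oppr_eq0 => /eqP.
Qed.

Lemma act_Zl c x v : act (c *: x) v = c *: act x v.
Proof. by rewrite -[c *: x]addr0 (gl_act_linear_l actP) act_0l addr0. Qed.

Lemma act_Dl x y v : act (x + y) v = act x v + act y v.
Proof. by have := gl_act_linear_l actP 1 x y v; rewrite !scale1r. Qed.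

Lemma act_suml (I : Type) (r : seq I) (P : pred I) (F : I -> 'M[K]_n) v :
  act (\sum_(i <- r | P i) F i) v = \sum_(i <- r | P i) act (F i) v.
Proof. by elim/big_rec2: _ => [|i x y _ <-]; rewrite ?act_0l ?act_Dl. Qed.

Lemma glE_br i j k l : br (glE i j) (glE k l) = glE i l *+ (j == k) - glE k j *+ (l == i).
Proof.
apply: endoP => v; rewrite endo_brE -(gl_act_bracket actP) !mul_delta_mx_cond.
rewrite -scaleN1r act_Dl act_Zl scaleN1r.
have mulb (x : 'M[K]_n) (d : bool) : act (x *+ d) v = (act_endo x *+ d) v.
  by case: d; rewrite ?mulr1n ?mulr0n ?act_0l.
by rewrite !mulb.
Qed.

(** The units with indices at most [k] are generated under brackets by the simple root vectors and
    the diagonal units, so a property stable under brackets need only be checked on these. *)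
Lemma glE_ind (k : nat) (Q : endo V -> Prop) :
  (forall f g, Q f -> Q g -> Q (br f g)) ->
  (forall i j : 'I_n, j = i.+1 :> nat -> (j <= k)%N -> Q (glE i j) /\ Q (glE j i)) ->
  (forall i : 'I_n, (i <= k)%N -> Q (glE i i)) ->
  forall a c : 'I_n, (a <= k)%N -> (c <= k)%N -> Q (glE a c).
Proof.
move=> Qbr Qg Qh.
have up m (a c : 'I_n) : (c <= k)%N -> c = (a + m.+1)%N :> nat -> Q (glE a c) /\ Q (glE c a).
  elim: m a c => [|m IH] a c ck E; first by apply: Qg => //; rewrite E addn1.
  have dn : (a + m.+1 < n)%N by have := ltn_ord c; lia.
  pose d := Ordinal dn.
  have [|//|Q1 Q2] := IH a d; first by rewrite /=; lia.
  have [||Q3 Q4] := Qg d c; [by rewrite /= E; lia | by [] |].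
  have ac : (c == a) = false by apply/negP => /eqP/(congr1 val) /=; lia.
  have ca : (a == c) = false by rewrite eq_sym.
  have E1 : glE a c = br (glE a d) (glE d c) by rewrite glE_br eqxx ac mulr1n mulr0n subr0.
  have E2 : glE c a = br (glE c d) (glE d a) by rewrite glE_br eqxx ca mulr1n mulr0n subr0.
  by rewrite E1 E2; split; apply: Qbr.
move=> a c ak ck; case: (ltn_cases a c) => [[m E]|[m E]|/val_inj <-]; last exact: Qh.
- by have [] := up m a c ck E.
- by have [] := up m c a ak E.
Qed.

Definition casimir (k : nat) : endo V :=
  \sum_(a : 'I_n | (a <= k)%N) \sum_(c : 'I_n | (c <= k)%N) glE a c * glE c a.

Lemma br_sumr (I : finType) (P : pred I) (x : endo V) (F : I -> endo V) :
  br x (\sum_(i | P i) F i) = \sum_(i | P i) br x (F i).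
Proof. by rewrite /br mulr_sumr mulr_suml sumrB. Qed.

Lemma br_mulr (x y z : endo V) : br x (y * z) = br x y * z + y * br x z.
Proof. by rewrite /br mulrBl mulrBr !mulrA addrA subrK. Qed.

(** The bracket acts as a derivation; its effects on the left and on the right factors are [A1 - A2]
    and [A2 - A1]. *)
Lemma casimir_comm k (c d : 'I_n) : (c <= k)%N -> (d <= k)%N -> br (glE c d) (casimir k) = 0.
Proof.
move=> ck dk; rewrite /casimir br_sumr.
under eq_bigr => a _ do (rewrite br_sumr; under eq_bigr => b _ do rewrite br_mulr !glE_br).
pose A1 := \sum_(b : 'I_n | (b <= k)%N) glE c b * glE b d.
pose A2 := \sum_(a : 'I_n | (a <= k)%N) glE a d * glE c a.
have pick (i : 'I_n) (F : 'I_n -> endo V) : (i <= k)%N ->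
    \sum_(a : 'I_n | (a <= k)%N) F a *+ (i == a) = F i.
  move=> ik; rewrite (bigD1 i) //= eqxx mulr1n big1 ?addr0 // => a /andP[_ ai].
  by rewrite eq_sym (negPf ai).
transitivity ((A1 - A2) + (A2 - A1)); last by rewrite addrA subrK subrr.
under eq_bigr => a _ do rewrite big_split /=.
rewrite big_split /=; congr (_ + _).
  under eq_bigr => a _ do (under eq_bigr => b _ do rewrite mulrBl !mulrnAl; rewrite sumrB).
  rewrite sumrB; congr (_ - _).
    rewrite exchange_big /=; apply: eq_bigr => b _.
    by rewrite (pick d (fun a => glE c b * glE b a)).
  apply: eq_bigr => a _.
  by under eq_bigr => b _ do rewrite (eq_sym b); rewrite (pick c (fun b => glE a d * glE b a)).
under eq_bigr => a _ do (under eq_bigr => b _ do rewrite mulrBr !mulrnAr; rewrite sumrB).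
rewrite sumrB; congr (_ - _).
  by apply: eq_bigr => a _; rewrite (pick d (fun b => glE a b * glE c a)).
rewrite exchange_big /=; apply: eq_bigr => b _.
by under eq_bigr => a _ do rewrite (eq_sym a); rewrite (pick c (fun a => glE a b * glE b d)).
Qed.

End GlUnits.

Section Separation.
Variables (K : numFieldType) (V : lmodType K) (P : V -> Prop) (C : endo V).
Hypothesis P0 : P 0.
Hypothesis PZ : forall c u v, P u -> P v -> P (c *: u + v).
Hypothesis PC : forall u, P u -> P (C u).

(** Applying the product of all $C-x_j$ with $j\ne i$ stays inside [P], kills every other summand
    and multiplies [z i] by a nonzero scalar. *)
Lemma eigen_separation (I : finType) (A : pred I) (z : I -> V) (x : I -> K) :
  (forall i, A i -> C (z i) = x i *: z i) ->
  (forall i j, A i -> A j -> i != j -> x i != x j) ->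
  P (\sum_(i | A i) z i) -> forall i, A i -> P (z i).
Proof.
move=> Cz xx Pz i Ai.
have lin c u : C (c *: u) = c *: C u by have := endo_lin C c u 0; rewrite endo_0 !addr0.
pose D y (u : V) := C u - y *: u.
have PD y u : P u -> P (D y u).
  by move=> Pu; rewrite /D addrC -scaleNr; apply: PZ => //; apply: PC.
have Dsum y (c : I -> K) :
    D y (\sum_(j | A j) c j *: z j) = \sum_(j | A j) (c j * (x j - y)) *: z j.
  rewrite /D endo_lin_sum scaler_sumr -sumrB; apply: eq_bigr => j Aj.
  by rewrite Cz // !scalerA -scalerBl mulrBr mulrC [y * _]mulrC.
have fold (s : seq I) (c : I -> K) : P (\sum_(j | A j) c j *: z j) ->
    P (\sum_(j | A j) (c j * \prod_(k <- s) (x j - x k)) *: z j).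
  elim: s c => [|k s IH] c Pc.
    by under eq_bigr => j _ do rewrite big_nil mulr1.
  under eq_bigr => j _ do rewrite big_cons mulrA.
  by apply: IH; rewrite -Dsum; apply: PD.
have := fold [seq j <- enum A | j != i] (fun => 1).
under eq_bigr => j _ do rewrite scale1r.
move=> /(_ Pz).
rewrite (bigD1 i) //= [X in _ + X]big1 ?addr0; last first.
  move=> j /andP[Aj ji]; rewrite mul1r (big_rem j) /=; last first.
    by rewrite mem_filter ji mem_enum.
  by rewrite subrr mul0r scale0r.
set c := 1 * _ => Pc.
have c0 : c != 0.
  rewrite /c mul1r prodf_seq_neq0; apply/allP => j; rewrite mem_filter mem_enum => /andP[ji Aj] /=.
  by rewrite subr_eq0 xx // eq_sym.
have := PZ c^-1 Pc P0; by rewrite addr0 scalerA mulVf // scale1r.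
Qed.

End Separation.

(** * Normalized entries and tight tableaux *)

Section Normalized.
Variables (K : numFieldType) (n : nat) (t : 'S_n) (b : bool).
Local Notation G := (chain_graph t b).
Implicit Types (M : tableau K n) (v w x y : vertex n) (i j k a : nat).

Definition lab i : nat := if insub i is Some o then t (o : 'I_n) else 0%N.

Lemma labE (o : 'I_n) : lab o = t o.
Proof. by rewrite /lab valK. Qed.

Lemma lab_inj i j : (i < n)%N -> (j < n)%N -> lab i = lab j -> i = j.
Proof.
move=> hi hj; have /= -> := labE (Ordinal hi); have /= -> := labE (Ordinal hj).
by move=> /val_inj/perm_inj [].
Qed.

(** A $\rho$-shift for the order of the labels, taken row by row: it changes by one across an up
    arrow and is constant across a down arrow. *)
Definition rk v : nat := (\sum_(0 <= c < (vr v).+1) (lab c < lab (vc v)))%N.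

(* In the normalized entries all vertical relations become weak inequalities. *)
Definition nc M v : K := M v + (rk v)%:R.

Lemma rk_above x y : vc x = vc y -> vr x = (vr y).+1 :> nat ->
  rk x = (rk y + (t (vr x) < t (vc y)))%N.
Proof. by move=> c r; rewrite /rk c r big_nat_recr //= -r !labE. Qed.

Definition vert_arrow x y := down_arrow t x y || up_arrow t x y.

Lemma vert_arrow_nc M x y : vert_arrow x y ->
  (if vrow y == (vrow x).+1 then int_ge 1 (M x - M y) else int_ge 0 (M x - M y)) <->
  int_ge 0 (nc M x - nc M y).
Proof.
case/orP=> /and3P[/eqP c /eqP r l].
  rewrite !vrowE r (_ : _ == _ = false); last by apply/eqP; lia.
  by rewrite /nc (rk_above c r) ltnNge ltnW // addn0 opprD addrACA subrr addr0.
rewrite !vrowE r eqxx /nc (rk_above c r) l natrD.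
have -> : M x + (rk x)%:R - (M y + ((rk x)%:R + 1)) = M x - M y - 1 by ring.
split=> [[m m1 ->]|[m m0 E]].
  by exists (m - 1); rewrite ?rmorphB //=; lia.
exists (m + 1); first by lia.
by rewrite rmorphD /= -E subrK.
Qed.

Lemma satisfies_nc M : satisfies G M <->
  (forall x y, vert_arrow x y -> int_ge 0 (nc M x - nc M y)) /\
  (forall v w, top_arrow t b v w -> int_ge 0 (M v - M w)).
Proof.
have topE v w : top_arrow t b v w -> vrow w == (vrow v).+1 = false.
  by move=> /and5P[_ /eqP -> /eqP -> _ _]; apply/eqP; lia.
split=> [sM|[sv stp] v w].
  split=> v w h.
    apply/(vert_arrow_nc _ h); apply: sM; rewrite /chain_graph.
    by case/orP: h => ->; rewrite ?orbT.
  by have := sM v w; rewrite topE // /chain_graph h !orbT; apply.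
case/or3P => h.
- by apply/vert_arrow_nc; [rewrite /vert_arrow h | apply: sv; rewrite /vert_arrow h].
- by apply/vert_arrow_nc; [rewrite /vert_arrow h orbT | apply: sv; rewrite /vert_arrow h orbT].
- by rewrite topE //; apply: stp.
Qed.

Lemma above_vert x y : vc x = vc y -> vr x = (vr y).+1 :> nat -> vert_arrow x y \/ vert_arrow y x.
Proof.
by move=> c r; case: (vertical_arrow t c r) => h; [left|right]; rewrite /vert_arrow h ?orbT.
Qed.

Lemma col_int M v w : satisfies G M -> vc v = vc w -> is_int (M v - M w).
Proof.
move=> /satisfies_nc[sv _]; have toN x y : is_int (nc M x - nc M y) -> is_int (M x - M y).
  move=> h; have -> : M x - M y = nc M x - nc M y - ((rk x)%:R - (rk y)%:R).
    by rewrite /nc; ring.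
  by apply: is_intB => //; apply: is_intB; [exists (rk x) | exists (rk y)]; rewrite pmulrn.
have top x y : vc x = vc y -> vrow y = n -> is_int (M x - M y).
  move=> c yn; elim/column_ind: x c => [x xn c|x z cxz rxz IH c].
    have -> : x = y by apply: vertex_eq => //; apply: vrow_inj; rewrite xn yn.
    by rewrite subrr; apply: is_int0.
  have -> : M z - M y = (M z - M x) + (M x - M y) by ring.
  apply: is_intD; last by apply: IH; rewrite cxz.
  apply: toN; case: (above_vert cxz rxz) => /sv /int_ge_int //.
  by rewrite -opprB => /is_intN; rewrite opprK.
move=> c; have [x xn xc] := top_ex v.
have -> : M v - M w = (M v - M x) - (M w - M x) by ring.
by apply: is_intB; apply: top => //; rewrite xc.
Qed.

Section Basis.
Variable L : tableau K n.
Hypothesis rL : realization G L.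
Local Notation inB := (gt_basis_pred G L).

(** Each column is linked to the fixed top row by relations with integral differences, so the shift
    from [L] is automatically integral; the component condition is then inherited from [L]. *)
Lemma inB_char M : inB M <-> satisfies G M /\ (forall x, vrow x = n -> M x = L x).
Proof.
split=> [BM|[sM top]].
  by split; [exact: (inB_real BM).1 | move=> x xn; apply: (inB_top BM xn)].
have zE v : exists z : int, M v - L v = z%:~R.
  have [x xn xc] := top_ex v.
  have -> : M v - L v = (M v - M x) - (L v - L x) by rewrite (top x) //; ring.
  by apply: is_intB; apply: col_int => //; exact: rL.1.
have [z zP] := choice zE.
apply/asboolP; split; first split=> // v w r rn iM.
  apply: rL.2 => //; have -> : L v - L w = M v - M w - ((z v)%:~R - (z w)%:~R).
    by rewrite -!zP; ring.
  by apply: is_intB => //; apply: is_intB; [exists (z v) | exists (z w)].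
exists z; split=> [v vn|].
  by apply: (@intr_inj K); rewrite -zP top // subrr.
by apply/ffunP => v; rewrite ffunE -zP addrC subrK.
Qed.

Definition up (k : 'I_n) v : vertex n := if (vr v < k)%N then insubd v (k, vc v) else v.

Lemma up_id (k : 'I_n) v : (k <= vr v)%N -> up k v = v.
Proof. by rewrite /up ltnNge => ->. Qed.

Lemma up_vc (k : 'I_n) v : vc (up k v) = vc v.
Proof.
rewrite /up; case: ifP => // h; rewrite /vc val_insubd /=.
by case: ifP.
Qed.

Lemma up_vr (k : 'I_n) v : (vr v <= k)%N -> vr (up k v) = k.
Proof.
rewrite leq_eqVlt => /orP[/eqP h|h]; first by rewrite up_id ?h //; apply: val_inj.
rewrite /up h /vr val_insubd /=; case: ifP => // /negP[].
by rewrite (leq_trans (vc_le v)) // ltnW.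
Qed.

Lemma up_eq (k : 'I_n) x y : vc x = vc y -> (vr x <= k)%N -> (vr y <= k)%N -> up k x = up k y.
Proof. by move=> c hx hy; apply: vertex_eq; rewrite ?up_vr // !up_vc. Qed.

(** Below the row of index [k] every vertical relation is made an equality in normalized entries;
    this is the extremal tableau of $\mathfrak{gl}_{k+1}$ under the rows that are kept. *)
Definition tight (k : 'I_n) M : tableau K n := [ffun v => nc M (up k v) - (rk v)%:R].

Lemma nc_tight (k : 'I_n) M v : nc (tight k M) v = nc M (up k v).
Proof. by rewrite /nc ffunE subrK. Qed.

Lemma tight_row (k : 'I_n) M v : (k <= vr v)%N -> tight k M v = M v.
Proof. by move=> h; rewrite ffunE up_id // /nc addrK. Qed.

Lemma inB_tight (k : 'I_n) M : inB M -> inB (tight k M).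
Proof.
move=> /inB_char[/satisfies_nc[sv st] top]; apply/inB_char.
have trow x : vrow x = n -> tight k M x = M x.
  by move=> xn; apply: tight_row; have := ltn_ord k; move: xn; rewrite vrowE; lia.
split; last by move=> x xn; rewrite trow // top.
apply/satisfies_nc; split=> [x y h|v w h]; last first.
  by move: (h) => /and5P[_ /eqP vn /eqP wn _ _]; rewrite !trow //; apply: st.
rewrite !nc_tight.
have [hy|hy] := ltnP (vr y) k; have [hx|hx] := ltnP (vr x) k.
- rewrite (@up_eq k x y) ?subrr; [exact: int_ge0 | | exact: ltnW | exact: ltnW].
  by case/orP: h => /and3P[/eqP].
- have [c r] : vc x = vc y /\ (vr x <= k)%N.
    by case/orP: h => /and3P[/eqP c /eqP r _]; split=> //; lia.
  by rewrite (@up_eq k x y) ?subrr; [apply: int_ge0 | | | apply: ltnW].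
- have [c r] : vc x = vc y /\ (vr y <= k)%N.
    by case/orP: h => /and3P[/eqP c /eqP r _]; split=> //; lia.
  by rewrite (@up_eq k x y) ?subrr; [apply: int_ge0 | | apply: ltnW |].
- by rewrite !up_id //; apply: sv.
Qed.

End Basis.

End Normalized.

Lemma row_sum (K : numFieldType) (n i : nat) (F : nat -> K) : (i < n)%N ->
  \sum_(v : vertex n | vrow v == i.+1) F (vc v) = \sum_(0 <= j < i.+1) F j.
Proof.
move=> hi; rewrite big_mkord.
pose h (j : 'I_i.+1) : vertex n :=
  @mkv n (Ordinal hi) (widen_ord hi j) (ltn_ord j).
rewrite (reindex_onto h (fun v => inord (vc v))) /=.
  apply: eq_big => [j|j _]; last by rewrite /vc /=.
  rewrite /vrow /= eqxx /=; apply/eqP/val_inj; rewrite /vc /= inordK //.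
move=> v /eqP vr; apply: vertex_eq.
  by apply: val_inj; move: vr; rewrite vrowE => -[].
by apply: val_inj; rewrite /vc /= inordK // -vr vrowE ltnS vc_le.
Qed.

Lemma int_ge_sum (K : numFieldType) (I : Type) (r : seq I) (P : pred I) (F : I -> K) :
  (forall i, P i -> int_ge 0 (F i)) -> int_ge 0 (\sum_(i <- r | P i) F i).
Proof.
move=> FP; elim/big_ind: _ => // [|x y hx hy]; first exact: int_ge0.
by have := int_geD hx hy; rewrite addr0.
Qed.

(** * Weights and heights *)

Section Heights.
Variables (K : numFieldType) (n : nat) (t : 'S_n) (b : bool).
Local Notation G := (chain_graph t b).
Local Notation lab := (lab t).
Local Notation rk := (rk t).
Local Notation nc := (nc t).
Local Notation tight := (tight t).
Implicit Types (M : tableau K n) (v w x y : vertex n) (i j a : nat).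

Definition nentry M i j : K := \sum_(v | (vr v == i :> nat) && (vc v == j :> nat)) nc M v.

Lemma nentry_vtx M v : nentry M (vr v) (vc v) = nc M v.
Proof.
rewrite /nentry (big_pred1 v) // => w /=.
Qed.

Lemma nentry_nc M v i j : vr v = i :> nat -> vc v = j :> nat -> nentry M i j = nc M v.
Proof. by move=> <- <-; apply: nentry_vtx. Qed.

Lemma row_nc M i : (i < n)%N ->
  \sum_(v : vertex n | vrow v == i.+1) nc M v = \sum_(0 <= j < i.+1) nentry M i j.
Proof.
move=> hi; rewrite -(row_sum _ hi); apply: eq_bigr => v /eqP [vr].
by rewrite (@nentry_nc M v).
Qed.

Definition rank_total m : nat := (\sum_(0 <= j < m) \sum_(0 <= c < m) (lab c < lab j))%N.

(** Each pair of distinct indices is counted once, whatever the labelling. The increment [m] cancels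
    the constant in the Gelfand-Tsetlin weight, which is why [hval_nc] has none. *)
Lemma rank_totalS m : (m < n)%N -> rank_total m.+1 = (rank_total m + m)%N.
Proof.
move=> hm; rewrite /rank_total big_nat_recr //= [in X in (_ + X)%N]big_nat_recr //= ltnn addn0.
under eq_big_nat => j _ do rewrite big_nat_recr //=.
rewrite big_split /= -addnA; congr (_ + _)%N; rewrite -big_split /=.
rewrite -[RHS]subn0 -[RHS]muln1 -sum_nat_const_nat; apply: eq_big_nat => j /andP[_ hj].
case: ltngtP => // /lab_inj E; have : m = j by apply: E => //; apply: ltn_trans hm.
by move=> E'; rewrite E' ltnn in hj.
Qed.

Lemma row_rk i : (i < n)%N ->
  \sum_(v : vertex n | vrow v == i.+1) (rk v)%:R = (rank_total i.+1)%:R :> K.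
Proof.
move=> hi; rewrite /rank_total natr_sum -(row_sum _ hi); apply: eq_bigr => v /eqP [vr].
by rewrite /rk vr.
Qed.

Lemma hval_nc M i : (i < n)%N ->
  hval i M = \sum_(0 <= j < i.+1) nentry M i j - \sum_(0 <= j < i) nentry M i.-1 j.
Proof.
have rowM k : (k < n)%N -> \sum_(v : vertex n | vrow v == k.+1) M v =
    \sum_(0 <= j < k.+1) nentry M k j - (rank_total k.+1)%:R.
  move=> hk; rewrite -row_nc // -row_rk // -sumrB.
  by apply: eq_bigr => v _; rewrite /nc addrK.
move=> hi; rewrite /hval rowM //; case: i hi => [|i] hi.
  rewrite [X in _ - X]big1 => [|v]; last by rewrite vrowE.
  rewrite [X in _ = _ - X]big_geq // !subr0 /rank_total !big_nat1 ltnn.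
  by rewrite /= subr0 add0r.
rewrite rowM /=; last exact: ltnW.
by rewrite (rank_totalS hi) natrD; ring.
Qed.

(** The label difference has the sign of the arrow between the two entries, so on a realization
    every summand is a nonnegative integer. The sum measures the slack left in the vertical
    relations. *)
Definition height (k : nat) M : K := \sum_(0 <= j < k.+1) \sum_(j.+1 <= a < k.+1)
  ((lab a)%:R - (lab j)%:R) * (nentry M a j - nentry M a.-1 j).

(** The eigenvalue of $\sum_a \mathrm{lab}(a)E_{aa}$, a grading element for which $E_{ac}$ has
    degree [lab a - lab c]. *)
Definition wt (k : nat) M : K := \sum_(0 <= a < k.+1) (lab a)%:R * hval a M.

(** Summation by parts splits the weight into a term that sees only the row of index [k] and the
    height below it. *)
Lemma wtE k M : (k < n)%N ->
  wt k M = \sum_(0 <= j < k.+1) (lab j)%:R * nentry M k j + height k M.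
Proof.
elim: k => [|k IH] hk.
  rewrite /wt /height !big_nat1 hval_nc // big_nat1 [X in _ - X]big_geq // subr0.
  by rewrite [X in _ = _ + X]big_geq // addr0.
rewrite /wt big_nat_recr //= -/(wt k M) IH; last exact: ltnW.
rewrite /height [X in _ = _ + X]big_nat_recr //= [X in _ = _ + (_ + X)]big_geq // addr0.
under [X in _ = _ + X]eq_big_nat => j /andP[_ hj] do rewrite big_nat_recr //=.
rewrite big_split /= -/(height k M) hval_nc // !(big_nat_recr k.+1) //=.
have -> : \sum_(0 <= j < k.+1) ((lab k.+1)%:R - (lab j)%:R) * (nentry M k.+1 j - nentry M k j) =
    (lab k.+1)%:R * (\sum_(0 <= j < k.+1) nentry M k.+1 j - \sum_(0 <= j < k.+1) nentry M k j)
    - \sum_(0 <= j < k.+1) (lab j)%:R * nentry M k.+1 j + \sum_(0 <= j < k.+1) (lab j)%:R * nentry M k j.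
  rewrite -sumrB mulr_sumr -sumrB -big_split /=.
  by apply: eq_bigr => j _; ring.
by ring.
Qed.

Lemma nentry_tight (k : 'I_n) M i j : (j <= i)%N -> (i <= k)%N -> nentry (tight k M) i j = nentry M k j.
Proof.
move=> ji ik; have hi : (i < n)%N by apply: leq_ltn_trans ik _.
have hj : (j < n)%N by apply: leq_ltn_trans ji _.
have h : (Ordinal hj <= Ordinal hi)%N by [].
rewrite (@nentry_nc _ (mkv h)) // nc_tight (@nentry_nc _ (up k (mkv h))) ?up_vr ?up_vc //.
Qed.

Lemma hval_tight (k : 'I_n) M i : (i <= k)%N -> hval i (tight k M) = nentry M k i.
Proof.
move=> ik; have hi : (i < n)%N by apply: leq_ltn_trans ik _.
rewrite hval_nc // big_nat_recr //=.
have -> : \sum_(0 <= j < i) nentry (tight k M) i j = \sum_(0 <= j < i) nentry M k j.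
  by apply: eq_big_nat => j /andP[_ ji]; rewrite nentry_tight // ltnW.
have -> : \sum_(0 <= j < i) nentry (tight k M) i.-1 j = \sum_(0 <= j < i) nentry M k j.
  by apply: eq_big_nat => j /andP[_ ji]; rewrite nentry_tight //; lia.
by rewrite nentry_tight // addrAC subrr add0r.
Qed.

Lemma height_tight (k : 'I_n) M : height k (tight k M) = 0.
Proof.
rewrite /height big_nat_cond big1 // => j /andP[/andP[_ jk] _].
rewrite big_nat_cond big1 // => a /andP[/andP[ja ak] _].
by rewrite !nentry_tight ?subrr ?mulr0 //; lia.
Qed.

Lemma height_ge0 M k : satisfies G M -> (k < n)%N -> int_ge 0 (height k M).
Proof.
move=> /satisfies_nc[sv _] hk; rewrite /height big_nat_cond; apply: int_ge_sum => j /andP[/andP[_ jk] _].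
rewrite big_nat_cond; apply: int_ge_sum => a /andP[/andP[ja ak] _].
have ha : (a < n)%N by lia.
have hj : (j < n)%N by lia.
have h : (Ordinal hj <= Ordinal ha)%N by rewrite /=; lia.
have [|y r c] := @below_ex n (mkv h); first by [].
rewrite (@nentry_nc _ (mkv h)) // (@nentry_nc _ y) ?c //; last by have : a = (vr y).+1 := r; lia.
have mulint (p : nat) z : int_ge 0 z -> int_ge 0 (p%:R * z : K).
  by move=> [m m0 ->]; exists (p%:Z * m); rewrite ?mulr_ge0 // rmorphM.
case: (vertical_arrow t (esym c) r) => arr.
  have := sv (mkv h) y; rewrite /vert_arrow arr => /(_ isT).
  case/and3P: arr => _ _; rewrite -!labE c /= => l.
  by rewrite -natrB ?(ltnW l) //; apply: mulint.
have := sv y (mkv h); rewrite /vert_arrow arr orbT => /(_ isT).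
case/and3P: arr => _ _; rewrite -!labE c /= => l.
rewrite -mulrNN !opprB -natrB ?(ltnW l) //; exact: mulint.
Qed.

End Heights.

(** * Paths from a tight tableau to a given one *)

Section Paths.
Variables (K : numFieldType) (n : nat) (t : 'S_n) (b : bool) (L : tableau K n).
Local Notation G := (chain_graph t b).
Local Notation inB := (gt_basis_pred G L).
Local Notation nc := (nc t).
Local Notation tight := (tight t).
Implicit Types (M : tableau K n) (v w x y : vertex n) (s : bool).
Hypothesis n2 : (2 <= n)%N.
Hypothesis rL : realization G L.
Hypothesis col_neq : forall M v w, inB M -> vc v <> vc w -> M v != M w.

(** By [col_neq] a numerator factor can vanish only for the vertical neighbour in the same column,
    and such an equality contradicts the relation between the two, either in [M] or after the
    step. *)
Lemma coef_neq0 s v M : inB M -> inB (step s v M) -> (vrow v < n)%N -> coef s M v != 0.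
Proof.
move=> BM BM' vn; have sM := (inB_real BM).1; have sM' := (inB_real BM').1.
have sg0 : sg K s != 0 by rewrite /sg; case: (s); rewrite ?oppr_eq0 oner_eq0.
rewrite /coef !mulf_eq0 oppr_eq0 invr_eq0 (negPf sg0) /= negb_or; apply/andP; split.
  apply/prodf_neq0 => w /eqP wa; rewrite subr_eq0.
  have [c|/eqP c] := eqVneq (vc v) (vc w); last by apply: col_neq.
  have vw : v != w by apply: row_neq; rewrite wa eq_sym adj_neq.
  have wv : w != v by rewrite eq_sym.
  apply/eqP => E; have F (m : int) : int_ge 0 (m%:~R : K) -> m < 0 -> False.
    by move/int_geP; lia.
  move: wa sM'; rewrite /adj; case: (s) => wa sM'.
    have r : vr w = (vr v).+1 :> nat by move: wa; rewrite !vrowE => -[].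
    case: (vertical_arrow t (esym c) r) => arr.
      have := satisfies_down sM' arr; rewrite step_id step_neq // E opprD addrA subrr sub0r /sg.
      by move/(F (-1)); apply.
    by have := satisfies_up sM arr; rewrite E subrr => /(int_geP K 1 0).
  have r : vr v = (vr w).+1 :> nat by move: wa; rewrite !vrowE /= => <-.
  case: (vertical_arrow t c r) => arr.
    have := satisfies_down sM' arr; rewrite step_id step_neq // E addrAC subrr add0r /sg.
    by move/(F (-1)); apply.
  by have := satisfies_up sM arr; rewrite E subrr => /(int_geP K 1 0).
apply/prodf_neq0 => w /andP[/eqP wr wv]; rewrite subr_eq0; apply: col_neq => // c.
by move: wv; rewrite (@vertex_eq n w v) ?eqxx //; apply: vrow_inj.
Qed.

Lemma nc_step s v M w : nc (step s v M) w = nc M w + (if w == v then sg K s else 0).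
Proof. by rewrite /nc stepE addrAC. Qed.

Lemma tight_step (k : 'I_n) s v M : (vr v < k)%N -> tight k (step s v M) = tight k M.
Proof.
move=> vk; apply/ffunP => w; rewrite !ffunE nc_step; case: eqP => [E|_]; last by rewrite addr0.
have [h|h] := ltnP (vr w) k; last by move: vk; rewrite -E up_id // ltnNge h.
by move: vk; rewrite -E up_vr ?ltnn // ltnW.
Qed.

(** Among the vertices attaining the largest absolute value with a fixed sign, choose one of least
    potential if the sign is positive and of greatest potential if it is negative. Its neighbours on
    the critical side are then strictly less extreme, so it can move by one towards zero. *)
Lemma extremal_vertex (xi : vertex n -> int) : (exists v, xi v != 0) ->
  exists v s, [/\ xi v != 0, s = (0 < xi v),
    forall y, s -> vert_arrow t v y -> xi y < xi v &
    forall x, ~~ s -> vert_arrow t x v -> xi v < xi x].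
Proof.
move=> [v1 v1P].
have pot x y : vert_arrow t x y -> potential t x = (potential t y).+1.
  by case/orP => h; apply: (@potential_arrow n t b) => //; rewrite /chain_graph h ?orbT.
pose v0 := [arg max_(v > v1) `|xi v|%N].
have v0P w : (`|xi w| <= `|xi v0|)%N.
  by rewrite /v0; case: arg_maxnP => // v _; apply.
have v0n : xi v0 != 0 by have := v0P v1; lia.
have [pos|neg] := ltrP 0 (xi v0).
  case: (@arg_minnP _ v0 (fun v => xi v == xi v0) (potential t) (eqxx _)) => v /eqP vE vmin.
  exists v, true; split; rewrite ?vE // => y _ arr.
  have := v0P y; have [yE|ny] := eqVneq (xi y) (xi v0); last by lia.
  by have := vmin y; rewrite yE eqxx (pot _ _ arr) ltnn => /(_ isT).
case: (@arg_maxnP _ v0 (fun v => xi v == xi v0) (potential t) (eqxx _)) => v /eqP vE vmax.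
exists v, false; split; rewrite ?vE //; first by lia.
move=> x _ arr; have := v0P x; have [xE|nx] := eqVneq (xi x) (xi v0); last by lia.
by have := vmax x; rewrite xE eqxx (pot _ _ arr) => /(_ isT) /=; lia.
Qed.

(** Induction on the total deviation of the normalized entries from the tight tableau: the extremal
    vertex moves one unit back, all relations persist, and the reverse step has a nonzero
    coefficient. *)
Lemma path_ind (k : 'I_n) (Q : tableau K n -> Prop) :
  (forall M, inB M -> M = tight k M -> Q M) ->
  (forall M v s, inB M -> inB (step s v M) -> (vr v < k)%N -> coef s M v != 0 ->
     Q M -> Q (step s v M)) ->
  forall M, inB M -> Q M.
Proof.
move=> Q0 Qs M BM.
have [xi xiP] : exists xi : vertex n -> int, forall v, nc M v - nc M (up k v) = (xi v)%:~R.
  suff h v : exists z : int, nc M v - nc M (up k v) = z%:~R by have [f fP] := choice h; exists f.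
  have sM := (inB_real BM).1.
  have -> : nc M v - nc M (up k v) = (M v - M (up k v)) + ((rk t v)%:R - (rk t (up k v))%:R).
    by rewrite /nc; ring.
  apply: is_intD; first by apply: (col_int sM); rewrite up_vc.
  by apply: is_intB; [exists (rk t v) | exists (rk t (up k v))]; rewrite pmulrn.
move: {2}(\sum_v `|xi v|)%N (erefl (\sum_v `|xi v|)%N) => m.
elim: m M BM xi xiP => [|m IH] M BM xi xiP sm.
  apply: Q0 => //; apply/ffunP => v; rewrite ffunE.
  have : `|xi v|%N == 0%N by move/eqP: sm; rewrite sum_nat_eq0 => /forallP /(_ v).
  rewrite absz_eq0 => /eqP z0; have := xiP v; rewrite z0 => /eqP.
  by rewrite subr_eq0 => /eqP <-; rewrite /nc addrK.
have [|v [s [vn sE hs hns]]] := @extremal_vertex xi.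
  apply: contrapT => nex; move: sm; rewrite big1 // => v _.
  by apply/eqP; rewrite absz_eq0; apply: contraT => h; case: nex; exists v.
have vk : (vr v < k)%N.
  by rewrite ltnNge; apply: contra vn => h; have := xiP v; rewrite up_id // subrr => /esym/eqP;
     rewrite intr_eq0.
pose M0 := step (~~ s) v M; have ME : M = step s v M0 by rewrite /M0 -{1}[s]negbK step_opp.
have vtop : vrow v <> n by have := ltn_ord k; rewrite vrowE; lia.
have BM0 : inB M0.
  have /(inB_char rL)[/satisfies_nc[sv st] top] := BM.
  apply/(inB_char rL); split; last first.
    by move=> x xn; rewrite step_neq ?top //; apply: contra_not_neq vtop => <-.
  apply/satisfies_nc; split=> [x y arr|x y arr]; last first.
    case/and5P: (arr) => _ /eqP xn /eqP yn _ _.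
    rewrite !step_neq; [exact: st | |];
      by apply: contra_not_neq vtop => <-.
  have [c r] : vc x = vc y /\ ((vr x == (vr y).+1 :> nat) || (vr y == (vr x).+1 :> nat)).
    by case/orP: arr => /and3P[/eqP -> -> _]; rewrite ?orbT.
  have [g g0 gE] := sv _ _ arr.
  have xy : x != y by apply: row_neq; rewrite !vrowE; lia.
  have xiE : (vr x <= k)%N -> (vr y <= k)%N -> g = xi x - xi y.
    move=> xk yk; apply: (@intr_inj K); rewrite rmorphB /= -!xiP -gE (up_eq c xk yk).
    by ring.
  rewrite !nc_step; have [xv|xv] := eqVneq x v.
    subst x; rewrite eq_sym (negPf xy) addr0 addrAC gE sg_int -rmorphD /=; apply/int_geP.
    case: s sE hs hns {M0 ME} => //= sE hs hns; last by lia.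
    by have := hs y isT arr; have := xiE; lia.
  have [yv|yv] := eqVneq y v; last by rewrite !addr0 gE; exists g.
  subst y; rewrite addr0 opprD addrA gE sg_int -rmorphB /=; apply/int_geP.
  case: s sE hs hns {M0 ME} => //= sE hs hns; first by lia.
  by have := hns x isT arr; have := xiE; lia.
rewrite ME; apply: Qs => //; first by rewrite -ME.
  by apply: coef_neq0; rewrite -?ME // vrowE; have := ltn_ord k; lia.
pose xi' w := xi w + (if w == v then (if ~~ s then 1 else -1) else 0).
apply: (IH M0 BM0 xi').
  move=> w; rewrite !nc_step.
  have -> : (up k w == v) = false.
    apply/negP => /eqP E; have [h|h] := ltnP (vr w) k; last first.
      by move: vk; rewrite -E up_id // ltnNge h.
    by move: vk; rewrite -E up_vr ?ltnn // ltnW.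
  rewrite addr0 addrAC xiP /xi' rmorphD /=; congr (_ + _).
  by case: eqP => // _; rewrite sg_int.
move: sm; rewrite (bigD1 v) //= [X in _ -> X = _](bigD1 v) //=.
have -> : (\sum_(i | i != v) `|xi' i| = \sum_(i | i != v) `|xi i|)%N.
  by apply: eq_bigr => w /negPf wv; rewrite /xi' wv addr0.
rewrite /xi' eqxx sE; case: ltrP => /=; lia.
Qed.

End Paths.

Lemma ord_sum_le (W : nmodType) (n k : nat) (F : nat -> W) : (k < n)%N ->
  \sum_(a < n | (a <= k)%N) F a = \sum_(0 <= a < k.+1) F a.
Proof. by move=> hk; rewrite big_mkord (big_ord_widen n F hk). Qed.

(** * Casimir separation and cyclicity *)

Section CyclicModule.
Variables (K : numFieldType) (n : nat) (t : 'S_n) (b : bool) (L : tableau K n).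
Local Notation G := (chain_graph t b).
Local Notation inB := (gt_basis_pred G L).
Local Notation nc := (nc t).
Local Notation nentry := (nentry t).
Local Notation tight := (tight t).
Local Notation lab := (lab t).
Local Notation wt := (wt t).
Implicit Types (M : tableau K n) (v w x y : vertex n) (s : bool) (i j a c k : 'I_n).
Hypothesis n2 : (2 <= n)%N.
Hypothesis rL : realization G L.
Hypothesis col_neq : forall M v w, inB M -> vc v <> vc w -> M v != M w.

Variables (V : lmodType K) (gv : tableau K n -> V) (act : 'M[K]_n -> V -> V).
Hypothesis actP : is_gl_action act.
Local Notation E := (glE actP).
Hypothesis gv_out : forall M, ~~ inB M -> gv M = 0.
Hypothesis gv_span : forall z : V, exists (r : seq (tableau K n)) (d : tableau K n -> K),
  all inB r /\ z = \sum_(M <- r) d M *: gv M.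
Variable Dg : (tableau K n -> K) -> endo V.
Hypothesis DgE : forall g M, inB M -> Dg g (gv M) = g M *: gv M.
Hypothesis raiseE : forall i j M, j = i.+1 :> nat -> inB M ->
  E i j (gv M) = \sum_(v | vrow v == i.+1) coef true M v *: gv (step true v M).
Hypothesis lowerE : forall i j M, j = i.+1 :> nat -> inB M ->
  E j i (gv M) = \sum_(v | vrow v == i.+1) coef false M v *: gv (step false v M).
Hypothesis cartanE : forall i M, inB M -> E i i (gv M) = hval i M *: gv M.

Lemma endo_Z (f : endo V) d z : f (d *: z) = d *: f z.
Proof. by have := endo_lin f d z 0; rewrite endo_0 !addr0. Qed.

Lemma gv_ext (f g : endo V) : (forall M, inB M -> f (gv M) = g (gv M)) -> f = g.
Proof.
move=> fg; apply: endoP => z; have [r [d [/allP Br ->]]] := gv_span z.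
by rewrite !endo_lin_sum big_seq [RHS]big_seq; apply: eq_bigr => M /Br BM; rewrite fg.
Qed.

Lemma Dg_mul g g' : Dg g * Dg g' = Dg (fun M => g M * g' M).
Proof.
apply: gv_ext => M BM; rewrite -[LHS]/(Dg g (Dg g' (gv M))) !DgE // endo_Z DgE //.
by rewrite scalerA mulrC.
Qed.

Lemma Dg_comm g g' : br (Dg g) (Dg g') = 0.
Proof.
rewrite /br !Dg_mul; apply/eqP; rewrite subr_eq0; apply/eqP; apply: gv_ext => M BM.
by rewrite !DgE // mulrC.
Qed.

Lemma cartan_Dg i : E i i = Dg (hval i).
Proof. by apply: gv_ext => M BM; rewrite cartanE // DgE. Qed.

(** The generators of $\mathfrak{gl}_{k+1}$ move only rows of index below [k], where [g] is blind;
    brackets extend the commutation to all its units. *)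
Lemma Dg_comm_row k g a c : (a <= k)%N -> (c <= k)%N ->
  (forall s v M, (vr v < k)%N -> g (step s v M) = g M) -> br (Dg g) (E a c) = 0.
Proof.
move=> ak ck gP; apply: (@glE_ind _ _ _ _ actP k (fun f => br (Dg g) f = 0)) => //.
- by move=> f f'; apply: br_comm0.
- move=> i j ij jk.
  have op (f : endo V) s : (forall M, inB M ->
      f (gv M) = \sum_(v | vrow v == i.+1) coef s M v *: gv (step s v M)) -> br (Dg g) f = 0.
    move=> fE; apply: gv_ext => M BM; rewrite endo_brE DgE // endo_Z fE // endo_lin_sum scaler_sumr.
    rewrite -[RHS]/(0 : V) -sumrB big1 // => v /eqP vr.
    have [B'|/gv_out ->] := boolP (inB (step s v M)); last by rewrite endo_0 !scaler0 subrr.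
    rewrite DgE // !scalerA gP ?[g M * _]mulrC ?subrr //.
    by move: vr; rewrite vrowE => -[->]; rewrite -ij.
  by split; [apply: (op _ true) => M; apply: raiseE | apply: (op _ false) => M; apply: lowerE].
- by move=> i ik; rewrite cartan_Dg; apply: Dg_comm.
Qed.

(** With indicator functions, [Dg] supplies the coordinate projections, finitely many of which
    recover a given vector. *)
Lemma gv_sep z : (forall M, inB M -> Dg (fun M' => (M' == M)%:R) z = 0) -> z = 0.
Proof.
move=> h; have [r [d [/allP Br zE]]] := gv_span z.
have E1 : z = Dg (fun M' => (M' \in r)%:R) z.
  rewrite {2}zE endo_lin_sum [LHS]zE big_seq [RHS]big_seq; apply: eq_bigr => M Mr.
  by rewrite DgE ?Br // Mr scale1r.
have E2 : Dg (fun M' => (M' \in r)%:R) = \sum_(M <- undup r) Dg (fun M' => (M' == M)%:R).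
  apply: gv_ext => M' BM'.
  have sumE (u : seq (tableau K n)) z' :
      (\sum_(M <- u) Dg (fun M' => (M' == M)%:R)) z' = \sum_(M <- u) Dg (fun M' => (M' == M)%:R) z'.
    by elim: u => [|M u IH]; rewrite ?big_nil // !big_cons -IH.
  rewrite sumE DgE //; under eq_bigr do rewrite DgE //.
  rewrite -scaler_suml; congr (_ *: _).
  have [Mr|Mr] := boolP (M' \in r).
    rewrite (big_rem M') ?mem_undup //= eqxx big_seq big1 ?addr0 // => M.
    rewrite mem_rem_uniq ?undup_uniq // !inE => /andP[MM' _].
    by rewrite eq_sym (negPf MM').
  rewrite big_seq big1 // => M; rewrite mem_undup => Mr'.
  by case: eqP => // MM'; rewrite MM' Mr' in Mr.
rewrite E1 E2.
have sumE (u : seq (tableau K n)) z' :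
    (\sum_(M <- u) Dg (fun M' => (M' == M)%:R)) z' = \sum_(M <- u) Dg (fun M' => (M' == M)%:R) z'.
  by elim: u => [|M u IH]; rewrite ?big_nil // !big_cons -IH.
by rewrite sumE big_seq big1 // => M; rewrite mem_undup => /Br /h.
Qed.

Fact scal_lin (d : K) (e : K) (u v : V) : d *: (e *: u + v) = e *: (d *: u) + d *: v.
Proof. by rewrite scalerDr !scalerA mulrC. Qed.

Definition scal (d : K) : endo V := Endo (scal_lin d).

Lemma scal_comm d f : scal d * f = f * scal d.
Proof. by apply: endoP => z; rewrite -[RHS]/(f (d *: z)) endo_Z. Qed.

Lemma br_scal d f g : br (scal d * f) g = scal d * br f g.
Proof. by rewrite /br mulrBr !mulrA -(scal_comm d g). Qed.

Lemma wt_Dg k : Dg (wt k) = \sum_(i : 'I_n | (i <= k)%N) scal (lab i)%:R * E i i.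
Proof.
apply: gv_ext => M BM; rewrite DgE //.
have sumE (I : finType) (P : pred I) (F : I -> endo V) z :
    (\sum_(i | P i) F i) z = \sum_(i | P i) F i z.
  by elim/big_rec2: _ => [|i u f _ <-].
rewrite sumE /wt -(@ord_sum_le _ n k (fun m : nat => (lab m)%:R * hval m M) (ltn_ord k)) scaler_suml.
by apply: eq_bigr => i _; rewrite -scalerA -cartanE.
Qed.

Lemma wt_glE k a c z : (a <= k)%N -> (c <= k)%N ->
  Dg (wt k) (E a c z) = E a c (Dg (wt k) z) + ((lab a)%:R - (lab c)%:R) *: E a c z.
Proof.
move=> ak ck; have key : br (Dg (wt k)) (E a c) = (scal (lab a)%:R - scal (lab c)%:R) * E a c.
  have pick (i0 : 'I_n) : (i0 <= k)%N ->
      \sum_(i : 'I_n | (i <= k)%N) (scal (lab i)%:R * E a c) *+ (i == i0) = scal (lab i0)%:R * E a c.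
    move=> ik; rewrite (bigD1 i0) //= eqxx mulr1n big1 ?addr0 // => i /andP[_ ii].
    by rewrite (negPf ii).
  rewrite wt_Dg br_opp br_sumr -sumrN mulrBl -(pick a) // -(pick c) // -sumrB.
  apply: eq_bigr => i _; rewrite -br_opp br_scal glE_br mulrBr !mulrnAr (eq_sym c).
  by congr (_ - _); case: eqP => // ->.
have : Dg (wt k) (E a c z) - E a c (Dg (wt k) z) =
    (lab a)%:R *: E a c z - (lab c)%:R *: E a c z.
  by rewrite -endo_brE key.
by rewrite -scalerBl => <-; rewrite addrC subrK.
Qed.

Lemma tightK k M : tight k (tight k M) = tight k M.
Proof.
apply/ffunP => v; rewrite ffunE nc_tight [RHS]ffunE; congr (nc M _ - _).
have [h|h] := ltnP (vr v) k; first by rewrite [LHS]up_id // up_vr // ltnW.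
by rewrite !up_id.
Qed.

(* The raised vector would have a negative height. *)
Lemma singular k M a c : inB M -> (a <= k)%N -> (c <= k)%N -> (t a < t c)%N ->
  E a c (gv (tight k M)) = 0.
Proof.
move=> BM ak ck tac; set M0 := tight k M; have B0 : inB M0 by apply: inB_tight.
set z := E a c (gv M0); apply: gv_sep => M1 B1; set pz := Dg _ z.
(* Since [E a c] changes only rows of index below [k], the result involves only tableaux that agree
   with [M0] from row [k] upwards; for these, comparing weights amounts to comparing heights. *)
pose chi (M' : tableau K n) : K := [forall v : vertex n, (k <= vr v)%N ==> (M' v == M0 v)]%:R.
have chiz : Dg chi z = z.
  have : br (Dg chi) (E a c) = 0.
    apply: (@Dg_comm_row k) => // s v M' vk; rewrite /chi; congr (_%:R); congr nat_of_bool.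
    apply: eq_forallb => w; case: leqP => //= kw; rewrite step_neq //.
    by apply: contraTneq kw => ->; rewrite -ltnNge.
  move=> comm; have : Dg chi z - E a c (Dg chi (gv M0)) = 0 by rewrite -endo_brE comm.
  rewrite DgE // (_ : chi M0 = 1) ?scale1r => [/eqP|]; first by rewrite subr_eq0 => /eqP.
  by rewrite /chi; case: forallP => // -[] v; rewrite eqxx implybT.
have pchi : pz = chi M1 *: pz.
  rewrite {1}/pz -chiz -[LHS]/((Dg _ * Dg chi) z) Dg_mul.
  have -> : Dg (fun M' => (M' == M1)%:R * chi M') = scal (chi M1) * Dg (fun M' => (M' == M1)%:R).
    apply: gv_ext => M' B'; rewrite DgE // -[RHS]/(chi M1 *: Dg _ (gv M')) DgE // scalerA.
    by case: eqP => [->|]; rewrite ?mul0r ?mulr0 // mulr1 mul1r.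
  by [].
have pwt : wt k M1 *: pz = (wt k M0 + ((lab a)%:R - (lab c)%:R)) *: pz.
  have : Dg (fun M' => (M' == M1)%:R) (Dg (wt k) z) = wt k M1 *: pz.
    rewrite -[LHS]/((Dg _ * Dg (wt k)) z) Dg_mul.
    have -> : Dg (fun M' => (M' == M1)%:R * wt k M') =
        scal (wt k M1) * Dg (fun M' => (M' == M1)%:R).
      apply: gv_ext => M' B'; rewrite DgE // -[RHS]/(wt k M1 *: Dg _ (gv M')) DgE // scalerA.
      by case: eqP => [->|]; rewrite ?mul0r ?mulr0 // mulr1 mul1r.
    by [].
  by move=> <-; rewrite wt_glE // DgE // !endo_Z -scalerDl endo_Z.
have [c1|c1] := boolP [forall v : vertex n, (k <= vr v)%N ==> (M1 v == M0 v)]; last first.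
  by rewrite pchi /chi (negPf c1) scale0r.
have tE : tight k M1 = M0.
  rewrite -[RHS]tightK; apply/ffunP => v; rewrite !ffunE /nc.
  have upk : (k <= vr (up k v))%N.
    by have [h|h] := ltnP (vr v) k; [rewrite up_vr // ltnW | rewrite up_id].
  by have /implyP /(_ upk) /eqP -> := forallP c1 (up k v).
have hE : wt k M1 = wt k M0 + height t k M1.
  rewrite !wtE // -tE height_tight addr0; congr (_ + _); apply: eq_big_nat => j /andP[_ jk].
  by rewrite nentry_tight.
have [m m0 mE] := height_ge0 (inB_real B1).1 (ltn_ord k).
move/eqP: pwt; rewrite hE -subr_eq0 -scalerBl opprD addrACA subrr add0r scaler_eq0.
case/orP => [|/eqP //]; rewrite mE opprB.
rewrite !labE -natrB ?(ltnW tac) // pmulrn -rmorphD intr_eq0; lia.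
Qed.

(** The Casimir eigenvalue in normalized entries: the linear term collects the commutators
    [E a a - E c c] over the pairs with [t a < t c]. It depends only on the row of index [k]. *)
Definition casval k M : K :=
  \sum_(v : vertex n | vrow v == k.+1) (nc M v ^+ 2 + nc M v * (k%:R - 2 * (rk t v)%:R)).

(** The increment is affine in [M v] with slope $\pm2$, so neighbours obtained by moving distinct
    entries of a row have distinct eigenvalues. *)
Lemma casval_step s v k M : vr v = k ->
  casval k (step s v M) = casval k M + (2 * sg K s * M v + (1 + sg K s * k%:R)).
Proof.
move=> vk; rewrite /casval (bigD1 v) ?vrowE ?vk //= [X in _ = X + _](bigD1 v) ?vrowE ?vk //=.
have -> : \sum_(w : vertex n | (vrow w == k.+1) && (w != v))
    (nc (step s v M) w ^+ 2 + nc (step s v M) w * (k%:R - 2 * (rk t w)%:R)) =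
  \sum_(w : vertex n | (vrow w == k.+1) && (w != v))
    (nc M w ^+ 2 + nc M w * (k%:R - 2 * (rk t w)%:R)).
  by apply: eq_bigr => w /andP[_ /negPf wv]; rewrite !nc_step wv addr0.
rewrite nc_step eqxx /nc; have : sg K s ^+ 2 = 1 by case: (s); rewrite /sg ?sqrrN expr1n.
move: (sg K s) => e e2; apply/eqP; rewrite -subr_eq0; apply/eqP.
by transitivity (e ^+ 2 - 1); [ring | rewrite e2 subrr].
Qed.

Lemma casval_row k M M' : (forall v, vr v = k -> nc M v = nc M' v) -> casval k M = casval k M'.
Proof.
move=> h; apply: eq_bigr => v /eqP [vk]; rewrite h //; exact: val_inj.
Qed.

Lemma sum_pairs (m : nat) (eta : nat -> K) : (m <= n)%N ->
  \sum_(0 <= a0 < m) \sum_(0 <= c0 < m) (if a0 == c0 then eta a0 ^+ 2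
     else if (lab a0 < lab c0)%N then eta a0 - eta c0 else 0) =
  \sum_(0 <= a0 < m) (eta a0 ^+ 2 + eta a0 * (m%:R - 1 -
     2 * (\sum_(0 <= c0 < m) (lab c0 < lab a0))%:R)).
Proof.
move=> mn.
transitivity (\sum_(0 <= a0 < m) (\sum_(0 <= c0 < m) (eta a0 ^+ 2 *+ (a0 == c0)) +
   \sum_(0 <= c0 < m) (eta a0 *+ (lab a0 < lab c0)%N)) -
   \sum_(0 <= a0 < m) \sum_(0 <= c0 < m) eta c0 *+ (lab a0 < lab c0)%N).
  rewrite -sumrB; apply: eq_big_nat => a0 _; rewrite -big_split -sumrB /=.
  apply: eq_big_nat => c0 _; case: eqP => [->|_]; first by rewrite ltnn !mulr0n subr0 addr0 mulr1n.
  by rewrite mulr0n add0r; case: ifP; rewrite ?mulr1n // !mulr0n subr0.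
rewrite [X in _ - X]exchange_big /= -sumrB; apply: eq_big_nat => a0 /andP[_ am].
have -> : \sum_(0 <= c0 < m) eta a0 ^+ 2 *+ (a0 == c0) = eta a0 ^+ 2.
  rewrite big_mkord (bigD1 (Ordinal am)) //= eqxx mulr1n big1 ?addr0 // => c0 c0a.
  by case: eqP => // E; case/eqP: c0a; apply: val_inj.
rewrite -addrA; congr (_ + _).
have cnt : (\sum_(0 <= c0 < m) (lab a0 < lab c0) + \sum_(0 <= c0 < m) (lab c0 < lab a0) + 1 = m)%N.
  have one : (\sum_(0 <= c0 < m) (a0 == c0) = 1)%N.
    rewrite big_mkord (bigD1 (Ordinal am)) //= eqxx big1 // => c0 c0a.
    by case: eqP => // E; case/eqP: c0a; apply: val_inj.
  rewrite -{1}one -!big_split /= -[RHS]subn0 -[RHS]muln1 -sum_nat_const_nat.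
  apply: eq_big_nat => c0 /andP[_ cm]; case: ltngtP => //=.
  - by case: eqP => // ->; rewrite ltnn.
  - by case: eqP => // ->; rewrite ltnn.
  - by move=> /lab_inj -> //; [rewrite eqxx | apply: leq_trans mn | apply: leq_trans mn].
rewrite -[in m%:R]cnt !natrD !natr_sum !mulr_sumr.
have tonat (F : nat -> bool) : \sum_(0 <= c0 < m) eta a0 *+ F c0 = eta a0 * \sum_(0 <= c0 < m) (F c0)%:R.
  by rewrite mulr_sumr; apply: eq_bigr => c0 _; rewrite mulr_natr.
rewrite !tonat -?mulr_sumr; ring.
Qed.

(** For each pair of distinct indices one of the two opposite units kills the tight vector, so every
    product in the Casimir acts as zero or as a commutator of Cartan type. *)
Lemma casimir_tight k M : inB M ->
  casimir actP k (gv (tight k M)) = casval k M *: gv (tight k M).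
Proof.
move=> BM; set M0 := tight k M; have B0 : inB M0 by apply: inB_tight.
pose eta (m : nat) := nentry M k m.
pose val (a0 c0 : nat) := if a0 == c0 then eta a0 ^+ 2
     else if (lab a0 < lab c0)%N then eta a0 - eta c0 else 0.
have cE a : (a <= k)%N -> E a a (gv M0) = eta a *: gv M0.
  by move=> ak; rewrite cartanE // hval_tight.
have pairE a c : (a <= k)%N -> (c <= k)%N -> (E a c * E c a) (gv M0) = val a c *: gv M0.
  move=> ak ck; rewrite -[LHS]/(E a c (E c a (gv M0))) /val !labE.
  case: eqP => [/val_inj <-|ac]; first by rewrite !cE // endo_Z cE // scalerA.
  case: ltnP => tac; last first.
    rewrite singular // ?endo_0 ?scale0r // ltn_neqAle tac andbT.
    by apply: contra_not_neq ac => /val_inj/perm_inj ->.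
  have : E a c (E c a (gv M0)) - E c a (E a c (gv M0)) = E a a (gv M0) - E c c (gv M0).
    by rewrite -endo_brE glE_br !eqxx !mulr1n.
  by rewrite (singular BM ak ck tac) endo_0 subr0 !cE // scalerBl.
have sumE (I : finType) (P : pred I) (F : I -> endo V) z :
    (\sum_(i | P i) F i) z = \sum_(i | P i) F i z.
  by elim/big_rec2: _ => [|i u f _ <-].
rewrite /casimir sumE.
transitivity (\sum_(a < n | (a <= k)%N) \sum_(c < n | (c <= k)%N) val a c *: gv M0).
  apply: eq_bigr => a ak; rewrite sumE; apply: eq_bigr => c ck; exact: pairE.
under eq_bigr do rewrite -scaler_suml.
rewrite -scaler_suml; congr (_ *: _).
under eq_bigr => a _ do rewrite (@ord_sum_le _ n k (val a) (ltn_ord k)).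
rewrite (@ord_sum_le _ n k (fun m => \sum_(0 <= c0 < k.+1) val m c0) (ltn_ord k)) sum_pairs //.
rewrite /casval -(@row_sum K n k _ (ltn_ord k)); apply: eq_bigr => v /eqP [vk].
by rewrite /eta (@nentry_nc _ _ _ M v) // /rk vk -natr1 addrK.
Qed.

(** Submodules appear as predicates, so this is generation by the tight vector and an induction
    principle at once; [casimirE] uses it in the second way. *)
Definition cyclic_at k := forall P : V -> Prop, P 0 ->
  (forall d u z, P u -> P z -> P (d *: u + z)) ->
  (forall a c z, (a <= k)%N -> (c <= k)%N -> P z -> P (E a c z)) ->
  forall M, inB M -> P (gv (tight k M)) -> P (gv M).

(** Both the Casimir and [Dg (casval k)] commute with $\mathfrak{gl}_{k+1}$, so their agreement
    spreads from the tight vector to everything it generates. *)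
Lemma casimirE k : cyclic_at k -> forall M, inB M -> casimir actP k (gv M) = casval k M *: gv M.
Proof.
move=> cyc M BM; rewrite -DgE //.
apply: (cyc (fun z => casimir actP k z = Dg (casval k) z)) => //.
- by rewrite !endo_0.
- by move=> d u z hu hz; rewrite !endo_lin hu hz.
- move=> a c z ak ck hz.
  have c1 : br (E a c) (casimir actP k) = 0 by apply: casimir_comm.
  have c2 : br (Dg (casval k)) (E a c) = 0.
    apply: (@Dg_comm_row k) => // s v M' vk; apply: casval_row => w wk; rewrite nc_step.
    by case: eqP => [wv|_]; rewrite ?addr0 //; move: vk; rewrite -wv wk ltnn.
  have e1 : casimir actP k (E a c z) = E a c (casimir actP k z).
    by apply/eqP; rewrite eq_sym -subr_eq0 -endo_brE c1.
  have e2 : Dg (casval k) (E a c z) = E a c (Dg (casval k) z).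
    by apply/eqP; rewrite -subr_eq0 -endo_brE c2.
  by rewrite e1 e2 hz.
- rewrite casimir_tight // DgE; last by apply: inB_tight.
  congr (_ *: _); apply: casval_row => v vk.
  by rewrite nc_tight up_id // vk.
Qed.

(** Along [path_ind], a generator of $\mathfrak{gl}_{k+1}$ yields the wanted neighbour mixed with
    others moved in the same row. The Casimir of the smaller algebra attached to that row is
    diagonal by induction and isolates it, with a nonzero coefficient. *)
Lemma cyclic_all k : cyclic_at k.
Proof.
move: {2}(k : nat) (leqnn k) => m; elim: m k => [|m IH] k km P P0 PZ PE.
  move=> M BM; suff -> : tight k M = M by [].
  apply/ffunP => v; rewrite tight_row //; lia.
have key : forall M, inB M -> P (gv (tight k M)) -> P (gv M).
  apply: (path_ind n2 rL col_neq (k := k)); first by move=> M BM <-.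
  move=> M v s BM BM' vk c0 QM; rewrite tight_step // => /QM PM.
  have kn : ((vr v).+1 < n)%N by apply: leq_ltn_trans vk _.
  pose g := if s then E (vr v) (Ordinal kn) else E (Ordinal kn) (vr v).
  have gE : g (gv M) = \sum_(w | vrow w == (vr v).+1) coef s M w *: gv (step s w M).
    by rewrite /g; case: (s); [apply: raiseE | apply: lowerE].
  have Pg : P (\sum_(w | vrow w == (vr v).+1) coef s M w *: gv (step s w M)).
    rewrite -gE /g; case: (s); apply: PE => //=; exact: ltnW.
  have cas : forall M, inB M -> casimir actP (vr v) (gv M) = casval (vr v) M *: gv M.
    by apply: casimirE; apply: IH; lia.
  pose x w := casval (vr v) M + (2 * sg K s * M w + (1 + sg K s * (vr v)%:R)).
  have := @eigen_separation K V P (casimir actP (vr v)) P0 PZ _ (vertex n)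
    (fun w => vrow w == (vr v).+1) (fun w => coef s M w *: gv (step s w M)) x _ _ Pg v.
  rewrite vrowE eqxx => sep; have {}sep : P (coef s M v *: gv (step s v M)).
    apply: sep => //.
    + move=> u Pu; rewrite /casimir.
      have sumE (I : finType) (Q : pred I) (F : I -> endo V) z :
          (\sum_(i | Q i) F i) z = \sum_(i | Q i) F i z.
        by elim/big_rec2: _ => [|i u' f _ <-].
      have PD u1 u2 : P u1 -> P u2 -> P (u1 + u2) by rewrite -{2}[u1]scale1r; apply: PZ.
      rewrite sumE; elim/big_ind: _ => // a av; rewrite sumE; elim/big_ind: _ => // c cv.
      by apply: (PE a c (E c a u)); rewrite ?(leq_trans _ (ltnW vk)) //; apply: PE => //;
        apply: leq_trans (ltnW vk).
    + move=> w /eqP [wr]; rewrite endo_Z.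
      have [B'|/gv_out ->] := boolP (inB (step s w M)); last by rewrite endo_0 !scaler0.
      rewrite cas // casval_step; last exact: val_inj.
      by rewrite !scalerA mulrC.
    + move=> w w' /eqP [wr] /eqP [wr'] ww'; rewrite /x (inj_eq (addrI _)) (inj_eq (addIr _)).
      rewrite -!mulrA !(inj_eq (mulfI _)) ?pnatr_eq0 //; last first.
        by rewrite /sg; case: (s); rewrite ?oppr_eq0 oner_eq0.
      apply: col_neq => // cc; case/eqP: ww'; apply: vertex_eq => //; apply: val_inj.
      by rewrite /= wr wr'.
  have := PZ (coef s M v)^-1 _ _ sep P0.
  by rewrite addr0 scalerA mulVf // scale1r.
exact: key.
Qed.

End CyclicModule.

(** * Ordered monomials and the Verma module *)

Section HighestWeight.
Variables (K : numFieldType) (n : nat) (V : lmodType K) (act : 'M[K]_n -> V -> V).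
Hypothesis actP : is_gl_action act.
Local Notation E := (glE actP).
Local Notation letter := ('I_n * 'I_n)%type.
Implicit Types (p q : letter) (i j : 'I_n) (z : V).
Variables (v0 : V) (lam : 'I_n -> K).
Hypothesis v0_raise : forall i j, (i < j)%N -> E i j v0 = 0.
Hypothesis v0_cartan : forall i, E i i v0 = lam i *: v0.

Definition neg p := (p.2 < p.1)%N.

(** The filtration by the number of lowering operators; admitting [v0] at every level makes it
    increasing. *)
Inductive words : nat -> V -> Prop :=
| words_base r : words r v0
| words_zero r : words r 0
| words_lin r d u z : words r u -> words r z -> words r (d *: u + z)
| words_cons r p z : neg p -> words r z -> words r.+1 (E p.1 p.2 z).

Lemma words_mono r z : words r z -> words r.+1 z.
Proof.
elim=> [r'|r'|r' d u z' _ hu _ hz|r' p z' np _ hz].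
- exact: words_base.
- exact: words_zero.
- exact: words_lin.
- exact: words_cons.
Qed.

Lemma words_le r r' z : (r <= r')%N -> words r z -> words r' z.
Proof. by move=> /subnK <- hz; elim: (r' - r)%N => //= m; apply: words_mono. Qed.

Lemma words_add r u z : words r u -> words r z -> words r (u + z).
Proof. by rewrite -{2}[u]scale1r; apply: words_lin. Qed.

Lemma words_sub r u z : words r u -> words r z -> words r (u - z).
Proof. by move=> hu hz; rewrite addrC -scaleN1r; apply: words_lin. Qed.

Lemma words_bool r (f : endo V) (d : bool) z : words r (f z) -> words r ((f *+ d : endo V) z).
Proof. by case: d; rewrite ?mulr1n ?mulr0n // => _; apply: words_zero. Qed.

Lemma endo_B (f : endo V) u z : f (u - z) = f u - f z.
Proof. by rewrite addrC -scaleN1r endo_lin scaleN1r addrC. Qed.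

Lemma endo_swap (f g : endo V) z : f (g z) = g (f z) + br f g z.
Proof. by rewrite endo_brE addrC subrK. Qed.

(** A raising or Cartan unit passes a lowering one at the cost of a bracket acting on a shorter
    word, and finally meets [v0]; hence it does not increase the length. *)
Lemma words_act r z : words r z ->
  (forall i j, (i <= j)%N -> words r (E i j z)) /\ (forall i j, words r.+1 (E i j z)).
Proof.
elim=> [r'|r'|r' d u z' _ [hu1 hu2] _ [hz1 hz2]|r' p z' np hz [IH1 IH2]].
- have h i j : (i <= j)%N -> words r' (E i j v0).
    rewrite leq_eqVlt => /orP[/eqP/val_inj <-|ij]; last by rewrite v0_raise //; apply: words_zero.
    by rewrite v0_cartan -[_ *: _]addr0; apply: words_lin; [apply: words_base | apply: words_zero].
  split=> // i j; have [ij|ij] := leqP i j; first by apply/words_mono/h.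
  exact: (@words_cons r' (i, j) v0 ij (words_base r')).
- by split=> i j *; rewrite endo_0; apply: words_zero.
- by split=> i j *; rewrite endo_lin; apply: words_lin; auto.
- have h i j : (i <= j)%N -> words r'.+1 (E i j (E p.1 p.2 z')).
    move=> ij; rewrite endo_swap; apply: words_add; first by apply: words_cons => //; apply: IH1.
    by rewrite glE_br; apply: words_sub; apply: words_bool; apply: IH2.
  split=> // i j; have [ij|ij] := leqP i j; first by apply/words_mono/h.
  apply: (@words_cons _ (i, j)) => //; exact: words_cons.
Qed.

Definition mon (ps : seq letter) (d : letter -> nat) : V :=
  foldr (fun p z => iter (d p) (E p.1 p.2) z) v0 ps.

Lemma mon_cons p ps d : mon (p :: ps) d = iter (d p) (E p.1 p.2) (mon ps d).
Proof. by []. Qed.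

Definition mdeg (ps : seq letter) (d : letter -> nat) : nat := (\sum_(p <- ps) d p)%N.

Definition incr (d : letter -> nat) p q : nat := (d q + (q == p))%N.

Lemma iter_words m r p z : neg p -> words r z -> words (m + r) (iter m (E p.1 p.2) z).
Proof. by move=> np hz; elim: m => // m IH; rewrite iterS addSn; apply: words_cons. Qed.

Lemma mon_words ps d : all neg ps -> words (mdeg ps d) (mon ps d).
Proof.
elim: ps => [|p ps IH]; first by move=> _; apply: words_base.
by move=> /andP[np nps]; rewrite /mdeg big_cons mon_cons; apply: iter_words => //; apply: IH.
Qed.

(** Either product has length [m + r + 1]; the commutator loses one factor, which drives the
    reordering. *)
Lemma iter_comm m r p q z : neg p -> neg q -> words r z ->
  words (m + r) (E p.1 p.2 (iter m (E q.1 q.2) z) - iter m (E q.1 q.2) (E p.1 p.2 z)).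
Proof.
move=> np nq hz; elim: m => [|m IH]; first by rewrite subrr; apply: words_zero.
rewrite !iterS endo_swap addrAC addSn.
have -> : E q.1 q.2 (E p.1 p.2 (iter m (E q.1 q.2) z)) -
    E q.1 q.2 (iter m (E q.1 q.2) (E p.1 p.2 z)) =
  E q.1 q.2 (E p.1 p.2 (iter m (E q.1 q.2) z) - iter m (E q.1 q.2) (E p.1 p.2 z)).
  by rewrite endo_B.
apply: words_add; first exact: words_cons.
have [_ h] := words_act (iter_words m nq hz).
by rewrite glE_br; apply: words_sub; apply: words_bool; apply: h.
Qed.

Lemma eq_mon ps d d' : {in ps, d =1 d'} -> mon ps d = mon ps d'.
Proof.
elim: ps => // p ps IH dd; rewrite !mon_cons IH; first by rewrite dd // mem_head.
by move=> q qs; apply: dd; rewrite inE qs orbT.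
Qed.

Lemma iterB m (f : endo V) u z : iter m f (u - z) = iter m f u - iter m f z.
Proof.
by elim: m => // m IH; rewrite !iterS IH endo_B.
Qed.

Lemma mon_insert ps d p : uniq ps -> all neg ps -> p \in ps ->
  words (mdeg ps d) (E p.1 p.2 (mon ps d) - mon ps (incr d p)).
Proof.
elim: ps => // q ps IH /andP[qps ups] /andP[nq nps]; rewrite inE /mdeg big_cons !mon_cons.
have [-> _|pq /= pps] := eqVneq p q.
  rewrite {1}/incr eqxx addn1 iterS (@eq_mon ps (incr d q) d) ?subrr; first exact: words_zero.
  by move=> p' pp; rewrite /incr; case: eqP => [Ep|_]; rewrite ?addn0 //; rewrite -Ep pp in qps.
rewrite {1}/incr eq_sym (negPf pq) addn0.
have np : neg p by apply: (allP nps).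
rewrite -[X in X - _](subrK (iter (d q) (E q.1 q.2) (E p.1 p.2 (mon ps d)))) -addrA -iterB.
apply: words_add; first by apply: iter_comm => //; apply: mon_words.
by apply: iter_words => //; apply: IH.
Qed.

Inductive monspan (ps : seq letter) (r : nat) : V -> Prop :=
| monspan_zero : monspan ps r 0
| monspan_lin d u z : monspan ps r u -> monspan ps r z -> monspan ps r (d *: u + z)
| monspan_mon d : (mdeg ps d <= r)%N -> monspan ps r (mon ps d).

Lemma monspan_mono ps r r' z : (r <= r')%N -> monspan ps r z -> monspan ps r' z.
Proof.
move=> rr; elim=> [|d u z' _ hu _ hz|d h].
- exact: monspan_zero.
- exact: monspan_lin.
- by apply: monspan_mon; apply: leq_trans rr.
Qed.

(** The spanning half of the Poincaré-Birkhoff-Witt argument: inserting a letter into an ordered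
    monomial leaves a correction of smaller length, covered by the strong induction on [r]. *)
Lemma words_monspan ps r z : uniq ps -> all neg ps -> (forall p, neg p -> p \in ps) ->
  words r z -> monspan ps r z.
Proof.
move=> ups nps allps; move: z; elim/ltn_ind: r => r IH z wz.
elim: wz IH => {r z} [r|r|r d u z _ hu _ hz|r p z np wz _] IH.
- have -> : v0 = mon ps (fun=> 0%N) by rewrite /mon; elim: (ps) => //= p' ps' <-.
  by apply: monspan_mon; rewrite /mdeg big1.
- exact: monspan_zero.
- by apply: monspan_lin; [apply: hu | apply: hz].
have Wr z' : words r z' -> monspan ps r z' by apply: IH.
elim: (Wr _ wz) => [|d u z' _ hu _ hz|d hd].
- by rewrite endo_0; apply: monspan_zero.
- by rewrite endo_lin; apply: monspan_lin.
have pps := allps p np.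
rewrite -[E _ _ _](subrK (mon ps (incr d p))) -[X in X + _]scale1r; apply: monspan_lin.
  apply: (monspan_mono (leqnSn r)); apply: Wr; apply: (words_le hd); exact: mon_insert.
apply: monspan_mon; rewrite /mdeg /incr big_split /= -addn1; apply: leq_add => //.
rewrite (big_rem p) //= eqxx big_seq big1 // => q.
by rewrite mem_rem_uniq // !inE => /andP[/negPf ->].
Qed.

End HighestWeight.

Lemma malgUM (K : numFieldType) (W : monomType) (w w' : W) :
  << w >> * << w' >> = << mmul w w' >> :> {malg K[W]}.
Proof. by rewrite malgM_def fgmulUU mulr1. Qed.

Lemma delta_mx_sum (K : numFieldType) (n : nat) (V : lmodType K) (a c : 'I_n)
    (F : 'I_n -> 'I_n -> V) :
  \sum_i \sum_j (delta_mx a c : 'M[K]_n) i j *: F i j = F a c.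
Proof.
rewrite (bigD1 a) //= (bigD1 c) //= mxE !eqxx scale1r.
rewrite big1 => [|l lj]; last by rewrite mxE (negPf lj) andbF scale0r.
rewrite addr0 big1 ?addr0 // => k ki; rewrite big1 // => l _.
by rewrite mxE (negPf ki) scale0r.
Qed.

Lemma malg_lin_ext (K : numFieldType) (B : choiceType) (V : lmodType K)
    (f g : {malg K[B]} -> V) :
  (forall c x y, f (c *: x + y) = c *: f x + f y) ->
  (forall c x y, g (c *: x + y) = c *: g x + g y) ->
  (forall i, f << i >> = g << i >>) -> forall x, f x = g x.
Proof.
move=> fl gl fg x; have f0 h : (forall c x y, h (c *: x + y) = c *: h x + h y) -> h 0 = 0 :> V.
  move=> hl; have := hl 1 0 0; rewrite scaler0 addr0 scale1r => /eqP.
  by rewrite -subr_eq0 opprD addrA subrr add0r oppr_eq0 => /eqP.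
rewrite [x]malg_sumU; elim: (msupp x : seq B) => [|i s IH]; first by rewrite big_nil !f0.
by rewrite big_cons fl gl IH fg.
Qed.

(* Stated for an abstract ring: with the tensor algebra itself, comparing the
   products below by conversion would be very expensive. *)
Lemma ring_map_lie (K : numFieldType) (n : nat) (V : lmodType K) (act : 'M[K]_n -> V -> V)
    (T : pzRingType) (m : T -> V) (x y : 'M[K]_n) (X Y Z f : T) :
  is_gl_action act -> (forall g g', m (g - g') = m g - m g') ->
  (forall g, m (X * g) = act x (m g)) -> (forall g, m (Y * g) = act y (m g)) ->
  (forall g, m (Z * g) = act (x *m y - y *m x) (m g)) ->
  m ((X * Y - Y * X - Z) * f) = 0.
Proof.
move=> actP mB hX hY hZ.
by rewrite !mulrBl !mB -!mulrA !hX !hY hX hZ (gl_act_bracket actP) subrr.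
Qed.

Lemma ring_map_gen (V T : Type) (R : pzRingType) (act : T -> V -> V) (m : R -> V)
    (x : T) (X : R) z :
  (forall g, m (X * g) = act x (m g)) -> act x (m 1) = z -> m X = z.
Proof. by move=> hX <-; rewrite -hX mulr1. Qed.

(** * The Verma module and its universal property *)

Section VermaModule.
Variables (K : numFieldType) (n : nat) (lam : 'I_n -> K).
Local Notation tensor := {malg K[gl_word n]}.
Local Notation letter := ('I_n * 'I_n)%type.

Lemma gl_injE x : gl_inj x = \sum_i \sum_j x i j *: << (fmu ((i, j) : gl_letter n) : gl_word n) >> :> tensor.
Proof. by apply: eq_bigr => i _; apply: eq_bigr => j _; rewrite malgU_scale. Qed.

Lemma gl_inj_delta (p : letter) :
  gl_inj (delta_mx p.1 p.2) = << (fmu (p : gl_letter n) : gl_word n) >> :> tensor.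
Proof.
by rewrite gl_injE (delta_mx_sum p.1 p.2 (fun i j => << (fmu ((i, j) : gl_letter n) : gl_word n) >>));
   case: p.
Qed.

Definition verma_gen : verma lam := lquot_pi (verma_ideal_subspace lam) 1.

Lemma verma_act_pi x f : gl_act x (lquot_pi (verma_ideal_subspace lam) f : verma lam) =
  lquot_pi (verma_ideal_subspace lam) (gl_inj x * f).
Proof. by apply: left_act_pi => f' g; apply: verma_mul. Qed.

Lemma verma_pi0 : lquot_pi (verma_ideal_subspace lam) 0 = 0 :> verma lam.
Proof. by have := lquot_piB (verma_ideal_subspace lam) 0 0; rewrite !subrr. Qed.

Lemma verma_raise (i j : 'I_n) : (i < j)%N -> glE (gl_actP (verma lam)) i j verma_gen = 0.
Proof.
move=> ij; rewrite -[LHS]/(gl_act (delta_mx i j) verma_gen) verma_act_pi mulr1.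
by rewrite -verma_pi0; apply/lquot_eqP; rewrite subr0; apply: verma_nilp.
Qed.

Lemma verma_weight i : glE (gl_actP (verma lam)) i i verma_gen = lam i *: verma_gen.
Proof.
rewrite -[LHS]/(gl_act (delta_mx i i) verma_gen) verma_act_pi mulr1.
rewrite -[RHS]addr0 -verma_pi0 -lquot_pi_linear addr0.
by apply/lquot_eqP; apply: verma_cartan.
Qed.

Lemma verma_words z : exists r, words (gl_actP (verma lam)) verma_gen r z.
Proof.
have [f ->] := lquot_surj z.
have wordP (s : seq letter) : exists r,
    words (gl_actP (verma lam)) verma_gen r (lquot_pi (verma_ideal_subspace lam) << (FMonom s : gl_word n) >>).
  elim: s => [|p s [r IH]].
    exists 0%N; have -> : (FMonom [::] : gl_word n) = mone by rewrite -fmoneE.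
    exact: words_base.
  exists r.+1; have -> : (FMonom (p :: s) : gl_word n) = mmul (fmu p) (FMonom s).
    by rewrite -[RHS]/(fmmul _ _) fmmulE fmuE.
  rewrite -malgUM -gl_inj_delta -verma_act_pi.
  have [_ h] := words_act verma_raise verma_weight IH.
  exact: h.
rewrite [f]malg_sumU; elim: (msupp f : seq _) => [|w ws [r IH]].
  exists 0%N; rewrite big_nil.
  rewrite verma_pi0; exact: words_zero.
have [r' hw] := wordP w; rewrite fmK in hw.
exists (maxn r r'); rewrite big_cons lquot_pi_linear; apply: words_lin.
  exact: (words_le (leq_maxr _ _) hw).
exact: (words_le (leq_maxl _ _) IH).
Qed.

Section Universal.
Variables (V : lmodType K) (act : 'M[K]_n -> V -> V) (v0 : V).
Hypothesis actP : is_gl_action act.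
Hypothesis v0_raise : forall i j : 'I_n, (i < j)%N -> act (delta_mx i j) v0 = 0.
Hypothesis v0_cartan : forall i : 'I_n, act (delta_mx i i) v0 = lam i *: v0.

Definition word_act (w : seq letter) (z : V) : V :=
  foldr (fun p z => act (delta_mx p.1 p.2) z) z w.

Definition tensor_map : tensor -> V := lext (fun w : gl_word n => word_act w v0).

Lemma word_act_lin w c u z : word_act w (c *: u + z) = c *: word_act w u + word_act w z.
Proof. by elim: w => //= p w ->; rewrite (gl_act_linear_r actP). Qed.

Lemma word_act0 w : word_act w 0 = 0.
Proof. by elim: w => //= p w ->; apply: (endo_0 (act_endo actP _)). Qed.

Lemma tensor_mapZ c f : tensor_map (c *: f) = c *: tensor_map f.
Proof.
have h0 : tensor_map 0 = 0 by rewrite /tensor_map /lext msupp0 big_seq_fset0.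
by have := lext_linear (fun w : gl_word n => word_act w v0) c f 0; rewrite addr0 -!/(tensor_map _) h0 addr0.
Qed.

Lemma tensor_mapD f g : tensor_map (f + g) = tensor_map f + tensor_map g.
Proof.
by have := lext_linear (fun w : gl_word n => word_act w v0) 1 f g; rewrite !scale1r.
Qed.

Lemma tensor_map_sum (I : Type) (r : seq I) (F : I -> tensor) :
  tensor_map (\sum_(i <- r) F i) = \sum_(i <- r) tensor_map (F i).
Proof.
elim: r => [|i r IH]; last by rewrite !big_cons tensor_mapD IH.
by rewrite !big_nil /tensor_map /lext msupp0 big_seq_fset0.
Qed.

Lemma tensor_mapU w : tensor_map << w >> = word_act w v0.
Proof. exact: lextU. Qed.

Lemma tensor_mapB f g : tensor_map (f - g) = tensor_map f - tensor_map g.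
Proof. by rewrite tensor_mapD -(scaleN1r g) tensor_mapZ scaleN1r. Qed.

Lemma tensor_map_word w g : tensor_map (<< w >> * g) = word_act w (tensor_map g).
Proof.
move: g; apply: malg_lin_ext => [c x y|c x y|w'].
- by rewrite mulrDr malg_scaleAr tensor_mapD tensor_mapZ.
- by rewrite tensor_mapD tensor_mapZ word_act_lin.
- by rewrite malgUM 2!tensor_mapU fmM /word_act foldr_cat.
Qed.

Lemma tensor_map_mul0 f g : tensor_map g = 0 -> tensor_map (f * g) = 0.
Proof.
move=> g0; move: f; apply: (@malg_lin_ext _ _ _ (fun f => tensor_map (f * g)) (fun=> 0)).
- by move=> c x y; rewrite mulrDl -scalerAl tensor_mapD tensor_mapZ.
- by move=> c x y; rewrite scaler0 addr0.
- by move=> w; rewrite tensor_map_word g0 word_act0.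
Qed.

Lemma tensor_map_inj x g : tensor_map (gl_inj x * g) = act x (tensor_map g).
Proof.
rewrite gl_injE {2}(matrix_sum_delta x) (act_suml actP) mulr_suml tensor_map_sum.
apply: eq_bigr => i _; rewrite (act_suml actP) mulr_suml tensor_map_sum.
apply: eq_bigr => j _; rewrite -scalerAl tensor_mapZ tensor_map_word (act_Zl actP).
by rewrite fmU.
Qed.

Lemma tensor_map1 : tensor_map 1 = v0.
Proof. by rewrite -[1]/(<< (mone : gl_word n) >> : tensor) tensor_mapU fm1. Qed.

Lemma tensor_map_ideal f : verma_ideal lam f -> tensor_map f = 0.
Proof.
elim=> [|f1 g _ hf _ hg|f1 g _|x y f1|i j ij|i].
- by have := tensor_map_sum [::] (fun i : nat => 0); rewrite !big_nil.
- by rewrite tensor_mapD hf hg addr0.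
- exact: tensor_map_mul0.
- exact: (ring_map_lie _ actP tensor_mapB (tensor_map_inj x) (tensor_map_inj y) (tensor_map_inj _)).
- by apply: (ring_map_gen (tensor_map_inj _)); rewrite tensor_map1 v0_raise.
- rewrite tensor_mapB tensor_mapZ tensor_map1.
  apply/eqP; rewrite subr_eq0; apply/eqP.
  by apply: (ring_map_gen (tensor_map_inj _)); rewrite tensor_map1 v0_cartan.
Qed.

Lemma verma_universal : exists f : verma lam -> V,
  [/\ forall (c : K) (u z : verma lam), f (c *: u + z) = c *: f u + f z,
      forall (x : 'M[K]_n) (z : verma lam), f (gl_act x z) = act x (f z) & f verma_gen = v0].
Proof.
pose f (z : verma lam) := tensor_map (lquot_repr z).
have fpi g : f (lquot_pi (verma_ideal_subspace lam) g) = tensor_map g.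
  apply/eqP; rewrite -subr_eq0 /f -scaleN1r -tensor_mapZ -tensor_mapD scaleN1r; apply/eqP.
  apply: tensor_map_ideal; apply/(lquot_eqP (verma_ideal_subspace lam)); exact: lquot_reprK.
exists f; split=> [c u z|x z|].
- have [[g ->] [g' ->]] := (lquot_surj u, lquot_surj z).
  by rewrite -lquot_pi_linear !fpi tensor_mapD tensor_mapZ.
- by have [g ->] := lquot_surj z; rewrite verma_act_pi !fpi tensor_map_inj.
- by rewrite /verma_gen fpi tensor_map1.
Qed.

End Universal.
End VermaModule.

(** * The Verma module as a twisted relation module *)

Section Tableaux.
Variables (K : numFieldType) (n : nat) (t : 'S_n) (b : bool) (lam : 'I_n -> K).
Local Notation G := (chain_graph t b).
Local Notation nc := (nc t).
Local Notation letter := ('I_n * 'I_n)%type.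
Implicit Types (M : tableau K n) (v w x y : vertex n) (d : letter -> nat) (q p : letter).

Definition extremal : tableau K n := [ffun v => lam (t (vc v)) - (rk t v)%:R].
Local Notation L := extremal.
Local Notation inB := (gt_basis_pred G L).

Lemma nc_extremal v : nc L v = lam (t (vc v)).
Proof. by rewrite /nc ffunE subrK. Qed.

(* The root vector attached to the relation between the rows [q.1 - 1] and
   [q.1] of the column [q.2], written in terms of column labels. *)
Definition root_letter q : letter :=
  if (t q.2 < t q.1)%N then (t q.1, t q.2) else (t q.2, t q.1).

Definition root_letters : seq letter := [seq root_letter q | q <- enum [pred q : letter | (q.2 < q.1)%N]].

Lemma root_letters_uniq : uniq root_letters.
Proof.
rewrite map_inj_in_uniq ?enum_uniq // => -[a j] [a' j']; rewrite !mem_enum !inE /root_letter /=.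
by move=> ja ja'; case: ifP => _; case: ifP => _ [] /perm_inj E1 /perm_inj E2; subst=> //; lia.
Qed.

Lemma root_letters_neg : all (@neg n) root_letters.
Proof.
apply/allP => p /mapP[[a j]]; rewrite mem_enum inE /= => ja ->; rewrite /root_letter /neg /=.
have [//|l] := ltnP (t j) (t a); rewrite /= ltn_neqAle l andbT.
by apply: contraTneq ja => /val_inj/perm_inj ->; rewrite ltnn.
Qed.

Lemma root_letters_all p : neg p -> p \in root_letters.
Proof.
case: p => i j; rewrite /neg /= => ji; apply/mapP.
pose a := (t^-1%g i); pose c := (t^-1%g j).
have ta : t a = i by rewrite permKV.
have tc : t c = j by rewrite permKV.
have [ca|ac] := ltnP c a.
  by exists (a, c); rewrite ?mem_enum ?inE // /root_letter /= ta tc ji.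
exists (c, a); last by rewrite /root_letter /= ta tc ltnNge (ltnW ji).
rewrite mem_enum inE /= ltn_neqAle ac andbT; apply: contraTneq ji => /val_inj E.
by rewrite -ta -tc E ltnn.
Qed.

(** The factor [p.1 - p.2] is the amount that one application of the lowering unit [p] adds to the
    weight, so this degree is the [height] of the corresponding tableau by [height_tab]. *)
Definition mht d : nat := (\sum_(p <- root_letters) (p.1 - p.2) * d p)%N.

Lemma mht_ge d p : p \in root_letters -> (d p <= mht d)%N.
Proof.
move=> pr; rewrite /mht (big_rem p) //=; apply: leq_trans (leq_addr _ _).
by rewrite leq_pmull // subn_gt0; apply: (allP root_letters_neg).
Qed.

Definition rsgn q : K := if (t q.2 < t q.1)%N then -1 else 1.

Definition offset d v : K :=
  \sum_(a : 'I_n | (vr v < a)%N) rsgn (a, vc v) * (d (root_letter (a, vc v)))%:R.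

(** The exponent of a root vector becomes the slack of the vertical relation attached to it,
    accumulated downwards from the fixed top row. *)
Definition tab d : tableau K n := [ffun v => L v + offset d v].

Lemma nc_tab d v : nc (tab d) v = lam (t (vc v)) + offset d v.
Proof. by rewrite -nc_extremal /nc ffunE addrAC. Qed.

Lemma offset_above d x y : vc x = vc y -> vr x = (vr y).+1 :> nat ->
  offset d y = rsgn (vr x, vc y) * (d (root_letter (vr x, vc y)))%:R + offset d x.
Proof.
move=> c r; rewrite /offset (bigD1 (vr x)) /= ?r ?ltnSn //; congr (_ + _).
apply: eq_big => [a|a _]; last by rewrite c.
by rewrite -(inj_eq val_inj) /=; lia.
Qed.

Lemma offset_top d v : vrow v = n -> offset d v = 0.
Proof.
by move=> vn; apply: big_pred0 => a; have := ltn_ord a; move: vn; rewrite vrowE; lia.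
Qed.

Lemma nc_tab_above d x y : vc x = vc y -> vr x = (vr y).+1 :> nat ->
  nc (tab d) x - nc (tab d) y = - rsgn (vr x, vc y) * (d (root_letter (vr x, vc y)))%:R.
Proof. by move=> c r; rewrite !nc_tab (offset_above d c r) c; ring. Qed.

Lemma tab_inj d d' : tab d = tab d' -> {in root_letters, d =1 d'}.
Proof.
move=> E p /mapP[[a j]]; rewrite mem_enum inE /= => ja ->.
have h : (j <= a)%N by exact: ltnW.
have [|y r c] := @below_ex n (mkv h); first by [].
have := nc_tab_above d (esym c) r; rewrite E (nc_tab_above d' (esym c) r) c /=.
rewrite -[vr (mkv h)]/a -[vc (mkv h)]/j => /mulfI.
have -> : (- rsgn (a, j) != 0) = true.
  by rewrite /rsgn; case: ifP; rewrite ?opprK ?oppr_eq0 oner_eq0.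
by move=> /(_ isT) /eqP; rewrite eqr_nat => /eqP.
Qed.

Hypothesis rL : realization G L.

Lemma inB_tab d : inB (tab d).
Proof.
apply/(inB_char rL); have top x : vrow x = n -> tab d x = L x.
  by move=> xn; rewrite ffunE offset_top // addr0.
split=> //; apply/satisfies_nc; split=> [x y arr|v w arr].
  case/orP: arr => /and3P[/eqP c /eqP r l].
    rewrite (nc_tab_above d c r) /rsgn /= l opprK mul1r.
    by exists (d (root_letter (vr x, vc y))); rewrite // pmulrn.
  rewrite -opprB (nc_tab_above d c r) /rsgn /= ltnNge (ltnW l) /= mulN1r opprK.
  by exists (d (root_letter (vr y, vc x))); rewrite // pmulrn.
have [_ st] : _ /\ _ := (satisfies_nc t b L).1 rL.1.
by move: (arr) => /and5P[_ /eqP vn /eqP wn _ _]; rewrite !top //; apply: st.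
Qed.

Lemma height_tab d : (0 < n)%N -> height t n.-1 (tab d) = (mht d)%:R.
Proof.
move=> n0; rewrite /height prednK // big_mkord /mht big_map big_enum natr_sum /=.
under eq_bigr => j _ do rewrite big_geq_mkord.
rewrite (exchange_big_dep predT) //= pair_big_dep /=.
apply: eq_big => [[a j] //|[a j] /= ja].
have h : (j <= a)%N by exact: ltnW.
have [|y r c] := @below_ex n (mkv h); first by [].
have r' : a = (vr y).+1 :> nat by [].
rewrite (@nentry_nc _ _ _ _ (mkv h)) // (@nentry_nc _ _ _ _ y) ?c //; last by rewrite r'.
rewrite (nc_tab_above d (esym c) r) -[vr (mkv h)]/a c -[vc (mkv h)]/j !labE.
rewrite /rsgn /root_letter /=; case: ltngtP => [l|l|/val_inj/perm_inj E].
- by rewrite /= natrM natrB ?(ltnW l) // opprK mul1r.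
- by rewrite /= natrM natrB ?(ltnW l) //; ring.
- by rewrite E ltnn in ja.
Qed.

Lemma tight_extremal (k : 'I_n) : tight t k L = L.
Proof. by apply/ffunP => v; rewrite ffunE nc_extremal up_vc -nc_extremal /nc addrK. Qed.

Lemma tight_top (k : 'I_n) M : k = n.-1 :> nat -> inB M -> tight t k M = L.
Proof.
move=> kn /(inB_char rL)[_ top]; apply/ffunP => v; rewrite ffunE.
have vk : (vr v <= k)%N by have := ltn_ord (vr v); lia.
have un : vrow (up k v) = n by rewrite vrowE up_vr //; have := ltn_ord k; lia.
have -> : nc M (up k v) = nc L (up k v) by rewrite /nc top.
by rewrite nc_extremal up_vc -nc_extremal /nc addrK.
Qed.

End Tableaux.

Lemma square_inverse (K : numFieldType) (I : finType) (A C : I -> I -> K) :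
  (forall i k, \sum_j C i j * A j k = (i == k)%:R) ->
  forall i k, \sum_j A i j * C j k = (i == k)%:R.
Proof.
move=> CA; pose mx (F : I -> I -> K) : 'M[K]_#|I| := \matrix_(i, j) F (enum_val i) (enum_val j).
have mulE (F F' : I -> I -> K) (i k : 'I_#|I|) :
    (mx F *m mx F') i k = \sum_j F (enum_val i) j * F' j (enum_val k).
  rewrite mxE (reindex (@enum_rank I)) /=; last exact: onW_bij (enum_rank_bij I).
  by apply: eq_bigr => j _; rewrite !mxE enum_rankK.
have h : mx C *m mx A = 1%:M.
  by apply/matrixP => i k; rewrite mulE CA mxE (inj_eq enum_val_inj).
move=> i k; have := congr1 (fun X : 'M[K]_#|I| => X (enum_rank i) (enum_rank k)) (mulmx1C h).
by rewrite mulE !enum_rankK mxE (inj_eq enum_rank_inj).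
Qed.

(** * Injectivity by counting in bounded degree *)

Section Injectivity.
Variables (K : numFieldType) (n : nat) (t : 'S_n) (b : bool) (lam : 'I_n -> K).
Local Notation G := (chain_graph t b).
Local Notation L := (extremal t lam).
Local Notation inB := (gt_basis_pred G L).
Local Notation letter := ('I_n * 'I_n)%type.
Local Notation ps := (root_letters t).
Implicit Types (M : tableau K n) (d : letter -> nat) (p : letter).
Hypothesis rL : realization G L.
Variables (V : lmodType K) (gv : tableau K n -> V) (act : 'M[K]_n -> V -> V).
Hypothesis actP : is_gl_action act.
Local Notation E := (glE actP).
Hypothesis gv_span : forall z : V, exists (r : seq (tableau K n)) (d : tableau K n -> K),
  all inB r /\ z = \sum_(M <- r) d M *: gv M.
Variable Dg : (tableau K n -> K) -> endo V.
Hypothesis DgE : forall g M, inB M -> Dg g (gv M) = g M *: gv M.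
Hypothesis cartanE : forall (i : 'I_n) M, inB M -> E i i (gv M) = hval i M *: gv M.
Variable co : tableau K n -> V -> K.
Hypothesis co_lin : forall M c u z, co M (c *: u + z) = c * co M u + co M z.
Hypothesis co_gv : forall M M', inB M -> inB M' -> co M (gv M') = (M == M')%:R.

Variables (U : lmodType K) (actU : 'M[K]_n -> U -> U) (actUP : is_gl_action actU).
Local Notation EU := (glE actUP).
Variables (u0 : U) (f : U -> V).
Hypothesis f_lin : forall c u z, f (c *: u + z) = c *: f u + f z.
Hypothesis f_act : forall (i j : 'I_n) z, f (EU i j z) = E (t^-1%g i) (t^-1%g j) (f z).
Hypothesis f_u0 : f u0 = gv L.
Hypothesis f_surj : forall z, exists u, f u = z.
Hypothesis u_span : forall u, exists r, monspan actUP u0 ps r u.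
Local Notation monU := (mon actUP u0 ps).

Variable k : 'I_n.
Hypothesis kn : k = n.-1 :> nat.

Let leqk (i : 'I_n) : (i <= k)%N.
Proof. by have := ltn_ord i; lia. Qed.

Let inBL : inB L.
Proof. by apply/(inB_char rL); split=> //; exact: rL.1. Qed.

Lemma wt_mon d : Dg (wt t k) (f (monU d)) = (wt t k L + (mht t d)%:R) *: f (monU d).
Proof.
rewrite /mht; move: (root_letters_neg t); elim: ps => [_|p s IH /andP[np ns]].
  by rewrite big_nil addr0 (f_u0 : f (mon actUP u0 [::] d) = _) (DgE _ inBL).
rewrite mon_cons big_cons natrD; move: (IH ns) => {IH}.
set z := mon actUP u0 s d; set c := \sum_(j <- s) _ => IH.
rewrite natrM mulrC.
have -> : (d p)%:R * (p.1 - p.2)%N%:R = \sum_(0 <= j < d p) (p.1 - p.2)%N%:R :> K.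
  by rewrite sumr_const_nat subn0 mulr_natl.
elim: (d p) => [|m IHm]; first by rewrite big_geq // add0r.
rewrite big_nat_recr // iterS f_act.
rewrite (wt_glE gv_span DgE cartanE) // ?leqk // IHm !labE !permKV.
rewrite -natrB ?(ltnW np) // endo_Z -scalerDl; congr (_ *: _).
by rewrite -!addrA (addrC c%:R).
Qed.

Lemma co_Z M c z : co M (c *: z) = c * co M z.
Proof.
have h0 : co M 0 = 0.
  have := co_lin M 1 0 0; rewrite scaler0 addr0 mul1r => /eqP.
  by rewrite -subr_eq0 opprD addrA subrr add0r oppr_eq0 => /eqP.
by have := co_lin M c z 0; rewrite addr0 h0 addr0.
Qed.

Lemma co_sum M (I : Type) (r : seq I) (F : I -> V) :
  co M (\sum_(i <- r) F i) = \sum_(i <- r) co M (F i).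
Proof.
elim: r => [|i r IH]; first by rewrite !big_nil -(scale0r 0) co_Z mul0r.
by rewrite !big_cons -[F i]scale1r co_lin mul1r scale1r IH.
Qed.

Lemma hw_map_Z c z : f (c *: z) = c *: f z.
Proof.
have h0 : f 0 = 0.
  have := f_lin 1 0 0; rewrite scaler0 addr0 scale1r => /eqP.
  by rewrite -subr_eq0 opprD addrA subrr add0r oppr_eq0 => /eqP.
by have := f_lin c z 0; rewrite addr0 h0 addr0.
Qed.

Lemma hw_map_sum (I : Type) (r : seq I) (F : I -> U) : f (\sum_(i <- r) F i) = \sum_(i <- r) f (F i).
Proof.
elim: r => [|i r IH]; first by rewrite !big_nil -(scale0r 0) hw_map_Z scale0r.
by rewrite !big_cons -[F i]scale1r f_lin !scale1r IH.
Qed.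

Lemma co_Dg M g z : inB M -> co M (Dg g z) = g M * co M z.
Proof.
move=> BM; have [r [c [/allP Br ->]]] := gv_span z.
rewrite endo_lin_sum !co_sum mulr_sumr big_seq [RHS]big_seq; apply: eq_bigr => M' /Br BM'.
rewrite DgE // !co_Z co_gv //; case: eqP => [<-|_]; first by rewrite mulr1 mulrCA mulr1.
by rewrite !mulr0.
Qed.

Lemma wt_height M : inB M -> wt t k M = wt t k L + height t k M.
Proof.
move=> BM; rewrite !wtE //.
rewrite -(tight_extremal t lam k) height_tight addr0; congr (_ + _).
apply: eq_big_nat => j /andP[_ jk].
by rewrite (tight_extremal t lam k) -(tight_top rL kn BM) nentry_tight.
Qed.

(** The image of a monomial and the basis tableau [M] are both eigenvectors of [Dg (wt t k)], with
    eigenvalues exceeding that of [L] by [mht t d] and by the height of [M]; a coordinate survives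
    only if these agree. *)
Lemma co_graded M d : inB M -> height t k M != (mht t d)%:R -> co M (f (monU d)) = 0.
Proof.
move=> BM ne; have := co_Dg (wt t k) (f (monU d)) BM.
rewrite wt_mon co_Z (wt_height BM) => /eqP; rewrite -subr_eq0 -mulrBl opprD addrACA subrr add0r.
by rewrite mulf_eq0 subr_eq0 eq_sym (negPf ne) => /eqP.
Qed.

Lemma monspan_sum u : exists s : seq (K * (letter -> nat)), u = \sum_(e <- s) e.1 *: monU e.2.
Proof.
have [r] := u_span u; elim=> [|c u' z _ [s ->] _ [s' ->]|d _].
- by exists [::]; rewrite big_nil.
- exists ([seq (c * e.1, e.2) | e <- s] ++ s'); rewrite big_cat big_map /= scaler_sumr.
  by congr (_ + _); apply: eq_bigr => e _; rewrite scalerA.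
- by exists [:: (1, d)]; rewrite big_seq1 scale1r.
Qed.

Section Bounded.
Variable H : nat.

(** No exponent exceeds the degree, so [H.+1] values suffice, and exponents off the root letters are
    set to zero so that a monomial has one code. Bounded degree thus gives a finite index type. *)
Definition bnd_pred (g : {ffun letter -> 'I_H.+1}) :=
  [forall p, (p \notin ps) ==> (g p == 0%N :> nat)] && (mht t (fun p => g p) <= H)%N.

Definition bnd : finType := {g : {ffun letter -> 'I_H.+1} | bnd_pred g}.

Definition bnd_fun (i : bnd) : letter -> nat := fun p => val i p.

Lemma bnd_ht i : (mht t (bnd_fun i) <= H)%N.
Proof. by case/andP: (valP i). Qed.

Lemma bnd_inj i j : {in ps, bnd_fun i =1 bnd_fun j} -> i = j.
Proof.
move=> ij; apply: val_inj; apply/ffunP => p; apply: val_inj.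
have [/ij //|np] := boolP (p \in ps).
have h (l : bnd) : val l p = 0%N :> nat.
  by case/andP: (valP l) => /forallP /(_ p); rewrite np => /eqP.
by rewrite /= !h.
Qed.

Lemma bnd_ex d : (mht t d <= H)%N -> exists i : bnd, {in ps, bnd_fun i =1 d}.
Proof.
move=> dH; pose g := [ffun p => if p \in ps then inord (d p) else ord0] : {ffun letter -> 'I_H.+1}.
have gE : {in ps, (fun p => g p : nat) =1 d}.
  by move=> p pp; rewrite ffunE pp inordK // ltnS (leq_trans (mht_ge d pp)).
have gP : bnd_pred g.
  apply/andP; split; first by apply/forallP => p; apply/implyP => /negPf np; rewrite ffunE np.
  rewrite (_ : mht _ _ = mht t d) //; apply: eq_big_seq => p pp; congr (_ * _)%N.
  exact: gE.
by exists (Sub g gP) => p pp; rewrite /bnd_fun /= gE.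
Qed.

Lemma bnd_sum (s : seq (K * (letter -> nat))) : all (fun e => mht t e.2 <= H)%N s ->
  exists x : bnd -> K, \sum_(e <- s) e.1 *: monU e.2 = \sum_i x i *: monU (bnd_fun i).
Proof.
elim: s => [_|[c d] s IH /= /andP[dH sH]].
  by exists (fun=> 0); rewrite big_nil big1 // => i _; rewrite scale0r.
have [x xE] := IH sH; have [i0 i0E] := bnd_ex dH.
exists (fun i => x i + (if i == i0 then c else 0)).
rewrite big_cons xE [RHS](bigD1 i0) //= [X in _ + X](bigD1 i0) //= eqxx scalerDl -!addrA addrCA.
rewrite (eq_mon _ _ i0E); congr (_ + (_ + _)); apply: eq_bigr => i /negPf ->.
by rewrite addr0.
Qed.

Definition bnd_mx (i j : bnd) : K := co (tab t lam (bnd_fun j)) (f (monU (bnd_fun i))).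

(* Surjectivity of [f] gives a one-sided inverse; truncating at height [H] is
   harmless because [f] preserves the grading. *)
Lemma bnd_mx_inv : exists C : bnd -> bnd -> K, forall i j, \sum_l bnd_mx i l * C l j = (i == j)%:R.
Proof.
have n0 : (0 < n)%N by apply: leq_ltn_trans (ltn_ord k).
suff : forall i, exists x : bnd -> K, forall j, \sum_l x l * bnd_mx l j = (i == j)%:R.
  by move/choice => [C CP]; exists C; apply: square_inverse.
move=> i; have [u uE] := f_surj (gv (tab t lam (bnd_fun i))).
have [s sE] := monspan_sum u.
pose s' := [seq e <- s | (mht t e.2 <= H)%N].
have [|x xE] := @bnd_sum s'; first exact: filter_all.
exists x => j.
have -> : (i == j)%:R = co (tab t lam (bnd_fun j)) (f u).
  rewrite uE co_gv; try exact: inB_tab.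
  congr (_%:R); congr nat_of_bool; apply/eqP/eqP => [->//|]; move/tab_inj => ij.
  by apply: bnd_inj => p pp; rewrite ij.
have htE : height t k (tab t lam (bnd_fun j)) = (mht t (bnd_fun j))%:R :> K.
  by rewrite kn height_tab.
transitivity (co (tab t lam (bnd_fun j)) (f (\sum_(e <- s') e.1 *: monU e.2))).
  rewrite xE hw_map_sum co_sum; apply: eq_bigr => l _; by rewrite hw_map_Z co_Z.
rewrite sE !hw_map_sum !co_sum /s' big_filter big_mkcond /=; apply: eq_bigr => e _.
case: leqP => // eH; rewrite hw_map_Z co_Z co_graded ?mulr0 //; first exact: inB_tab.
rewrite htE eqr_nat; apply: contraTneq eH => <-; rewrite -leqNgt; exact: bnd_ht.
Qed.

End Bounded.

(** A given vector involves finitely many monomials, all of degree below some [H]; invertibility of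
    the matrix for that [H] forces its coefficients to vanish. *)
Lemma hw_map_injective u : f u = 0 -> u = 0.
Proof.
move=> fu; have [s sE] := monspan_sum u.
pose H := (\max_(e <- s) mht t e.2)%N.
have [|x xE] := @bnd_sum H s.
  by apply/allP => e es; rewrite /H (big_rem e) //= leq_maxl.
have [C CP] := bnd_mx_inv H.
have xA j : \sum_i x i * bnd_mx i j = 0.
  transitivity (co (tab t lam (bnd_fun j)) (f u)).
    by rewrite sE xE hw_map_sum co_sum; apply: eq_bigr => i _; rewrite hw_map_Z co_Z.
  by rewrite fu -(scale0r 0) co_Z mul0r.
have x0 i : x i = 0.
  transitivity (\sum_l x l * (l == i)%:R).
    rewrite (bigD1 i) //= eqxx mulr1 big1 ?addr0 // => l /negPf ->.
    by rewrite mulr0.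
  under eq_bigr => l _ do rewrite -CP mulr_sumr.
  rewrite exchange_big big1 //= => j _.
  by under eq_bigr => l _ do rewrite mulrA; rewrite -mulr_suml xA mul0r.
by rewrite sE xE big1 // => i _; rewrite x0 scale0r.
Qed.

End Injectivity.

(** * Where the hypotheses on the weight are used *)

Section ExtremalTableau.
Variables (K : numFieldType) (n : nat) (t : 'S_n) (b : bool) (lam : 'I_n -> K).
Local Notation G := (chain_graph t b).
Local Notation L := (extremal t lam).
Local Notation inB := (gt_basis_pred G L).
Implicit Types (M : tableau K n) (v w x y : vertex n) (r s : 'I_n).
Hypothesis n2 : (2 <= n)%N.
Hypothesis h1n : forall r s, r = 0%N :> nat -> s = n.-1 :> nat ->
  ~ int_ge (1 - n%:Z) (lam r - lam s).
Hypothesis hrs : forall r s, r <> 0%N :> nat -> r <> s -> r <> n.-1 :> nat ->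
  ~ is_int (lam r - lam s).
Hypothesis bP : reflect
  (forall r s, r = 0%N :> nat -> s = n.-1 :> nat -> is_int (lam r - lam s)) b.

Lemma rk_top v : vrow v = n -> rk t v = t (vc v).
Proof.
move=> vn; rewrite /rk -vrowE vn big_mkord (reindex_inj (@perm_inj _ t^-1)).
under eq_bigr => c _ do rewrite !labE permKV.
rewrite -big_mkcond /= -(big_ord_widen n (fun=> 1%N)) ?sum1_card ?card_ord //.
exact/ltnW/ltn_ord.
Qed.

Lemma weight_int r s : r <> s -> is_int (lam r - lam s) ->
  [/\ b, r = 0%N :> nat & s = n.-1 :> nat] \/ [/\ b, s = 0%N :> nat & r = n.-1 :> nat].
Proof.
move=> rs irs; have isr : is_int (lam s - lam r) by rewrite -opprB; apply: is_intN.
have end_label (x y : 'I_n) : x <> y -> is_int (lam x - lam y) -> x = 0%N :> nat \/ x = n.-1 :> nat.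
  move=> xy ixy; have [x0|x0] := eqVneq (x : nat) 0%N; first by left.
  have [xn|xn] := eqVneq (x : nat) n.-1; first by right.
  by case: (hrs _ xy _ ixy); apply/eqP.
have bI (x y : 'I_n) : x = 0%N :> nat -> y = n.-1 :> nat -> is_int (lam x - lam y) -> b.
  move=> x0 yn ixy; apply/bP => x' y' x'0 y'n.
  have -> : x' = x by apply: val_inj; rewrite /= x0.
  by have -> : y' = y by apply: val_inj; rewrite /= yn.
have sr : s <> r by move/esym.
have [r0|rn] := end_label _ _ rs irs; have [s0|sn] := end_label _ _ sr isr.
- by case: rs; apply: val_inj; rewrite /= r0.
- by left; split=> //; apply: (bI r s).
- by right; split=> //; apply: (bI s r).
- by case: rs; apply: val_inj; rewrite /= rn.
Qed.

Lemma extremal_top_gap v w : b -> vrow v = n -> vrow w = n ->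
  t (vc v) = n.-1 :> nat -> t (vc w) = 0%N :> nat -> int_ge 1 (L v - L w).
Proof.
move=> /bP hb vn wn tv tw; have [m mE] := hb _ _ tw tv.
have mn : ~ (1 - n%:Z <= m) by move=> h; apply: (h1n tw tv); exists m.
exists (- m - n.-1%:Z); first by lia.
rewrite !ffunE !rk_top // tv tw subr0 rmorphB rmorphN /= -mE -pmulrn.
by rewrite opprB addrAC.
Qed.

Lemma extremal_col_int v w : is_int (L v - L w) -> is_int (lam (t (vc v)) - lam (t (vc w))).
Proof.
move=> h; have -> : lam (t (vc v)) - lam (t (vc w)) = L v - L w + ((rk t v)%:R - (rk t w)%:R).
  by rewrite !ffunE; ring.
by apply: is_intD => //; apply: is_intB; [exists (rk t v) | exists (rk t w)]; rewrite pmulrn.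
Qed.

Lemma connect_same v w : connect G v w -> same_component G v w.
Proof. by apply: connect_sub => x y xy; apply: connect1; rewrite xy. Qed.

Lemma same_component_sym v w : same_component G v w -> same_component G w v.
Proof. by rewrite /same_component sym_connect_sym // => x y; rewrite orbC. Qed.

Lemma extremal_realization : realization G L.
Proof.
split.
  apply/satisfies_nc; split=> [x y h|v w /and5P[hb /eqP vn /eqP wn /eqP tv /eqP tw]].
    have c : vc x = vc y by case/orP: h => /and3P[/eqP].
    by rewrite !nc_extremal c subrr; apply: int_ge0.
  by apply: int_geW (extremal_top_gap hb vn wn tv tw).
move=> v w r _ /extremal_col_int ivw.
have [c|c] := eqVneq (vc v) (vc w).
  have -> : v = w by apply: vertex_eq => //; apply: vrow_inj.
  exact: connect0.
have tc : t (vc v) <> t (vc w) by move/perm_inj/eqP; apply/negP.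
case: (weight_int tc ivw) => cr.
  by apply: same_component_sym; apply: connect_same; apply: connect_crit.
by apply: connect_same; apply: connect_crit.
Qed.

(** The numerators compare entries of different rows, so the two exceptional columns must be
    disjoint as a whole. This needs a top gap of at least $1$; the weak inequality of the top arrow
    would allow a coincidence. *)
Lemma extremal_col_neq M v w : inB M -> vc v <> vc w -> M v != M w.
Proof.
have rL := extremal_realization; move=> /(inB_char rL)[sM top] cvw; apply/eqP => E.
have tc : t (vc v) <> t (vc w) by move/perm_inj.
have crit_neq x y : crit t b x y -> M x <> M y.
  move=> [hb tx ty] Exy; have [x' xn xc] := top_ex x; have [y' yn yc] := top_ex y.
  have h1 := first_col_ge sM (esym xc) tx xn.
  have h2 := last_col_ge sM (esym yc) ty yn.
  have h3 : int_ge 1 (M y' - M x').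
    by rewrite !top //; apply: extremal_top_gap => //; rewrite ?xc ?yc.
  have := int_geD (int_geD h2 h3) h1.
  have -> : M y - M y' + (M y' - M x') + (M x' - M x) = 0%:~R by rewrite Exy /=; ring.
  by move/int_geP; lia.
have [x xn xc] := top_ex v; have [y yn yc] := top_ex w.
have : is_int (lam (t (vc v)) - lam (t (vc w))).
  rewrite -xc -yc; apply: extremal_col_int; rewrite -!top //.
  have -> : M x - M y = (M x - M v) - (M y - M w) by rewrite E; ring.
  by apply: is_intB; apply: (col_int sM).
by case/(weight_int tc) => /crit_neq; apply.
Qed.

End ExtremalTableau.

Lemma twist_mx_delta (K : numFieldType) (n : nat) (s : 'S_n) (i j : 'I_n) :
  twist_mx s (delta_mx i j : 'M[K]_n) = delta_mx (s i) (s j).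
Proof. by apply: twist_mxP => k l; rewrite !mxE !(inj_eq perm_inj). Qed.

Lemma inj_surj_bij (A B : choiceType) (f : A -> B) :
  injective f -> (forall y, exists x, f x = y) -> bijective f.
Proof.
by move=> fI /choice[g fg]; exists g => // x; apply: fI; rewrite fg.
Qed.

(** * The isomorphism with the twisted Gelfand-Tsetlin module *)

Section VermaIso.
Variables (K : numFieldType) (n : nat) (t : 'S_n) (b : bool) (lam : 'I_n -> K).
Local Notation G := (chain_graph t b).
Local Notation L := (extremal t lam).
Local Notation inB := (gt_basis_pred G L).
Implicit Types (M : tableau K n) (v w : vertex n) (i j : 'I_n).
Hypothesis n2 : (2 <= n)%N.
Hypothesis rL : realization G L.
Hypothesis col_neq : forall M v w, inB M -> vc v <> vc w -> M v != M w.
Variables (V : lmodType K) (gv : tableau K n -> V) (act : 'M[K]_n -> V -> V).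
Hypothesis actP : is_gl_action act.
Hypothesis gv_out : forall M, ~~ inB M -> gv M = 0.
Hypothesis gv_span : forall z : V, exists (r : seq (tableau K n)) (d : tableau K n -> K),
  all inB r /\ z = \sum_(M <- r) d M *: gv M.
Hypothesis gv_ext : forall F : tableau K n -> V,
  exists f : endo V, forall M, inB M -> f (gv M) = F M.
Variable co : tableau K n -> V -> K.
Hypothesis co_lin : forall M c u z, co M (c *: u + z) = c * co M u + co M z.
Hypothesis co_gv : forall M M', inB M -> inB M' -> co M (gv M') = (M == M')%:R.
Hypothesis gt_act : gt_formulas inB gv act.
Local Notation E := (glE actP).

Let raiseE i j M : j = i.+1 :> nat -> inB M ->
  E i j (gv M) = \sum_(v | vrow v == i.+1) coef true M v *: gv (step true v M).
Proof.
move=> ij /gt_act[h _ _]; rewrite -[LHS]/(act (delta_mx i j) (gv M)) h // -sumrN.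
apply: eq_bigr => v /eqP vr; rewrite -scaleNr /coef /sg mulN1r mulNr; congr (- (_ / _) *: _).
by apply: eq_bigl => w; rewrite /adj vr.
Qed.

Let lowerE i j M : j = i.+1 :> nat -> inB M ->
  E j i (gv M) = \sum_(v | vrow v == i.+1) coef false M v *: gv (step false v M).
Proof.
move=> ij /gt_act[_ h _]; rewrite -[LHS]/(act (delta_mx j i) (gv M)) h //.
apply: eq_bigr => v /eqP vr; rewrite /coef /sg opprK mul1r; congr (_ / _ *: _).
by apply: eq_bigl => w; rewrite /adj vr.
Qed.

Let cartanE i M : inB M -> E i i (gv M) = hval i M *: gv M.
Proof. by case/gt_act => _ _ h; apply: h. Qed.

Lemma verma_chain_iso : exists f : verma lam -> V,
  [/\ bijective f,
      forall (c : K) (u z : verma lam), f (c *: u + z) = c *: f u + f z &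
      forall (x : 'M[K]_n) (z : verma lam), f (gl_act x z) = act (twist_mx t^-1 x) (f z)].
Proof.
have [Dg DgE] := choice (fun g : tableau K n -> K => gv_ext (fun M => g M *: gv M)).
have kn : (n.-1 < n)%N by lia.
pose k := Ordinal kn; have lek i : (i <= k)%N by have := ltn_ord i; rewrite /k /=; lia.
have BL : inB L by apply/(inB_char rL); split=> //; exact: rL.1.
have raise0 i j : (i < j)%N -> act (twist_mx t^-1 (delta_mx i j)) (gv L) = 0.
  move=> ij; rewrite twist_mx_delta -[LHS]/(E _ _ (gv L)) -(tight_extremal t lam k).
  by apply: (singular n2 rL gv_out gv_span DgE raiseE lowerE cartanE) => //; rewrite !permKV.
have weight i : act (twist_mx t^-1 (delta_mx i i)) (gv L) = lam i *: gv L.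
  rewrite twist_mx_delta -[LHS]/(E _ _ (gv L)) cartanE //; congr (_ *: _).
  rewrite -{1}(tight_extremal t lam k) hval_tight //.
  have h : (t^-1%g i <= k)%N by exact: lek.
  by rewrite (@nentry_nc _ _ _ _ (mkv h)) // nc_extremal /vc /= permKV.
have twP : is_gl_action (fun x (z : V) => act (twist_mx t^-1 x) z) := gl_twistP t^-1 (GlModule actP).
have [f [f_lin f_act f_gen]] := verma_universal twP raise0 weight; exists f.
have f_glE i j z : f (glE (gl_actP (verma lam)) i j z) = E (t^-1%g i) (t^-1%g j) (f z).
  by rewrite -[LHS]/(f (gl_act (delta_mx i j) z)) f_act /= twist_mx_delta.
have f0 : f 0 = 0.
  have := f_lin 1 0 0; rewrite scaler0 addr0 scale1r => /eqP.
  by rewrite -subr_eq0 opprD addrA subrr add0r oppr_eq0 => /eqP.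
have f_surj z : exists u, f u = z.
  pose P (z' : V) := exists u, f u = z'.
  have PZ d u u' : P u -> P u' -> P (d *: u + u').
    by move=> [y <-] [y' <-]; exists (d *: y + y').
  have P0 : P 0 by exists 0.
  have PE (a c : 'I_n) z' : (a <= k)%N -> (c <= k)%N -> P z' -> P (E a c z').
    move=> _ _ [u <-]; exists (glE (gl_actP (verma lam)) (t a) (t c) u).
    by rewrite f_glE !permK.
  have Pgv M : inB M -> P (gv M).
    move=> BM; apply: (cyclic_all n2 rL col_neq gv_out gv_span DgE raiseE lowerE cartanE P0 PZ PE BM).
    by rewrite (tight_top rL) //; exists (verma_gen lam).
  rewrite -/(P z); have [r [d [Br ->]]] := gv_span z.
  elim: r Br => [_|M r IH /andP[BM Br]]; first by rewrite big_nil.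
  by rewrite big_cons; apply: PZ; [apply: Pgv | apply: IH].
have u_span u : exists r, monspan (gl_actP (verma lam)) (verma_gen lam) (root_letters t) r u.
  have [r wr] := verma_words u; exists r.
  apply: (words_monspan (@verma_raise _ _ lam) (@verma_weight _ _ lam)) => //.
  - exact: root_letters_uniq.
  - exact: root_letters_neg.
  - exact: root_letters_all.
have f_inj u : f u = 0 -> u = 0.
  exact: (hw_map_injective rL gv_span DgE cartanE co_lin co_gv f_lin f_glE f_gen f_surj u_span
    (erefl : k = n.-1 :> nat)).
split=> //; apply: inj_surj_bij => // u u' uu; apply/eqP; rewrite -subr_eq0; apply/eqP.
apply: f_inj; rewrite addrC -scaleN1r f_lin uu scaleN1r addrC.
exact: subrr.
Qed.

End VermaIso.

Section Coordinates.
Variables (K : numFieldType) (n : nat) (G : rel (vertex n)) (L : tableau K n).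
Local Notation inB := (gt_basis_pred G L).
Local Notation gv := (gt_vec G L).
Implicit Types M : tableau K n.

Definition gt_coord M (z : gt_space G L) : K :=
  if insub M is Some i then (z : {malg K[gt_basis G L]})@_i else 0.

Lemma gt_coord_lin M c u z : gt_coord M (c *: u + z) = c * gt_coord M u + gt_coord M z.
Proof.
rewrite /gt_coord; case: insubP => [i _ _|_]; last by rewrite mulr0 addr0.
by rewrite mcoeffD mcoeffZ.
Qed.

Lemma gt_coord_vec M M' : inB M -> inB M' -> gt_coord M (gv M') = (M == M')%:R.
Proof.
move=> BM BM'; rewrite gt_vecE.
have -> z : gt_coord M z = (z : {malg K[gt_basis G L]})@_(Sub M BM) by rewrite /gt_coord insubT.
by rewrite mcoeffU -(inj_eq val_inj) eq_sym.
Qed.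

Lemma gt_space_span (z : gt_space G L) : exists (r : seq (tableau K n)) (d : tableau K n -> K),
  all inB r /\ z = \sum_(M <- r) d M *: gv M.
Proof.
exists [seq val i | i <- (msupp (z : {malg K[gt_basis G L]}) : seq (gt_basis G L))].
exists (fun M => gt_coord M z); split.
  by apply/allP => M /mapP[i _ ->]; apply: (valP i).
rewrite big_map {1}[z]malg_sumU; apply: eq_bigr => i _.
by rewrite /gt_coord /gt_vec valK.
Qed.

End Coordinates.

Theorem proposition5p8 (R : realType) (n : nat) (hn : (2 <= n)%N)
    (lam : 'I_n -> R[i])
    (h1n : forall i j : 'I_n, i = 0%N :> nat -> j = n.-1 :> nat ->
       ~ int_ge (1 - n%:Z) (lam i - lam j))
    (hrs : forall r s : 'I_n,
       r <> 0%N :> nat -> r <> s -> r <> n.-1 :> nat ->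
       ~ is_int (lam r - lam s))
    (sigma : 'S_n) :
  sigma_relation_module sigma (verma lam).
Proof.
(* In $N^\sigma$ the unit $E_{ij}$ acts as $E_{\sigma(i)\sigma(j)}$, so index $\sigma(i)$ must carry
   the label $i$. *)
pose t : 'S_n := sigma^-1%g.
(* The top arrow demands an integral difference, so it is present only when $\lambda_1-\lambda_n$ is
   an integer; in that case it is what joins the two columns into one component, as a realization
   requires. *)
pose b := `[< forall r s : 'I_n, r = 0%N :> nat -> s = n.-1 :> nat -> is_int (lam r - lam s) >].
have bP : reflect _ b := asboolP _.
pose L := extremal t lam.
have rL : realization (chain_graph t b) L by apply: extremal_realization.
have neq (M : tableau R[i] n) (v w : vertex n) : gt_basis_pred (chain_graph t b) L M ->
  vc v <> vc w -> M v != M w by apply: extremal_col_neq.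
have rG := chain_relation_graph R[i] t b hn.
have [_ _ /(_ L rL)[act [actP gt_act]]] := rG.
exists (GlModule actP); split.
  exists (chain_graph t b), L, act, actP; split=> //.
  by exists id; split=> //; exists id.
have := verma_chain_iso hn rL neq actP (@gt_vec_out _ _ _ L)
  (@gt_space_span _ _ _ L) (@lext_endo_ex _ _ _ L) (@gt_coord_lin _ _ _ L)
  (@gt_coord_vec _ _ _ L) gt_act.
by rewrite /t invgK.
Qed.
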